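(* Consider the Fourier Neural Operator (FNO) setting described in the context, under the activation and initialization assumptions stated there. Then, with probability at least $1-\frac{2(L+2)}m$ over the initialization, the loss $\mathcal{L}$ is $\beta$-smooth in $B^{\mathrm{Euc}}_{\rho_w,\rho_r,\rho_1}(\theta_0)$, i.e. $\mathcal{L}(\theta')\le\mathcal{L}(\theta)+\langle\theta'-\theta,\nabla_\theta\mathcal{L}(\theta)\rangle+\frac\beta2\|\theta'-\theta\|_2^2$ for all $\theta,\theta'\in B^{\mathrm{Euc}}_{\rho_w,\rho_r,\rho_1}(\theta_0)$, where $\beta>0$ is a constant depending polynomially on the depth $L$ and the radii $\rho_w,\rho_r,\rho_1$ whenever $\sigma_{1,w}+\sigma_{1,r}\le1-\frac{\rho_w+\rho_r}{\sqrt m}$.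
   Context: FNO model. Fix width $m$, depth $L$, encoder dimension $d$, a fixed encoder giving $\alpha^{(0)}=P(u)(x)\in\mathbb{R}^d$, and a pointwise activation $\phi$. $F\in\mathbb{C}^{m\times m}$ is the unitary DFT matrix $F_{kj}=\frac1{\sqrt m}e^{-2\pi\iota(k-1)(j-1)/m}$. $\alpha^{(1)}=\phi(\frac1{\sqrt m}W^{(1)}\alpha^{(0)})$, $\alpha^{(l)}=\phi(\frac1{\sqrt m}W^{(l)}\alpha^{(l-1)}+\frac1{\sqrt m}F^*R^{(l)}F\alpha^{(l-1)})$ for $2\le l\le L+1$, $G_\theta(u)(x)=\frac1{\sqrt m}v^\top\alpha^{(L+1)}$; $W^{(1)}\in\mathbb{R}^{m\times d}$, $W^{(l)},R^{(l)}\in\mathbb{R}^{m\times m}$, $v\in\mathbb{R}^m$; $\theta$ collects all parameters. Loss $\mathcal{L}(\theta)=\frac1n\sum_{i=1}^n\frac1R\sum_{r=1}^R(G_\theta(u^{(i)})(x_r)-G^\dagger(u^{(i)})(x_r))^2$ for given input functions $u^{(i)}$, grid points $x_r$ and target operator $G^\dagger$. Assumptions: $\phi$ 1-Lipschitz and $\phi''\le\beta_\phi$; initialization $\theta_0$: entries of $W^{(l)}$ i.i.d. $\mathcal{N}(0,\sigma_{0,w}^2)$, of $R^{(l)}$ i.i.d. $\mathcal{N}(0,\sigma_{0,r}^2)$, $\sigma_{0,w}=\frac{\sigma_{1,w}}{2(1+\sqrt{\log m}/\sqrt{2m})}$, $\sigma_{0,r}=\frac{\sigma_{1,r}}{2(1+\sqrt{\log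 m}/\sqrt{2m})}$, $\sigma_{1,w},\sigma_{1,r}>0$; $v$ random unit vector; $\|\alpha^{(0)}\|_2=\sqrt d$. $B^{\mathrm{Euc}}_{\rho_w,\rho_r,\rho_1}(\theta_0)$: $\|W^{(l)}-W^{(l)}_0\|_2\le\rho_w$, $\|R^{(l)}-R^{(l)}_0\|_2\le\rho_r$, $\|v-v_0\|_2\le\rho_1$.
   Formalization: The activation bound is taken two-sided, |φ''| ≤ β_φ, since with only φ'' ≤ β_φ (φ'' unbounded below) smoothness fails; and since F*R^(l)Fα is complex in general while φ acts on reals, its real part is used in each layer. *)

(* Defs.v *)
From HB Require Import structures.
From mathcomp Require Import all_boot all_order all_algebra.
From mathcomp Require Import all_classical all_reals all_analysis.
From mathcomp Require Import complex.

Set Implicit Arguments.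
Unset Strict Implicit.
Unset Printing Implicit Defensive.

Import Order.TTheory GRing.Theory Num.Theory.
Local Open Scope classical_set_scope.
Local Open Scope ring_scope.

Section FNO.
Variable R : realType.

Definition enorm (p : nat) (x : 'cV[R]_p) : R :=
  Num.sqrt (\sum_(i < p) x i 0 ^+ 2).

Definition opnorm (p q : nat) (A : 'M[R]_(p, q)) : R :=
  sup [set enorm (A *m x) | x in [set x : 'cV[R]_q | enorm x <= 1]].

Definition dft (m : nat) : 'M[R[i]]_m :=
  \matrix_(k < m, j < m)
    ((Num.sqrt (m%:R))^-1%:C *
     (cos (2 * pi * (k * j)%:R / m%:R)
        -i* sin (2 * pi * (k * j)%:R / m%:R)))%C.

Definition adjmx (m : nat) (A : 'M[R[i]]_m) : 'M[R[i]]_m :=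
  map_mx (@conjc R) A^T.

(* the Fourier term F^* R F alpha; phi acts on reals, so the real part is taken *)
Definition fourier_term (m : nat) (Rm : 'M[R]_m) (a : 'cV[R]_m) : 'cV[R]_m :=
  map_mx (@complex.Re R)
    (adjmx (dft m) *m map_mx (fun x => (x%:C)%C) Rm *m dft m
       *m map_mx (fun x => (x%:C)%C) a).

(* layer l (2 <= l <= L+1) is indexed by the ordinal l-2 : 'I_L *)

Definition pidx (m d L : nat) : finType :=
  ((('I_m * 'I_d) + ('I_L * 'I_m * 'I_m)) + (('I_L * 'I_m * 'I_m) + 'I_m))%type.

Definition param (m d L : nat) := {ffun pidx m d L -> R}.

Section Accessors.
Variables (m d L : nat).
Implicit Type th : param m d L.

Definition W1_of th : 'M[R]_(m, d) := \matrix_(i, j) th (inl (inl (i, j))).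
Definition W_of th (l : 'I_L) : 'M[R]_m := \matrix_(i, j) th (inl (inr (l, i, j))).
Definition R_of th (l : 'I_L) : 'M[R]_m := \matrix_(i, j) th (inr (inl (l, i, j))).
Definition v_of th : 'cV[R]_m := \col_i th (inr (inr i)).

(* FNO forward pass G_theta(u)(x), alpha0 = P(u)(x) in R^d *)
Definition fno_layer (phi : R -> R) th (a : 'cV[R]_m) (l : 'I_L) : 'cV[R]_m :=
  map_mx phi ((Num.sqrt m%:R)^-1 *: (W_of th l *m a)
              + (Num.sqrt m%:R)^-1 *: fourier_term (R_of th l) a).

Definition fno (phi : R -> R) th (alpha0 : 'cV[R]_d) : R :=
  let a1 := map_mx phi ((Num.sqrt m%:R)^-1 *: (W1_of th *m alpha0)) in
  let aL := foldl (fno_layer phi th) a1 (enum 'I_L) in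
  (Num.sqrt m%:R)^-1 * ((v_of th)^T *m aL) 0 0.

(* empirical loss; data alpha0 i r = P(u^(i))(x_r), y i r = G^dagger(u^(i))(x_r) *)
Definition fno_loss (n K : nat) (phi : R -> R)
    (alpha0 : 'I_n -> 'I_K -> 'cV[R]_d) (y : 'I_n -> 'I_K -> R) th : R :=
  (n%:R)^-1 * \sum_(i < n) ((K%:R)^-1 *
     \sum_(r < K) (fno phi th (alpha0 i r) - y i r) ^+ 2).

Definition pbasis (c : pidx m d L) : param m d L := [ffun c' => (c' == c)%:R].

Definition ppartial (f : param m d L -> R) th (c : pidx m d L) : R :=
  derive1 (fun t : R => f (th + t *: pbasis c)) 0.

Definition grad_inner (f : param m d L -> R) th (delta : param m d L) : R :=
  \sum_(c : pidx m d L) delta c * ppartial f th c.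

Definition pnorm2 (delta : param m d L) : R := \sum_(c : pidx m d L) delta c ^+ 2.

Definition in_ball (rw rr r1 : R) (th0 th : param m d L) : Prop :=
  opnorm (W1_of th - W1_of th0) <= rw /\
  (forall l, opnorm (W_of th l - W_of th0 l) <= rw) /\
  (forall l, opnorm (R_of th l - R_of th0 l) <= rr) /\
  enorm (v_of th - v_of th0) <= r1.

Definition smooth_on_ball (f : param m d L -> R) (beta rw rr r1 : R)
    (th0 : param m d L) : Prop :=
  forall th th', in_ball rw rr r1 th0 th -> in_ball rw rr r1 th0 th' ->
    f th' <= f th + grad_inner f th (th' - th) + beta / 2 * pnorm2 (th' - th).

End Accessors.

Definition sigma0 (m : nat) (s1 : R) : R :=
  s1 / (2 * (1 + Num.sqrt (ln m%:R) / Num.sqrt (2 * m%:R))).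

(* Random initialization: a family X of real random variables indexed by pidx.
   Entries of W^(l) ~ N(0, sigma_{0,w}^2), entries of R^(l) ~ N(0, sigma_{0,r}^2),
   and a standard Gaussian vector g whose normalization g/||g|| is v_0 (a uniformly
   random unit vector); all scalar variables mutually independent. *)
Definition init_std (m d L : nat) (s1w s1r : R) (c : pidx m d L) : R :=
  match c with
  | inl _ => sigma0 m s1w
  | inr (inl _) => sigma0 m s1r
  | inr (inr _) => 1
  end.

Definition mutually_independent (dT : measure_display) (T : measurableType dT)
    (P : probability T R) (I : finType) (X : I -> T -> R) : Prop :=
  forall (J : {set I}) (B : I -> set R), (forall i, measurable (B i)) ->
    P [set w | forall i, i \in J -> B i (X i w)] =
    (\prod_(i in J) P (X i @^-1` B i))%E.

Definition theta0_of (m d L : nat) (T : Type) (X : pidx m d L -> T -> R) (w : T)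
    : param m d L :=
  let g : 'cV[R]_m := \col_i X (inr (inr i)) w in
  [ffun c => match c with
             | inr (inr i) => X c w / enorm g
             | _ => X c w
             end].

End FNO.

(* Main.v *)
(* Besides Chebyshev's inequality for the Frobenius norm of W^(1), the only probabilistic input
   is a bound 2 sqrt m + sqrt (2 ln m), with probability 1 - 1/m, on the spectral norm of a
   standard Gaussian m x m matrix G. It is obtained by the moment method: Gaussian integration
   by parts yields a recursion for E (prod_i tr ((G G^T)^j_i)), and by induction these
   expectations are at most prod_i m^(j_i + 1) Cat(j_i), where Cat is the Catalan number, up to
   a factor of order exp (p^2 / (8 m)) with p = sum_i j_i. Markov's inequality is applied with p
   a power of two of order sqrt (m ln m). With this bound every layer is 1-Lipschitz on the
   ball, so that the first two derivatives of the network along a segment of the ball grow at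
   most polynomially in the depth and the radii. The bound on G needs m to exceed an absolute
   constant; below it a layer has gain at most an absolute constant, which is harmless
   because 2 L < m unless the probability claim is vacuous. *)

Require Import Defs.
From HB Require Import structures.
From mathcomp Require Import all_boot all_order all_algebra.
From mathcomp Require Import all_classical all_reals all_analysis.
From mathcomp Require Import measurable_realfun complex.
From mathcomp Require Import ring lra zify.
Import Order.TTheory GRing.Theory Num.Theory.
Local Open Scope classical_set_scope.
Local Open Scope ring_scope.

Set Implicit Arguments.
Unset Strict Implicit.
Unset Printing Implicit Defensive.

(** * Gaussian integration by parts *)

Section gaussian_moments.
Variable R : realType.
Notation mu := (@lebesgue_measure R).

(** The scale [sigma0] is calibrated so that [sigma0 m s] times 2 sqrt m + sqrt (2 ln m) is exactly
    s sqrt m. The norm bound therefore needs the sharp leading constant 2: a constant factor lost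
    there, as in a covering argument, would let every layer expand by that factor and make the
    smoothness constant exponential in [L]. Hence the constant 1/8 in the exponent matters. With p =
    a sqrt (m ln m), Markov's inequality at level 1/m asks for a^2/8 + 2 < sqrt 2 * a up to
    lower-order terms. This holds on [3, 6], an interval of ratio two, so p can be a power of two;
    for such p an iterated Cauchy-Schwarz inequality compares |G x|^(2p) with tr ((G G^T)^p) without
    diagonalizing. Products of traces are the object of the induction because integration by parts
    cuts one trace into two, so that a recursion for single traces would not close. *)

Lemma ge0_integral_normal_prob (s : R) (f : R -> \bar R) :
  measurable_fun setT f -> (forall x, 0 <= f x)%E ->
  (\int[normal_prob 0 s]_x f x = \int[mu]_x (f x * (normal_pdf 0 s x)%:E))%E.
Proof.
move=> mf f0.
have dom := normal_prob_dominates (0 : R) s.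
rewrite -(Radon_Nikodym_SigmaFinite.change_of_variables dom)//.
apply: ae_eq_integral => //.
- apply: emeasurable_funM => //.
  exact: measurable_int (Radon_Nikodym_SigmaFinite.f_integrable dom).
- apply: emeasurable_funM => //; apply/measurable_EFinP.
  exact: measurable_normal_pdf.
- apply: ae_eqe_mul2l; apply: integral_ae_eq => //.
  + exact: Radon_Nikodym_SigmaFinite.f_integrable.
  + by apply/measurable_EFinP; exact: measurable_normal_pdf.
  + by move=> A _ mA; rewrite -Radon_Nikodym_SigmaFinite.f_integral.
Qed.

(** The Radon-Nikodym derivative of [normal_prob 0 s] and [normal_pdf 0 s] have the same integral
    over every measurable set, so they agree almost everywhere. The version for nonnegative
    functions, applied to the absolute value, supplies the integrability that the change of
    variables requires. *)
Lemma integral_normal_prob (s : R) (f : R -> R) :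
  measurable_fun setT f ->
  mu.-integrable setT (EFin \o (fun x => f x * normal_pdf 0 s x)) ->
  (normal_prob 0 s).-integrable setT (EFin \o f) /\
  (\int[normal_prob 0 s]_x (f x)%:E = \int[mu]_x (f x * normal_pdf 0 s x)%:E)%E.
Proof.
move=> mf intf.
have mEf : measurable_fun setT (EFin \o f) by exact/measurable_EFinP.
have dom := normal_prob_dominates (0 : R) s.
have ifN : (normal_prob 0 s).-integrable setT (EFin \o f).
  apply/integrableP; split => //.
  rewrite ge0_integral_normal_prob//; last exact: measurableT_comp.
  case/integrableP : intf => _; congr (_ < _)%E; apply: eq_integral => x _ /=.
  by rewrite normrM EFinM (ger0_norm (normal_pdf_ge0 _ _ _)).
split=> //.
rewrite -(Radon_Nikodym_change_of_variables dom measurableT ifN).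
apply: ae_eq_integral => //.
- exact: emeasurable_funM.
- apply/measurable_EFinP; apply: measurable_funM => //; exact: measurable_normal_pdf.
- have : ae_eq mu setT (fun x => (f x)%:E * (normal_pdf 0 s x)%:E)%E
      (fun x => (f x)%:E * Radon_Nikodym (charge_of_finite_measure (normal_prob 0 s)) mu x)%E.
    apply: ae_eqe_mul2l; apply: integral_ae_eq => //.
    + by have := integrable_normal_pdf 0 s.
    + by move=> A _ mA; rewrite -Radon_Nikodym_integral.
  by move/ae_eq_sym; apply: filterS => x h _; rewrite h// -EFinM.
Qed.

(** With y = x^2 / (4 s^2) the density is a multiple of exp (- 2 y). One factor exp (- y) absorbs
    the power of x, since y^(n+1) <= (n+1)! exp y; the other is, up to scaling, the density of
    deviation sqrt 2 * s, which is integrable. *)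
Lemma exprn_normal_pdf_le (s : R) (n : nat) : 0 < s ->
  exists C, forall x, `|x ^+ n * normal_pdf 0 s x| <= C * normal_pdf 0 (Num.sqrt 2 * s) x.
Proof.
move=> s0.
have s0' : s != 0 by rewrite gt_eqF.
have s20 : Num.sqrt 2 * s != 0 by rewrite mulf_neq0 ?gt_eqF ?sqrtr_gt0.
have pk0 := normal_peak_gt0 s20.
exists ((normal_peak s / normal_peak (Num.sqrt 2 * s)) *
  (1 + (4 * s ^+ 2) ^+ n.+1 * n.+1`!%:R)) => x.
rewrite normrM (ger0_norm (normal_pdf_ge0 _ _ _)) !normal_pdfE// /normal_fun !subr0.
set y := x ^+ 2 / (4 * s ^+ 2).
have s2 : 0 < 4 * s ^+ 2 by rewrite mulr_gt0// exprn_gt0.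
have y0 : 0 <= y by rewrite divr_ge0 ?sqr_ge0// ltW.
have -> : - x ^+ 2 / (s ^+ 2 *+ 2) = - y - y by rewrite /y; field.
have -> : - x ^+ 2 / ((Num.sqrt 2 * s) ^+ 2 *+ 2) = - y.
  by rewrite exprMn sqr_sqrtr// /y; field.
have xn : `|x ^+ n| <= (1 + (4 * s ^+ 2) ^+ n.+1 * n.+1`!%:R) * expR y.
  have h1 : `|x ^+ n| <= 1 + (x ^+ 2) ^+ n.+1.
    have x20 : 0 <= (x ^+ 2) ^+ n.+1 by rewrite exprn_ge0// sqr_ge0.
    rewrite normrX; have [x1|x1] := leP `|x| 1.
      by apply: (@le_trans _ _ 1); rewrite ?lerDl// exprn_ile1.
    apply: (@le_trans _ _ ((x ^+ 2) ^+ n.+1)); last by rewrite lerDr.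
    rewrite -exprM -[leRHS]ger0_norm; last by rewrite exprM.
    rewrite normrX ler_weXn2l ?(ltW x1)//; lia.
  apply: (le_trans h1); rewrite mulrDl mul1r lerD//.
    by rewrite -expR0 ler_expR.
  have := expR_ge1Dxn n y0; set e := expR y => he.
  have f0 : 0 < (n.+1)`!%:R :> R by rewrite ltr0n fact_gt0.
  have : y ^+ n.+1 <= n.+1`!%:R * e.
    by rewrite mulrC -ler_pdivrMr//; apply: le_trans he; rewrite lerDr.
  rewrite /y expr_div_n ler_pdivrMr ?exprn_gt0// => /le_trans; apply.
  by rewrite mulrC mulrA.
apply: (@le_trans _ _ (((1 + (4 * s ^+ 2) ^+ n.+1 * n.+1`!%:R) * expR y) *
   (normal_peak s * expR (- y - y)))).
  by rewrite ler_wpM2r// mulr_ge0 ?expR_ge0 ?normal_peak_ge0.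
rewrite expRD; set a := 1 + _; set p := normal_peak s; set q := normal_peak (_ * _).
rewrite (_ : a * expR y * _ = a * p * expR (- y) * (expR y * expR (- y))); last by ring.
by rewrite -expRD subrr expR0 mulr1 le_eqVlt; apply/orP; left; apply/eqP; field; rewrite gt_eqF.
Qed.

End gaussian_moments.

Section gaussian_stein.
Import numFieldNormedType.Exports.
Variable R : realType.
Notation mu := (@lebesgue_measure R).
Variable s : R.
Hypothesis s0 : 0 < s.

Let s20 : 0 < Num.sqrt 2 * s. Proof. by rewrite mulr_gt0 ?sqrtr_gt0. Qed.

Lemma integrable_exprn_normal_pdf n :
  mu.-integrable setT (EFin \o (fun x => x ^+ n * normal_pdf 0 s x)).
Proof.
have [C hC] := exprn_normal_pdf_le n s0.
apply: (@le_integrable _ _ _ mu _ measurableT _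
  (fun x => (C * normal_pdf 0 (Num.sqrt 2 * s) x)%:E)) => //.
- apply/measurable_EFinP; apply: measurable_funM.
    exact: measurable_funX.
  exact: measurable_normal_pdf.
- by move=> x _ /=; rewrite lee_fin (le_trans (hC x))// ler_norm.
- under eq_fun do rewrite EFinM.
  by apply: integrableZl => //; exact: (integrable_normal_pdf 0 _).
Qed.

Lemma is_derive_normal_pdf (x : R) :
  is_derive x 1 (normal_pdf 0 s) (- (x / s ^+ 2) * normal_pdf 0 s x).
Proof.
have sn0 : s != 0 by rewrite gt_eqF.
have -> : normal_pdf 0 s = fun x => normal_peak s * expR (- x ^+ 2 / (s ^+ 2 *+ 2)).
  by apply/funext => y; rewrite normal_pdfE// /normal_fun subr0.
have h : is_derive x 1 (fun x : R => - x ^+ 2 / (s ^+ 2 *+ 2)) (- (x / s ^+ 2)).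
  apply: is_derive_eq.
  by rewrite /GRing.scale /=; field.
apply: is_derive_eq.
by rewrite /GRing.scale /=; ring.
Qed.

(** The integrand is the derivative of [x ^+ n * normal_pdf 0 s x], so its integrals over
    [-k-1, k+1] are boundary terms that tend to 0, while dominated convergence identifies their
    limit with the full integral. For [n = 0] the coefficient [n%:R] kills the term with the
    truncated [n.-1]. *)
Lemma integral_deriv_exprn_normal_pdf n :
  (\int[mu]_x (n%:R * (x ^+ n.-1 * normal_pdf 0 s x)
     - (s ^+ 2)^-1 * (x ^+ n.+1 * normal_pdf 0 s x))%:E = 0)%E.
Proof.
set g := fun x : R => n%:R * (x ^+ n.-1 * normal_pdf 0 s x)
     - (s ^+ 2)^-1 * (x ^+ n.+1 * normal_pdf 0 s x).
pose F (x : R) := x ^+ n * normal_pdf 0 s x.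
have sn0 : s != 0 by rewrite gt_eqF.
have Fg (x : R) : is_derive x 1 F (g x).
  have h := is_derive_normal_pdf x.
  have hX : is_derive x 1 (fun y : R => y ^+ n) (n%:R * x ^+ n.-1).
    have := @is_deriveX R R id n x 1 1 (is_derive_id x 1).
    by rewrite /GRing.scale /= mulr1; congr (is_derive _ _ _ _); apply/funext => y; rewrite exprfctE.
  have := is_deriveM hX h; congr (is_derive _ _ _ _).
  by rewrite /g /GRing.scale /= !exprS; field.
have dF (x : R) : derivable F x 1 by have := Fg x; case.
have cF : continuous F by move=> x; exact/differentiable_continuous/derivable1_diffP.
have cg : continuous g.
  have cp := @continuous_normal_pdf R 0 s sn0.
  move=> x; rewrite /g; apply: (@cvgB _ R^o); apply: cvgM;
   try exact: cvg_cst; apply: cvgM; try exact: exprn_continuous; exact: cp.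
have ig : mu.-integrable setT (EFin \o g).
  have h c k : mu.-integrable setT (fun x => (c * (x ^+ k * normal_pdf 0 s x))%:E).
    under eq_fun do rewrite EFinM.
    exact/integrableZl/integrable_exprn_normal_pdf.
  rewrite /comp /g; under eq_fun do rewrite EFinB.
  exact: integrableB.
have mg : measurable_fun setT (EFin \o g) by exact: measurable_int ig.
pose I k : set R := `[- k.+1%:R, k.+1%:R]%classic.
have Ik k : (\int[mu]_(x in I k) (g x)%:E = (F k.+1%:R - F (- k.+1%:R))%:E)%E.
  rewrite /I (@continuous_FTC2 _ g F)//.
  - by rewrite gtrN.
  - exact: continuous_subspaceT.
  - split => //; [exact: cvg_at_right_filter (cF _)|exact: cvg_at_left_filter (cF _)].
  - by move=> x _; rewrite derive1E; apply: derive_val.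
have cvgI : (fun k => (F k.+1%:R - F (- k.+1%:R))%:E) @ \oo --> (\int[mu]_x (g x)%:E)%E.
  have mI k : measurable_fun setT ((EFin \o g) \_ (I k)).
    apply/(measurable_restrictT _ _).1 => //.
      by rewrite /I; exact: measurable_itv.
    exact: measurable_funTS.
  have hcv : {ae mu, forall x, setT x ->
      (fun k => ((EFin \o g) \_ (I k)) x) @ \oo --> (EFin \o g) x}.
    apply: aeW => x _; apply: cvg_near_cst; near=> k.
    rewrite patchE mem_set// /I /= in_itv /= -ler_norml.
    have : `|x| <= k%:R by near: k; exact: nbhs_infty_ger.
    by move=> /le_trans; apply; rewrite ler_nat.
  have hdom : {ae mu, forall x k, setT x ->
      (`|((EFin \o g) \_ (I k)) x| <= (abse \o (EFin \o g)) x)%E}.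
    apply: aeW => x k _; rewrite patchE; case: ifP => // _.
    by rewrite abse0 abse_ge0.
  have [_ _] := @dominated_convergence _ _ R mu _ measurableT _ _ _ mI mg hcv
    (integrable_abse ig) hdom.
  by under eq_fun => k do rewrite -integral_mkcond Ik.
(* Dominating one power more than occurs in [F] gives |F x| <= C' / |x|, so the boundary terms
   vanish like 1/k. *)
have [C hC] := exprn_normal_pdf_le n.+1 s0.
pose C' := C * normal_peak (Num.sqrt 2 * s).
have C0 : 0 <= C.
  have := le_trans (normr_ge0 _) (hC 0).
  by rewrite pmulr_lge0// normal_pdfE ?gt_eqF// mulr_gt0 ?expR_gt0 ?normal_peak_gt0// gt_eqF.
have Fle x : x != 0 -> `|F x| <= C' / `|x|.
  move=> x0; rewrite ler_pdivlMr ?normr_gt0// -normrM.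
  rewrite /F (_ : _ * x = x ^+ n.+1 * normal_pdf 0 s x); last by rewrite [in RHS]exprS; ring.
  by rewrite (le_trans (hC x))// ler_wpM2l// normal_pdf_ub// gt_eqF.
have cvg0 : (fun k => F k.+1%:R - F (- k.+1%:R)) @ \oo --> (0 : R).
  have h0 : (fun k : nat => (C' + C') * k.+1%:R^-1) @ \oo --> (0 : R).
    by rewrite -[X in _ --> X](mulr0 (C' + C')); apply: cvgMr; exact: cvg_harmonic.
  apply/norm_cvg0P; apply: (squeeze_cvgr _ (cvg_cst 0) h0).
  near=> k; rewrite normr_ge0/= (le_trans (ler_normB _ _))// mulrDl lerD//.
    by rewrite (le_trans (Fle _ _))// ger0_norm.
  by rewrite (le_trans (Fle _ _)) ?oppr_eq0// normrN ger0_norm.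
have cvgE : (fun k => (F k.+1%:R - F (- k.+1%:R))%:E) @ \oo --> 0%E.
  by apply: cvg_EFin => //; exact: nearW.
exact: (cvg_unique (@ereal_hausdorff R) cvgI cvgE).
Unshelve. all: by end_near.
Qed.

Lemma integrable_exprn_normal_prob n :
  (normal_prob 0 s).-integrable setT (EFin \o (fun x => x ^+ n)).
Proof.
by have [] := integral_normal_prob _ (integrable_exprn_normal_pdf n).
Qed.

(** Stein's identity E (x f(x)) = s^2 E (f'(x)) for f(x) = x^n. *)
Lemma Rintegral_exprn_normal_prob n :
  \int[normal_prob 0 s]_x (x ^+ n.+1) = s ^+ 2 * (n%:R * \int[normal_prob 0 s]_x (x ^+ n.-1)).
Proof.
have mX k : measurable_fun [set: R] (fun x : R => x ^+ k) by exact: measurable_funX.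
have E k : \int[normal_prob 0 s]_x (x ^+ k) = \int[mu]_x (x ^+ k * normal_pdf 0 s x).
  have [_] := integral_normal_prob (mX k) (integrable_exprn_normal_pdf k).
  by rewrite /Rintegral => ->.
rewrite !E.
have i k c : mu.-integrable setT (EFin \o (fun x => c * (x ^+ k * normal_pdf 0 s x))).
  rewrite /comp; under eq_fun do rewrite EFinM.
  exact/integrableZl/integrable_exprn_normal_pdf.
have : \int[mu]_x (n%:R * (x ^+ n.-1 * normal_pdf 0 s x)
     - (s ^+ 2)^-1 * (x ^+ n.+1 * normal_pdf 0 s x)) = 0.
  by rewrite /Rintegral integral_deriv_exprn_normal_pdf.
rewrite RintegralB// !RintegralZl//; try exact: integrable_exprn_normal_pdf.
move/eqP; rewrite subr_eq0 => /eqP ->.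
by rewrite mulrA divff ?mul1r// gt_eqF// exprn_gt0.
Qed.

End gaussian_stein.

(** * Independence and expectations of monomials *)

Section independence.
Context dT (T : measurableType dT) (R : realType) (P : probability T R).

(** Independence makes the law of the pair the product of the two laws, by uniqueness of the product
    measure on rectangles; Tonelli then gives the integrability of the product and Fubini its
    value. *)
Lemma integral_mul_indep (f h : {RV P >-> R}) :
  (forall A C, measurable A -> measurable C ->
     P (f @^-1` A `&` h @^-1` C) = (P (f @^-1` A) * P (h @^-1` C))%E) ->
  P.-integrable setT (EFin \o f) -> P.-integrable setT (EFin \o h) ->
  P.-integrable setT (EFin \o (fun w => f w * h w)) /\
  \int[P]_w (f w * h w) = \int[P]_w f w * \int[P]_w h w.
Proof.
move=> ind fi hi.
have mf : measurable_fun setT f by [].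
have mh : measurable_fun setT h by [].
have mpair : measurable_fun setT (fun w => (f w, h w)) by exact: measurable_fun_pair.
pose F : {mfun T >-> (R * R)%type} := HB.pack (fun w => (f w, h w))
  (isMeasurableFun.Build _ _ _ _ _ mpair).
pose Pf := distribution P f; pose Ph := distribution P h.
have EP X : measurable X -> (Pf \x Ph)%E X = distribution P F X.
  apply: product_measure_unique => A C mA mC.
  by rewrite /Pf /Ph /distribution /= /pushforward -ind.
have m1 : measurable_fun [set: R * R] (fun z : R * R => z.1 * z.2).
  by apply: measurable_funM; [exact: measurable_fst|exact: measurable_snd].
have mE1 : measurable_fun [set: R * R] (fun z : R * R => (z.1 * z.2)%:E).
  exact/measurable_EFinP.
have mX : measurable_fun [set: R] (fun x : R => `|x|%:E).
  by apply/measurable_EFinP; exact: normr_measurable.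
have eqm (g : R * R -> \bar R) : (\int[distribution P F]_z g z = \int[(Pf \x Ph)%E]_z g z)%E.
  by apply: eq_measure_integral => A mA _; apply: esym; exact: EP.
have ifh : P.-integrable setT (EFin \o (fun w => f w * h w)).
  apply/integrableP; split; first by apply/measurable_EFinP; exact: measurable_funM.
  have <- : (\int[distribution P F]_z `|(z.1 * z.2)%:E| =
      \int[P]_x `|(EFin \o (fun w => f w * h w)%R) x|)%E.
    by rewrite ge0_integral_distribution//; exact: measurableT_comp.
  rewrite eqm fubini_tonelli1//; last exact: measurableT_comp.
  rewrite /fubini_F /=.
  under eq_integral => x _.
    under eq_integral do rewrite normrM EFinM.
    rewrite ge0_integralZl//.
    over.
  rewrite ge0_integralZr//; last exact: integral_ge0.
  rewrite ge0_integral_distribution// ge0_integral_distribution//.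
  case/integrableP : fi => _ fi; case/integrableP : hi => _ hi.
  by apply: lte_mul_pinfty => //; rewrite ?ge0_fin_numE//;
    by apply: integral_ge0 => x _ /=; rewrite lee_fin.
split=> //.
have ipair : (Pf \x Ph)%E.-integrable setT (fun z : R * R => (z.1 * z.2)%:E).
  apply/integrableP; split => //.
  rewrite -eqm ge0_integral_distribution//; last exact: measurableT_comp.
  by case/integrableP : ifh.
have iid (k : {RV P >-> R}) : P.-integrable setT (EFin \o k) ->
    (distribution P k).-integrable setT EFin /\
    (\int[distribution P k]_x x%:E = \int[P]_w (k w)%:E)%E.
  move=> ki; split; last by rewrite integral_distribution.
  by apply: integrable_pushforward.
have [idf Ef] := iid _ fi; have [idh Eh] := iid _ hi.
have ffin : (\int[P]_w (f w)%:E)%E \is a fin_num by exact: integrable_fin_num.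
have hfin : (\int[P]_w (h w)%:E)%E \is a fin_num by exact: integrable_fin_num.
rewrite /Rintegral -fineM//; congr fine.
transitivity (\int[distribution P F]_z (z.1 * z.2)%:E)%E.
  by rewrite integral_distribution.
rewrite eqm -integral12_prod_meas1// /fubini_F /=.
rewrite -Ef -Eh.
under eq_integral => x _.
  under eq_integral do rewrite EFinM.
  rewrite integralZl//.
  over.
by rewrite /= Eh -(fineK hfin) integralZr// Ef.
Qed.

Variables (I : finType) (X : I -> T -> R).
Hypothesis mX : forall c, measurable_fun setT (X c).
Hypothesis indX : mutually_independent P X.

Definition monomial (s : seq I) (e : I -> nat) w := \prod_(i <- s) X i w ^+ e i.

Let cyl (s : seq I) (B : I -> set R) := [set w | forall i, i \in s -> B i (X i w)].

(** A pi-system that generates the events depending on the variables in [s]; on it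
    [mutually_independent] applies directly. *)
Let G s := [set S | exists B : I -> set R, (forall i, measurable (B i)) /\ S = cyl s B].

Let measurable_cyl s B : (forall i, measurable (B i)) -> measurable (cyl s B).
Proof.
move=> mB; elim: s => [|i s ih].
  by rewrite (_ : cyl [::] B = setT)//; apply/seteqP; split.
rewrite (_ : cyl (i :: s) B = (X i @^-1` B i) `&` cyl s B).
  by apply: measurableI => //; rewrite -[X in measurable X]setTI; exact: mX.
apply/seteqP; split => w /=.
  by move=> h; split; [apply: h; rewrite mem_head|move=> j js; apply: h; rewrite inE js orbT].
by move=> [h1 h2] j; rewrite inE => /predU1P[->//|]; exact: h2.
Qed.

Let measurable_monomial_G s e : measurable_fun [set: g_sigma_algebraType (G s)]
  (monomial s e : g_sigma_algebraType (G s) -> R).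
Proof.
suff H s' : {subset s' <= s} -> measurable_fun [set: g_sigma_algebraType (G s)]
  (monomial s' e : g_sigma_algebraType (G s) -> R) by exact: H.
rewrite /monomial; elim: s' => [|i s' ih] sub.
  by under eq_fun do rewrite big_nil; exact: measurable_cst.
under eq_fun do rewrite big_cons.
apply: measurable_funM; last by apply: ih => j js; apply: sub; rewrite inE js orbT.
apply: measurable_funX.
move=> _ B mB; rewrite setTI; apply: sub_sigma_algebra.
exists (fun j => if j == i then B else setT); split; first by move=> j; case: ifP.
apply/seteqP; split => w /=; first by move=> h j _; case: eqP => // ->.
by move/(_ i); rewrite eqxx; apply; apply: sub; rewrite mem_head.
Qed.

Let prob_cyl s B : uniq s -> (forall i, measurable (B i)) ->
  P (cyl s B) = (\prod_(i <- s) P (X i @^-1` B i))%E.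
Proof.
move=> us mB; have := indX [set i in s] mB.
rewrite big_uniq//= => h.
have -> : cyl s B = [set w | forall i, i \in [set j in s]%SET -> B i (X i w)].
  by apply/seteqP; split => w /= hw i; [rewrite inE; exact: hw|move=> ?; apply: hw; rewrite inE].
by rewrite h; apply: eq_bigl => i; rewrite inE.
Qed.

(** Independence is assumed for cylinders only. The finite measures sending C to P (C [&] A') and to
    P A' * P C agree on the cylinders over [s], hence on the sigma-algebra generated by this
    pi-system, and the monomial is measurable for that sigma-algebra. *)
Lemma indep_monomial c s e k A C : uniq (c :: s) -> measurable A -> measurable C ->
  P ((fun w => X c w ^+ k)%R @^-1` A `&` monomial s e @^-1` C) =
  (P ((fun w => X c w ^+ k)%R @^-1` A) * P (monomial s e @^-1` C))%E.
Proof.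
move=> ucs mA mC; have [cs us] : c \notin s /\ uniq s by move: ucs => /= /andP[].
pose A' := [set x : R | A (x ^+ k)].
have mA' : measurable A'.
  have mk : measurable_fun [set: R] (fun x : R => x ^+ k) by exact: measurable_funX.
  by rewrite -[A']setTI; exact: mk.
have mXA : measurable (X c @^-1` A').
  by rewrite -[X in measurable X]setTI; exact: mX.
have pA : (0 <= fine (P (X c @^-1` A')))%R by rewrite fine_ge0.
pose m1 := mrestr P mXA.
pose m2 := mscale (NngNum pA) P.
have fA : P (X c @^-1` A') \is a fin_num by rewrite fin_num_measure.
rewrite [_ @^-1` A](_ : _ = X c @^-1` A')// setIC.
have Gm : G s `<=` @measurable _ T.
  by move=> _ [B [mB ->]]; exact: measurable_cyl.
have m2E S : m2 S = (P (X c @^-1` A') * P S)%E.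
  by rewrite /m2 /mscale /= -[in RHS](fineK fA).
have mC' : <<s G s >> (monomial s e @^-1` C).
  have := @measurable_monomial_G s e measurableT C mC.
  by rewrite setTI.
suff : m1 (monomial s e @^-1` C) = m2 (monomial s e @^-1` C).
  by rewrite m2E.
move: mC'; apply: (@g_sigma_algebra_measure_unique _ _ T (G s) Gm (fun=> setT)).
- move=> _; exists (fun=> setT); split => //.
  by apply/seteqP; split.
- by rewrite bigcup_const//; exists 0%N.
- move=> _ _ [B [mB ->]] [B' [mB' ->]]; exists (fun i => B i `&` B' i); split.
    by move=> i; exact: measurableI.
  apply/seteqP; split => w /=; first by move=> [h1 h2] i si; split; [exact: h1|exact: h2].
  by move=> h; split=> i /h[].
- move=> _ [B [mB ->]].
  pose B' i := if i == c then A' else B i.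
  have mB' i : measurable (B' i) by rewrite /B'; case: ifP.
  have EB : cyl s B `&` X c @^-1` A' = cyl (c :: s) B'.
    apply/seteqP; split => w /=; rewrite /cyl /=.
      move=> [h1 h2] i; rewrite inE /B'; case: eqP => [-> //|_ /=]; exact: h1.
    move=> h; split; last by have := h c; rewrite /B' eqxx mem_head; exact.
    move=> i si; have := h i; rewrite /B' inE si orbT; case: eqP => [ic|_]; last exact.
    by move: cs; rewrite -ic si.
  apply: (etrans _ (esym (m2E _))).
  apply: (@etrans _ _ (P (cyl (c :: s) B'))); first by rewrite -EB.
  rewrite !prob_cyl// big_cons /B' eqxx; congr (_ * _)%E.
  rewrite big_seq [RHS]big_seq; apply: eq_bigr => i si.
  by case: eqP => // ic; move: cs; rewrite -ic si.
- move=> _; have E : m1 setT = P (X c @^-1` A') by rewrite /m1 /mrestr /= setTI.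
  by apply: le_lt_trans (ltry 1); rewrite [leLHS]E probability_le1.
Qed.

Variable sg : I -> R.
Hypothesis sg0 : forall i, 0 < sg i.
Hypothesis lawX : forall c B, measurable B -> P (X c @^-1` B) = normal_prob 0 (sg c) B.

Lemma integral_exprn_gaussian c k :
  P.-integrable setT (EFin \o (fun w => X c w ^+ k)) /\
  \int[P]_w (X c w ^+ k) = \int[normal_prob 0 (sg c)]_x (x ^+ k).
Proof.
have mXc : measurable_fun setT (X c : T -> measurableTypeR R) := mX c.
pose Xc : {RV P >-> measurableTypeR R} := HB.pack (X c : T -> measurableTypeR R)
  (isMeasurableFun.Build _ _ _ _ _ mXc).
have mXk : measurable_fun [set: measurableTypeR R] (EFin \o (fun x : R => x ^+ k)).
  by apply/measurable_EFinP; exact: measurable_funX.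
have eqm (g : R -> \bar R) : (\int[distribution P Xc]_z g z = \int[normal_prob 0 (sg c)]_z g z)%E.
  have := @eq_measure_integral _ (measurableTypeR R) R setT (normal_prob 0 (sg c))
    (distribution P Xc) g.
  by apply=> A mA _; exact: lawX.
have h : P.-integrable setT (EFin \o (fun w => X c w ^+ k)).
  apply/integrableP; split; first by apply/measurable_EFinP; exact: measurable_funX.
  have <- : (\int[distribution P Xc]_z `|(EFin \o (fun x : R => x ^+ k)%R) z| =
      \int[P]_x `|(EFin \o (fun w => X c w ^+ k)%R) x|)%E.
    by rewrite ge0_integral_distribution//; exact: measurableT_comp.
  rewrite eqm.
  by have /integrableP[] := integrable_exprn_normal_prob (sg0 c) k.
split=> //; rewrite /Rintegral -eqm; congr fine.
by rewrite (@integral_distribution _ _ _ _ _ P Xc (EFin \o (fun x : R => x ^+ k))).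
Qed.

Lemma integral_monomial s e : uniq s ->
  P.-integrable setT (EFin \o monomial s e) /\
  \int[P]_w monomial s e w = \prod_(i <- s) \int[normal_prob 0 (sg i)]_x (x ^+ e i).
Proof.
elim: s => [|c s ih] us.
  rewrite /monomial /comp; under eq_fun do rewrite big_nil.
  split; first exact: finite_measure_integrable_cst.
  under eq_Rintegral do rewrite big_nil.
  rewrite (@Rintegral_cst _ _ _ P _ measurableT 1) big_nil mul1r.
  exact: (congr1 fine (probability_setT P)).
have [is_ Es] := ih (proj2 (andP us)).
have [ic Ec] := integral_exprn_gaussian c (e c).
have mf : measurable_fun setT (fun w => X c w ^+ e c) by exact: measurable_funX.
have mh : measurable_fun setT (monomial s e) by apply/measurable_EFinP; exact: measurable_int is_.
pose f : {RV P >-> R} := HB.pack (fun w => X c w ^+ e c) (isMeasurableFun.Build _ _ _ _ _ mf).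
pose h : {RV P >-> R} := HB.pack (monomial s e) (isMeasurableFun.Build _ _ _ _ _ mh).
have [ifh Efh] := integral_mul_indep (f := f) (h := h)
  (fun A C => @indep_monomial c s e (e c) A C us) ic is_.
have E w : monomial (c :: s) e w = f w * h w by rewrite /monomial big_cons.
rewrite /comp; under eq_fun do rewrite E.
split=> //; under eq_Rintegral do rewrite E.
by rewrite Efh big_cons Ec Es.
Qed.

End independence.

(** * Polynomials in independent Gaussian variables *)

Section gaussian_integration_by_parts.
Context dT (T : measurableType dT) (R : realType) (P : probability T R).
Variables (I : finType) (X : I -> T -> R).

(* Partial derivatives of a polynomial in the variables X are only well defined through its
   syntax, since X c is a function on the probability space: hence a relation. *)
Inductive poly_deriv : (T -> R) -> (I -> T -> R) -> Prop :=
| poly_deriv_cst a : poly_deriv (fun=> a) (fun _ _ => 0)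
| poly_deriv_var c : poly_deriv (X c) (fun c' _ => (c' == c)%:R)
| poly_derivD f df g dg : poly_deriv f df -> poly_deriv g dg ->
    poly_deriv (fun w => f w + g w) (fun c w => df c w + dg c w)
| poly_derivM f df g dg : poly_deriv f df -> poly_deriv g dg ->
    poly_deriv (fun w => f w * g w) (fun c w => df c w * g w + f w * dg c w).

Definition set_exp (e : I -> nat) c k := fun i => if i == c then k else e i.

Local Notation M e := (monomial X (index_enum I) e).

Lemma monomial_set_exp e c k w : M (set_exp e c k) w = X c w ^+ k * M (set_exp e c 0) w.
Proof.
rewrite /monomial (bigD1 c)//= [in RHS](bigD1 c)//= /set_exp eqxx expr0 mul1r.
by congr (_ * _); apply: eq_bigr => i /negbTE ->.
Qed.

Lemma set_exp_id e c : set_exp e c (e c) = e.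
Proof. by apply/funext => i; rewrite /set_exp; case: eqP => // ->. Qed.

Lemma monomialE e c w : M e w = X c w ^+ e c * M (set_exp e c 0) w.
Proof. by rewrite -monomial_set_exp set_exp_id. Qed.

(** Normal form of a polynomial with its formal derivatives: a linear combination of monomials. Both
    sides of the integration by parts formula are linear, so on this form it reduces to one monomial
    at a time. *)
Inductive lin_deriv : (T -> R) -> (I -> T -> R) -> Prop :=
| lin_deriv_monomial e :
    lin_deriv (M e) (fun c w => (e c)%:R * M (set_exp e c (e c).-1) w)
| lin_derivD f df g dg : lin_deriv f df -> lin_deriv g dg ->
    lin_deriv (fun w => f w + g w) (fun c w => df c w + dg c w)
| lin_derivZ a f df : lin_deriv f df -> lin_deriv (fun w => a * f w) (fun c w => a * df c w).

Lemma lin_deriv_eq f df g dg : lin_deriv f df -> f =1 g -> (forall c, df c =1 dg c) ->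
  lin_deriv g dg.
Proof.
move=> h fg dfg; have <- : f = g by exact/funext.
by have <- : df = dg by apply/funext => c; exact/funext.
Qed.

Lemma lin_deriv_mulX c f df : lin_deriv f df ->
  lin_deriv (fun w => X c w * f w) (fun c' w => (c' == c)%:R * f w + X c w * df c' w).
Proof.
elim=> [e|{}f {}df g dg _ ihf _ ihg|a {}f {}df _ ihf].
- apply: (lin_deriv_eq (lin_deriv_monomial (set_exp e c (e c).+1))) => [w|c' w].
    by rewrite monomial_set_exp exprS -mulrA -monomialE.
  have [->|cc] := eqVneq c' c.
    have -> k : set_exp (set_exp e c (e c).+1) c k = set_exp e c k.
      by apply/funext => i; rewrite /set_exp; case: eqP.
    rewrite [set_exp e c _ c](_ : _ = (e c).+1); last by rewrite /set_exp eqxx.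
    rewrite mul1r /= set_exp_id.
    rewrite -natr1 mulrDl mul1r addrC; congr (_ + _).
    case: (e c) (monomialE e c w) => [|k] E; first by rewrite !mul0r mulr0.
    by rewrite monomial_set_exp E exprS /=; ring.
  rewrite /= mul0r add0r [set_exp e c _ c']/set_exp (negbTE cc).
  have -> : set_exp (set_exp e c (e c).+1) c' (e c').-1 =
            set_exp (set_exp e c' (e c').-1) c (e c).+1.
    apply/funext => i; rewrite /set_exp; case: eqP => [->|//].
    by rewrite (negbTE cc).
  rewrite monomial_set_exp [M (set_exp e c' _) w](monomialE _ c).
  by rewrite [set_exp e c' _ c]/set_exp eq_sym (negbTE cc) exprS; ring.
- by apply: (lin_deriv_eq (lin_derivD ihf ihg)) => [w|c' w] /=; ring.
- by apply: (lin_deriv_eq (lin_derivZ a ihf)) => [w|c' w] /=; ring.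
Qed.

Lemma poly_deriv_lin f df : poly_deriv f df -> lin_deriv f df.
Proof.
(* The claim is strengthened to products with an arbitrary normal form, so that the product rule can
   be applied factor by factor; the monomial with all exponents 0 recovers it. *)
move=> h; suff H : forall g dg, lin_deriv g dg ->
    lin_deriv (fun w => f w * g w) (fun c w => df c w * g w + f w * dg c w).
  have h1 := lin_deriv_monomial (fun=> 0).
  have E w : M (fun=> 0) w = 1 by rewrite /monomial big1.
  by apply: (lin_deriv_eq (H _ _ h1)) => [w|c w]; rewrite E ?mul0r ?mulr0 ?addr0 mulr1.
elim: h => [a|c|f1 d1 f2 d2 _ ih1 _ ih2|f1 d1 f2 d2 _ ih1 _ ih2] g dg hg.
- by apply: (lin_deriv_eq (lin_derivZ a hg)) => [w|c w]//; rewrite mul0r add0r.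
- exact: lin_deriv_mulX.
- by apply: (lin_deriv_eq (lin_derivD (ih1 _ _ hg) (ih2 _ _ hg))) => [w|c w] /=; ring.
- by apply: (lin_deriv_eq (ih1 _ _ (ih2 _ _ hg))) => [w|c w] /=; ring.
Qed.

Hypothesis mX : forall c, measurable_fun setT (X c).
Hypothesis indX : mutually_independent P X.
Variable sg : I -> R.
Hypothesis sg0 : forall i, 0 < sg i.
Hypothesis lawX : forall c B, measurable B -> P (X c @^-1` B) = normal_prob 0 (sg c) B.

Let int f := P.-integrable setT (EFin \o (f : T -> R)).

Let integral_M e : int (M e) /\
  \int[P]_w M e w = \prod_i \int[normal_prob 0 (sg i)]_x (x ^+ e i).
Proof. exact: (integral_monomial mX indX sg0 lawX e (index_enum_uniq I)). Qed.

Let intZ a f : int f -> int (fun w => a * f w).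
Proof.
move=> fi; rewrite /int /comp; under eq_fun do rewrite EFinM.
exact: integrableZl.
Qed.

Let intD f g : int f -> int g -> int (fun w => f w + g w).
Proof.
move=> fi gi; rewrite /int /comp; under eq_fun do rewrite EFinD.
exact: integrableD.
Qed.

(** For a monomial, independence factors the expectation over the variables, and what remains is the
    one-variable identity in the factor of index [c]. Integrability is carried along because
    additivity of the integral requires it. *)
Lemma lin_deriv_stein f df : lin_deriv f df ->
  [/\ int f, forall c, int (df c), forall c, int (fun w => X c w * f w) &
   forall c, \int[P]_w (X c w * f w) = sg c ^+ 2 * \int[P]_w df c w].
Proof.
elim=> [e|{}f {}df g dg _ [f1 f2 f3 f4] _ [g1 g2 g3 g4]|a {}f {}df _ [f1 f2 f3 f4]].
- have XM c w : X c w * M e w = M (set_exp e c (e c).+1) w.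
    by rewrite (monomialE e c) [RHS]monomial_set_exp exprS mulrA.
  split=> [|c|c|c].
  + by have [] := integral_M e.
  + by apply: intZ; have [] := integral_M (set_exp e c (e c).-1).
  + by rewrite /int /comp; under eq_fun do rewrite XM; have [] := integral_M (set_exp e c (e c).+1).
  + under eq_Rintegral do rewrite XM.
    rewrite RintegralZl//; last by have [] := integral_M (set_exp e c (e c).-1).
    have [_ ->] := integral_M (set_exp e c (e c).+1).
    have [_ ->] := integral_M (set_exp e c (e c).-1).
    have prodE k : \prod_i \int[normal_prob 0 (sg i)]_x (x ^+ set_exp e c k i) =
        \int[normal_prob 0 (sg c)]_x (x ^+ k) *
        \prod_(i | i != c) \int[normal_prob 0 (sg i)]_x (x ^+ e i).
      rewrite (bigD1 c)//= /set_exp eqxx; congr (_ * _).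
      by apply: eq_bigr => i /negbTE ->.
    by rewrite !prodE Rintegral_exprn_normal_prob// -!mulrA.
- have XD c w : X c w * (f w + g w) = X c w * f w + X c w * g w by rewrite mulrDr.
  split=> [|c|c|c].
  + exact: intD.
  + exact: intD.
  + by rewrite /int /comp; under eq_fun do rewrite XD; exact: intD.
  + under eq_Rintegral do rewrite XD.
    by rewrite !RintegralD//; [rewrite f4 g4 mulrDr|exact: f3|exact: g3|exact: f2|exact: g2].
- have XZ c w : X c w * (a * f w) = a * (X c w * f w) by rewrite mulrCA.
  split=> [|c|c|c].
  + exact: intZ.
  + exact: intZ.
  + by rewrite /int /comp; under eq_fun do rewrite XZ; exact: intZ.
  + under eq_Rintegral do rewrite XZ.
    by rewrite !RintegralZl//; [rewrite f4 mulrCA|exact: f2|exact: f3].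
Qed.

Lemma poly_deriv_integrable f df : poly_deriv f df -> int f.
Proof. by move=> /poly_deriv_lin /lin_deriv_stein []. Qed.

Lemma poly_deriv_integrableD f df c : poly_deriv f df -> int (df c).
Proof. by move=> /poly_deriv_lin /lin_deriv_stein []. Qed.

Lemma gaussian_stein f df c : poly_deriv f df ->
  \int[P]_w (X c w * f w) = sg c ^+ 2 * \int[P]_w df c w.
Proof. by move=> /poly_deriv_lin /lin_deriv_stein []. Qed.

End gaussian_integration_by_parts.

(** * Trace moments of a Gaussian matrix *)

Section trace_algebra.
Variables (R : comNzRingType) (m : nat).
Implicit Types U V G A : 'M[R]_m.

(** One of two contraction rules: differentiating an occurrence of [G] produces [delta_mx i j] and
    cuts the trace into two, whereas an occurrence of [G^T] produces [delta_mx j i] and leaves a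
    single trace. *)
Lemma sum_mul_delta_mx U V :
  \sum_i \sum_j (U *m delta_mx i j *m V) i j = \tr U * \tr V.
Proof.
rewrite /mxtrace mulr_suml; apply: eq_bigr => i _; rewrite mulr_sumr.
apply: eq_bigr => j _; rewrite mxE (bigD1 j)//= big1 ?addr0.
  rewrite mxE (bigD1 i)//= big1 ?addr0 ?mxE ?eqxx ?mulr1// => k /negbTE ki.
  by rewrite mxE ki mulr0.
move=> k /negbTE kj; rewrite mxE big1 ?mul0r// => l _.
by rewrite mxE kj andbF mulr0.
Qed.

Lemma sum_mul_delta_mxT U V :
  \sum_i \sum_j (U *m delta_mx j i *m V) i j = \tr (U *m V^T).
Proof.
rewrite /mxtrace; apply: eq_bigr => i _; rewrite mxE.
apply: eq_bigr => j _; rewrite !mxE (bigD1 i)//= big1 ?addr0.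
  rewrite !mxE (bigD1 j)//= big1 ?addr0 ?mxE ?eqxx ?mulr1// => k /negbTE ki.
  by rewrite mxE ki mulr0.
move=> k /negbTE kj; rewrite mxE big1 ?mul0r// => l _.
by rewrite mxE kj andbF mulr0.
Qed.

Lemma mxtrace_delta_mul V i j : \tr (delta_mx i j *m V) = V j i.
Proof.
rewrite /mxtrace (bigD1 i)//= big1 ?addr0.
  rewrite mxE (bigD1 j)//= big1 ?addr0 ?mxE ?eqxx ?mul1r// => k /negbTE kj.
  by rewrite mxE kj andbF mul0r.
move=> k /negbTE ki; rewrite mxE big1// => l _.
by rewrite mxE ki mul0r.
Qed.

Definition gram G := G *m G^T.

Lemma gram_exp0 G : gram G ^+ 0 = 1%:M.
Proof. by []. Qed.

Lemma gram_expD G a b : gram G ^+ a *m gram G ^+ b = gram G ^+ (a + b).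
Proof. by rewrite exprD mulmxE. Qed.

Lemma gram_expS G k : gram G *m gram G ^+ k = gram G ^+ k.+1.
Proof. by rewrite exprS mulmxE. Qed.

Lemma gram_expSr G k : gram G ^+ k *m gram G = gram G ^+ k.+1.
Proof. by rewrite exprSr mulmxE. Qed.

Lemma gram_exp_sym G k : (gram G ^+ k)^T = gram G ^+ k.
Proof.
have s1 : (gram G)^T = gram G by rewrite /gram trmx_mul trmxK.
elim: k => [|k ih]; first by rewrite gram_exp0 trmx1.
by rewrite -gram_expS trmx_mul ih s1 gram_expSr gram_expS.
Qed.

(** Directional derivative of [gram] at [G] along [E]; [dgram_exp] is the corresponding derivative
    of the powers. *)
Definition dgram G (E : 'M[R]_m) := E *m G^T + G *m E^T.

Fixpoint dgram_exp G E k : 'M[R]_m :=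
  if k is k'.+1 then dgram G E *m gram G ^+ k' + gram G *m dgram_exp G E k' else 0.

Lemma dgram_expE G E k :
  dgram_exp G E k = \sum_(a < k) gram G ^+ a *m dgram G E *m gram G ^+ (k.-1 - a).
Proof.
elim: k => [|k ih]; first by rewrite big_ord0.
rewrite big_ord_recl /= gram_exp0 mul1mx subn0 ih mulmx_sumr; congr (_ + _).
apply: eq_bigr => a _; rewrite /bump /= add1n -gram_expS !mulmxA.
by congr (_ *m (_ ^+ _)); have := ltn_ord a; lia.
Qed.

(** The gradient of tr ((G G^T)^k) is 2 k (G G^T)^(k-1) G: by cyclicity each of the [k] factors
    contributes equally, and within a factor [G] and [G^T] contribute the same by symmetry of
    [gram]. *)
Lemma mxtrace_dgram_exp G i j k :
  \tr (dgram_exp G (delta_mx i j) k) = (2 * k)%:R * (gram G ^+ k.-1 *m G) i j.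
Proof.
rewrite dgram_expE raddf_sum /=.
have E (a : 'I_k) : \tr (gram G ^+ a *m dgram G (delta_mx i j) *m gram G ^+ (k.-1 - a)) =
    2 * (gram G ^+ k.-1 *m G) i j.
  rewrite -mulmxA mxtrace_mulC -mulmxA gram_expD subnK; last first.
    by have := ltn_ord a; lia.
  rewrite /dgram mulmxDl raddfD /= -!mulmxA mxtrace_delta_mul trmx_delta.
  rewrite [\tr (G *m _)]mxtrace_mulC -mulmxA mxtrace_delta_mul.
  rewrite -{1}(gram_exp_sym G k.-1) -trmx_mul mxE.
  by rewrite -mulr2n mulr_natl.
under eq_bigr do rewrite E.
by rewrite sumr_const card_ord -mulr_natl natrM; ring.
Qed.

Lemma sum_mul_gram G p q :
  \sum_i \sum_j (gram G ^+ p *m G) i j * (gram G ^+ q *m G) i j = \tr (gram G ^+ (p + q).+1).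
Proof.
transitivity (\tr (gram G ^+ p *m G *m (gram G ^+ q *m G)^T)).
  rewrite /mxtrace; apply: eq_bigr => i _; rewrite mxE.
  by apply: eq_bigr => j _; congr (_ * _); rewrite [RHS]mxE.
rewrite trmx_mul gram_exp_sym -mulmxA [G *m _]mulmxA -/(gram G).
by rewrite gram_expS gram_expD addnS.
Qed.

(** Divergence of the field sending G to (G G^T)^p G. The index [a] is the position of the
    differentiated [G], with [a = p] for the last one; each of the [p] occurrences of [G^T] gives
    one copy of the undivided trace. *)
Lemma sum_dgram_exp G p :
  \sum_i \sum_j (dgram_exp G (delta_mx i j) p *m G + gram G ^+ p *m delta_mx i j) i j =
  \sum_(a < p.+1) \tr (gram G ^+ a) * \tr (gram G ^+ (p - a)) + p%:R * \tr (gram G ^+ p).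
Proof.
under eq_bigr do under eq_bigr do rewrite mxE.
under eq_bigr do rewrite big_split.
rewrite big_split /= addrC.
have -> : \sum_(i < m) \sum_(j < m) (gram G ^+ p *m delta_mx i j) i j =
    \tr (gram G ^+ p) * \tr (gram G ^+ 0).
  rewrite gram_exp0 -sum_mul_delta_mx.
  by apply: eq_bigr => i _; apply: eq_bigr => j _; rewrite mulmx1.
rewrite big_ord_recr /= subnn [RHS]addrAC [LHS]addrC; congr (_ + _).
have -> : \sum_(i < m) \sum_(j < m) (dgram_exp G (delta_mx i j) p *m G) i j =
  \sum_(a < p) \sum_(i < m) \sum_(j < m)
    (gram G ^+ a *m dgram G (delta_mx i j) *m gram G ^+ (p.-1 - a) *m G) i j.
  rewrite [RHS]exchange_big; apply: eq_bigr => i _; rewrite [RHS]exchange_big.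
  by apply: eq_bigr => j _; rewrite dgram_expE mulmx_suml summxE.
have E (a : 'I_p) : \sum_(i < m) \sum_(j < m)
    (gram G ^+ a *m dgram G (delta_mx i j) *m gram G ^+ (p.-1 - a) *m G) i j
    = \tr (gram G ^+ a) * \tr (gram G ^+ (p - a)) + \tr (gram G ^+ p).
  have Ea : (p.-1 - a).+1 = (p - a)%N by have := ltn_ord a; lia.
  have S (i j : 'I_m) :
      (gram G ^+ a *m dgram G (delta_mx i j) *m gram G ^+ (p.-1 - a) *m G) i j =
      (gram G ^+ a *m delta_mx i j *m (G^T *m (gram G ^+ (p.-1 - a) *m G))) i j +
      ((gram G ^+ a *m G) *m delta_mx j i *m (gram G ^+ (p.-1 - a) *m G)) i j.
    by rewrite /dgram mulmxDr !mulmxDl trmx_delta mxE !mulmxA.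
  under eq_bigr do under eq_bigr do rewrite S.
  under eq_bigr do rewrite big_split.
  rewrite big_split /= sum_mul_delta_mx; congr (_ * _ + _).
    by rewrite mxtrace_mulC -mulmxA -/(gram G) gram_expSr Ea.
  rewrite sum_mul_delta_mxT trmx_mul gram_exp_sym -mulmxA [G *m _]mulmxA -/(gram G).
  by rewrite gram_expS gram_expD Ea subnKC// ltnW.
rewrite (eq_bigr _ (fun a _ => E a)).
by rewrite big_split /= sumr_const card_ord -[_ *+ p]mulr_natl addrC.
Qed.

End trace_algebra.

(** * Recursion for expectations of products of traces *)

Section trace_recursion.
Context dT (T : measurableType dT) (R : realType) (P : probability T R).
Variables (I : finType) (X : I -> T -> R).

Lemma poly_deriv_eq f df g dg : poly_deriv X f df -> f =1 g -> (forall c, df c =1 dg c) ->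
  poly_deriv X g dg.
Proof.
move=> h fg dfg; have <- : f = g by exact/funext.
by have <- : df = dg by apply/funext => c; exact/funext.
Qed.

Lemma poly_deriv_sum (J : Type) (s : seq J) (F : J -> T -> R) (dF : J -> I -> T -> R) :
  (forall j, poly_deriv X (F j) (dF j)) ->
  poly_deriv X (fun w => \sum_(j <- s) F j w) (fun c w => \sum_(j <- s) dF j c w).
Proof.
move=> h; elim: s => [|j s ih].
  by apply: (poly_deriv_eq (poly_deriv_cst X 0)) => [w|c w]; rewrite big_nil.
by apply: (poly_deriv_eq (poly_derivD (h j) ih)) => [w|c w]; rewrite big_cons.
Qed.

Definition mx_deriv p q (M : T -> 'M[R]_(p, q)) (dM : I -> T -> 'M[R]_(p, q)) :=
  forall i j, poly_deriv X (fun w => M w i j) (fun c w => dM c w i j).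

Lemma mx_derivM p q r (M : T -> 'M[R]_(p, q)) dM (N : T -> 'M[R]_(q, r)) dN :
  mx_deriv M dM -> mx_deriv N dN ->
  mx_deriv (fun w => M w *m N w) (fun c w => dM c w *m N w + M w *m dN c w).
Proof.
move=> hM hN i j.
apply: (poly_deriv_eq (poly_deriv_sum (index_enum 'I_q)
  (fun k => poly_derivM (hM i k) (hN k j)))) => [w|c w]; rewrite !mxE//.
by rewrite big_split.
Qed.

Lemma mx_deriv_cst p q (A : 'M[R]_(p, q)) : mx_deriv (fun=> A) (fun _ _ => 0).
Proof.
move=> i j; apply: (poly_deriv_eq (poly_deriv_cst X (A i j))) => // c w.
by rewrite mxE.
Qed.

Lemma mx_deriv_tr p q (M : T -> 'M[R]_(p, q)) dM : mx_deriv M dM ->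
  mx_deriv (fun w => (M w)^T) (fun c w => (dM c w)^T).
Proof. by move=> h i j; apply: (poly_deriv_eq (h j i)) => [w|c w]; rewrite mxE. Qed.

Lemma poly_deriv_mxtrace p (M : T -> 'M[R]_p) dM : mx_deriv M dM ->
  poly_deriv X (fun w => \tr (M w)) (fun c w => \tr (dM c w)).
Proof. by move=> h; exact: (poly_deriv_sum (index_enum _) (fun i => h i i)). Qed.

Variables (m : nat) (emb : 'I_m -> 'I_m -> I).
Hypothesis emb_inj : forall i j i' j', emb i j = emb i' j' -> i = i' /\ j = j'.

Definition rmx w : 'M[R]_m := \matrix_(i, j) X (emb i j) w.
Let drmx c (_ : T) : 'M[R]_m := \matrix_(i, j) (c == emb i j)%:R.

Let drmxE i j w : drmx (emb i j) w = delta_mx i j.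
Proof.
apply/matrixP => k l; rewrite !mxE; congr ((_ : bool)%:R).
apply/eqP/andP => [/emb_inj[-> ->]//|[/eqP -> /eqP ->]//].
Qed.

Let mx_deriv_rmx : mx_deriv rmx drmx.
Proof.
move=> i j; apply: (poly_deriv_eq (poly_deriv_var X (emb i j))) => [w|c w].
  by rewrite mxE.
by rewrite mxE.
Qed.

Let mx_deriv_gram_exp k :
  mx_deriv (fun w => gram (rmx w) ^+ k) (fun c w => dgram_exp (rmx w) (drmx c w) k).
Proof.
elim: k => [|k ih].
  by have := @mx_deriv_cst m m 1%:M.
have := mx_derivM (mx_derivM mx_deriv_rmx (mx_deriv_tr mx_deriv_rmx)) ih.
by move=> h i j; apply: (poly_deriv_eq (h i j)) => [w|c w] //; rewrite -gram_expS.
Qed.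

Fixpoint trprod (s : seq nat) w : R :=
  if s is k :: s' then \tr (gram (rmx w) ^+ k) * trprod s' w else 1.

Let dtrprod := fix dtrprod (s : seq nat) c w : R :=
  if s is k :: s' then \tr (dgram_exp (rmx w) (drmx c w) k) * trprod s' w
     + \tr (gram (rmx w) ^+ k) * dtrprod s' c w else 0.

Let poly_deriv_trprod s : poly_deriv X (trprod s) (dtrprod s).
Proof.
elim: s => [|k s ih]; first exact: poly_deriv_cst.
exact: poly_derivM (poly_deriv_mxtrace (mx_deriv_gram_exp k)) ih.
Qed.

Fixpoint del (i : nat) (s : seq nat) : seq nat :=
  if s is k :: s' then (if i is i'.+1 then k :: del i' s' else s') else [::].

(** When the derivative falls on another factor of the product, that trace merges with the current
    one: the exponents add up, and the weight is the 2 k of the gradient of the trace. *)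
Let sum_dtrprod p s w :
  \sum_i \sum_j (gram (rmx w) ^+ p *m rmx w) i j * dtrprod s (emb i j) w =
  \sum_(i < size s) (2 * nth 0%N s i)%:R * trprod (p + nth 0 s i :: del i s)%N w.
Proof.
elim: s => [|k s ih] /=.
  by rewrite big_ord0; apply: big1 => i _; apply: big1 => j _; rewrite mulr0.
rewrite big_ord_recl /=.
transitivity (\sum_i \sum_j (gram (rmx w) ^+ p *m rmx w) i j *
     \tr (dgram_exp (rmx w) (delta_mx i j) k) * trprod s w +
   \tr (gram (rmx w) ^+ k) *
   (\sum_i \sum_j (gram (rmx w) ^+ p *m rmx w) i j * dtrprod s (emb i j) w)).
  rewrite mulr_sumr -big_split; apply: eq_bigr => i _.
  rewrite mulr_sumr -big_split; apply: eq_bigr => j _ /=.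
  by rewrite drmxE; ring.
congr (_ + _); last first.
  rewrite ih mulr_sumr; apply: eq_bigr => i _ /=.
  by rewrite /bump /=; ring.
transitivity ((2 * k)%:R * (\sum_i \sum_j (gram (rmx w) ^+ p *m rmx w) i j *
     (gram (rmx w) ^+ k.-1 *m rmx w) i j) * trprod s w).
  rewrite mulr_sumr mulr_suml; apply: eq_bigr => i _.
  rewrite mulr_sumr mulr_suml; apply: eq_bigr => j _ /=.
  by rewrite mxtrace_dgram_exp; ring.
rewrite sum_mul_gram -mulrA.
by case: k => [|k]; rewrite ?muln0 ?mul0r//= addnS.
Qed.

Hypothesis mX : forall c, measurable_fun setT (X c).
Hypothesis indX : mutually_independent P X.
Variable sg : I -> R.
Hypothesis sg0 : forall i, 0 < sg i.
Hypothesis lawX : forall c B, measurable B -> P (X c @^-1` B) = normal_prob 0 (sg c) B.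
Variable sigma : R.
Hypothesis sg_emb : forall i j, sg (emb i j) = sigma.

Lemma integrable_EFinD f g : P.-integrable setT (EFin \o f) -> P.-integrable setT (EFin \o g) ->
  P.-integrable setT (EFin \o (fun w => f w + g w)).
Proof. by move=> h1 h2; rewrite /comp; under eq_fun do rewrite EFinD; exact: integrableD. Qed.

Lemma integrable_EFin_sum (J : Type) (s : seq J) (F : J -> T -> R) :
  (forall j, P.-integrable setT (EFin \o F j)) ->
  P.-integrable setT (EFin \o (fun w => \sum_(j <- s) F j w)).
Proof.
move=> Fi; elim: s => [|j s ih]; rewrite /comp.
  under eq_fun do rewrite big_nil.
  exact: finite_measure_integrable_cst.
by under eq_fun do rewrite big_cons; exact: integrable_EFinD.
Qed.

Lemma Rintegral_sum (J : Type) (s : seq J) (F : J -> T -> R) :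
  (forall j, P.-integrable setT (EFin \o F j)) ->
  \int[P]_w (\sum_(j <- s) F j w) = \sum_(j <- s) \int[P]_w F j w.
Proof.
move=> Fi; elim: s => [|j s ih].
  rewrite big_nil; under eq_Rintegral do rewrite big_nil.
  by rewrite (@Rintegral_cst _ _ _ P _ measurableT 0) mul0r.
rewrite big_cons -ih; under eq_Rintegral do rewrite big_cons.
by rewrite RintegralD//; exact: integrable_EFin_sum.
Qed.

Lemma integrable_trprod s : P.-integrable setT (EFin \o trprod s).
Proof. exact: (poly_deriv_integrable mX indX sg0 lawX (poly_deriv_trprod s)). Qed.

Local Notation E f := (\int[P]_w f w).

(** The first trace is the sum over i, j of G_ij ((G G^T)^p G)_ij, and each summand is integrated by
    parts in G_ij. The derivative of the matrix field gives the first two terms, the derivative of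
    the remaining traces gives the third. *)
Lemma trprod_recursion p s :
  E (trprod (p.+1 :: s)) = sigma ^+ 2 *
    (\sum_(a < p.+1) E (trprod ((a : nat) :: (p - a)%N :: s)) + p%:R * E (trprod (p :: s)) +
     \sum_(i < size s) (2 * nth 0%N s i)%:R * E (trprod (p + nth 0 s i :: del i s)%N)).
Proof.
pose f i j w := (gram (rmx w) ^+ p *m rmx w) i j * trprod s w.
pose df i j c w := (dgram_exp (rmx w) (drmx c w) p *m rmx w + gram (rmx w) ^+ p *m drmx c w) i j *
   trprod s w + (gram (rmx w) ^+ p *m rmx w) i j * dtrprod s c w.
have fdf i j : poly_deriv X (f i j) (df i j).
  exact: poly_derivM (mx_derivM (mx_deriv_gram_exp p) mx_deriv_rmx i j) (poly_deriv_trprod s).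
have Xf i j : P.-integrable setT (EFin \o (fun w => X (emb i j) w * f i j w)).
  exact: (poly_deriv_integrable mX indX sg0 lawX
    (poly_derivM (poly_deriv_var X (emb i j)) (fdf i j))).
have -> : E (trprod (p.+1 :: s)) = E (fun w => \sum_i \sum_j X (emb i j) w * f i j w).
  apply: eq_Rintegral => w _ /=.
  have := sum_mul_gram (rmx w) 0 p; rewrite add0n => <-.
  rewrite mulr_suml; apply: eq_bigr => i _; rewrite mulr_suml; apply: eq_bigr => j _.
  by rewrite gram_exp0 mul1mx mxE /f mulrA.
have isum i : P.-integrable setT (EFin \o (fun w => \sum_j X (emb i j) w * f i j w)).
  by apply: integrable_EFin_sum => j; exact: Xf.
rewrite Rintegral_sum//; under eq_bigr do rewrite Rintegral_sum//.
have st i j := gaussian_stein mX indX sg0 lawX (emb i j) (fdf i j).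
under eq_bigr do under eq_bigr do rewrite st sg_emb.
have idf i j : P.-integrable setT (EFin \o df i j (emb i j)).
  exact: (poly_deriv_integrableD mX indX sg0 lawX _ (fdf i j)).
under eq_bigr do rewrite -mulr_sumr -Rintegral_sum//.
rewrite -mulr_sumr -Rintegral_sum; last first.
  by move=> i; apply: integrable_EFin_sum => j; exact: idf.
congr (_ * _).
have iZ a s' : P.-integrable setT (EFin \o (fun w => a * trprod s' w)).
  rewrite /comp; under eq_fun do rewrite EFinM.
  exact/integrableZl/integrable_trprod.
rewrite -RintegralZl//; last exact: integrable_trprod.
under [X in _ = _ + X]eq_bigr do rewrite -RintegralZl ?integrable_trprod//.
rewrite -!Rintegral_sum => [|j|j]; [|exact: iZ|exact: integrable_trprod].
have i1 : P.-integrable setT (EFin \o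
    (fun w => \sum_(a < p.+1) trprod ((a : nat) :: (p - a)%N :: s) w)).
  by apply: integrable_EFin_sum => j; exact: integrable_trprod.
have i3 : P.-integrable setT (EFin \o (fun w => \sum_(i < size s)
    (2 * nth 0%N s i)%:R * trprod (p + nth 0 s i :: del i s)%N w)).
  by apply: integrable_EFin_sum => j; exact: iZ.
rewrite -(RintegralD measurableT i1 (iZ _ _)).
rewrite -(RintegralD measurableT (integrable_EFinD i1 (iZ _ _)) i3).
apply: eq_Rintegral => w _.
rewrite /df; under eq_bigr do rewrite big_split.
rewrite big_split sum_dtrprod; congr (_ + _).
have := sum_dgram_exp (rmx w) p => /(congr1 (fun x => x * trprod s w)).
rewrite mulrDl !mulr_suml /= => h.
transitivity (\sum_(i < m) (\sum_(j < m) (dgram_exp (rmx w) (delta_mx i j) p *m rmx w +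
             gram (rmx w) ^+ p *m delta_mx i j) i j) * trprod s w).
  by apply: eq_bigr => i _; rewrite mulr_suml; apply: eq_bigr => j _; rewrite drmxE.
rewrite h mulrA; congr (_ + _).
by apply: eq_bigr => a _; rewrite mulrA.
Qed.

End trace_recursion.

(** * Catalan numbers *)

Section catalan.
Variable R : realType.

(** Defined through the ratio of consecutive terms, from which the growth estimates can be read off;
    the convolution identity is then a lemma. *)
Fixpoint catalan (n : nat) : R :=
  if n is k.+1 then catalan k * (4 * k%:R + 2) / (k%:R + 2) else 1.

Arguments catalan n : simpl never.

Lemma catalan0 : catalan 0 = 1. Proof. by []. Qed.

Lemma catalanE n : catalan n.+1 = catalan n * (4 * n%:R + 2) / (n%:R + 2).
Proof. by []. Qed.

Lemma catalan_gt0 n : 0 < catalan n.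
Proof.
elim: n => [|n ih]; first exact: ltr01.
by rewrite catalanE divr_gt0 ?mulr_gt0// ltr_wpDl// ?mulr_ge0.
Qed.

Lemma catalanS n : (n%:R + 2) * catalan n.+1 = (4 * n%:R + 2) * catalan n.
Proof.
have n2 : n%:R + 2 != 0 :> R by rewrite gt_eqF// ltr_wpDl.
by rewrite catalanE; field.
Qed.

(** The reflection of a into k - a shows that the sum weighted by a is k/2 times the plain sum S k.
    Evaluating the sum of (a + 1) C_a C_(n+1-a) once by this symmetry and once by the ratio (a + 2)
    C_(a+1) = (4 a + 2) C_a expresses S (n+1) through S n. *)
Lemma catalan_conv n : \sum_(a < n.+1) catalan a * catalan (n - a) = catalan n.+1.
Proof.
pose S k := \sum_(a < k.+1) catalan a * catalan (k - a).
have Tsym k : \sum_(a < k.+1) a%:R * (catalan a * catalan (k - a)) = k%:R / 2 * S k.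
  have E : \sum_(a < k.+1) a%:R * (catalan a * catalan (k - a)) =
      \sum_(a < k.+1) (k - a)%:R * (catalan a * catalan (k - a)).
    rewrite (reindex_inj rev_ord_inj) /=; apply: eq_bigr => a _.
    by rewrite subSS subKn ?(mulrC (catalan (k - a)))// -ltnS ltn_ord.
  suff : \sum_(a < k.+1) a%:R * (catalan a * catalan (k - a)) *+ 2 = k%:R * S k.
    by rewrite sumrMnl -mulr_natl => h; rewrite mulrAC -h; field.
  rewrite sumrMnl mulr2n {2}E -big_split /S mulr_sumr; apply: eq_bigr => a _ /=.
  by rewrite -mulrDl -natrD subnKC// -ltnS.
elim: n => [|n ih].
  by rewrite big_ord_recl big_ord0 /= subn0 catalanE catalan0; field.
rewrite -/(S n.+1); rewrite -/(S n) in ih.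
have n3 : n.+1%:R + 2 != 0 :> R by rewrite gt_eqF// ltr_wpDl.
apply: (mulfI n3); rewrite catalanS.
have : \sum_(a < n.+2) (a%:R + 1) * (catalan a * catalan (n.+1 - a)) =
    (n.+1%:R + 2) / 2 * S n.+1.
  under eq_bigr do rewrite mulrDl mul1r.
  by rewrite big_split /= Tsym -/(S n.+1); field.
have -> : \sum_(a < n.+2) (a%:R + 1) * (catalan a * catalan (n.+1 - a)) =
    catalan n.+1 + (2 * n.+1%:R) * S n.
  rewrite big_ord_recl /= subn0 add0r !mul1r; congr (_ + _).
  have -> : 2 * n.+1%:R * S n = 4 * (n%:R / 2 * S n) + 2 * S n.
    by rewrite -natr1; field.
  rewrite -Tsym /S !mulr_sumr -big_split; apply: eq_bigr => a _.
  rewrite /bump /= add1n subSS.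
  transitivity ((a%:R + 2) * catalan a.+1 * catalan (n - a)); last by rewrite catalanS; ring.
  by rewrite -natr1; ring.
rewrite ih => h.
have -> : (n.+1%:R + 2) * S n.+1 = 2 * ((n.+1%:R + 2) / 2 * S n.+1) by field.
by rewrite -h; ring.
Qed.

(** Source of the constant 1/8 of the exponent: C_n / C_(n+1) = (n + 2) / (4 n + 2), and 8 n (n + 2)
    and (2 n + 3) (4 n + 2) differ only by the constant 6, so hardly anything is lost. *)
Lemma catalan_pred_le n : n%:R * catalan n <= (2 * n%:R + 3) / 8 * catalan n.+1.
Proof.
have n2 : 0 < n%:R + 2 :> R by rewrite ltr_wpDl.
have c0 := catalan_gt0 n; have n0 : 0 <= n%:R :> R by [].
have -> : catalan n.+1 = catalan n * ((4 * n%:R + 2) / (n%:R + 2)) by rewrite catalanE mulrA.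
rewrite [n%:R * _]mulrC mulrCA ler_pM2l// mulrA ler_pdivlMr//.
nra.
Qed.

Lemma catalanD_le p k : catalan (p + k) <= 4 ^+ p * catalan k.
Proof.
elim: p => [|p ih]; first by rewrite expr0 mul1r.
rewrite addSn exprS -mulrA; apply: (@le_trans _ _ (4 * catalan (p + k))).
  have n2 : 0 < (p + k)%:R + 2 :> R by rewrite ltr_wpDl.
  have c := catalan_gt0 (p + k).
  rewrite catalanE ler_pdivrMr//; lra.
by rewrite ler_pM2l.
Qed.

(** Converts a power of 4 back into a Catalan number at polynomial cost, which the merging terms
    require. The induction runs on the squares, where the square root disappears. *)
Lemma catalan_lb n : 4 ^+ n.+1 <= 2 * Num.sqrt n.+1%:R * n.+2%:R * catalan n.+1.
Proof.
have sq : (4 ^+ n.+1) ^+ 2 <= 4 * n.+1%:R * n.+2%:R ^+ 2 * catalan n.+1 ^+ 2 :> R.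
  elim: n => [|n ih]; first by rewrite catalanE catalan0 mul1r mulr0 !add0r divff // !expr1 expr1n; lra.
  have n2 : 0 < n.+1%:R + 2 :> R by rewrite ltr_wpDl.
  have -> : catalan n.+2 = catalan n.+1 * (4 * n.+1%:R + 2) / (n.+1%:R + 2) by [].
  rewrite [4 ^+ n.+2]exprS -[n.+3%:R]natr1 -[n.+2%:R]natr1 in ih *.
  set x : R := n.+1%:R in ih n2 *; set c := catalan n.+1 in ih *.
  have x0 : 0 <= x by rewrite /x.
  apply: (@le_trans _ _ (4 ^+ 2 * (4 * x * (x + 1) ^+ 2 * c ^+ 2))).
    by rewrite exprMn ler_pM2l ?exprn_gt0.
  have -> : 4 * (x + 1) * (x + 1 + 1) ^+ 2 * (c * (4 * x + 2) / (x + 2)) ^+ 2 =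
      (4 * (x + 1) * c ^+ 2) * (4 * x + 2) ^+ 2.
    by field; rewrite gt_eqF.
  have -> : 4 ^+ 2 * (4 * x * (x + 1) ^+ 2 * c ^+ 2) =
      (4 * (x + 1) * c ^+ 2) * (16 * x * (x + 1)) by ring.
  apply: ler_wpM2l; first by rewrite mulr_ge0 ?sqr_ge0// mulr_ge0// addr_ge0.
  by rewrite -subr_ge0 (_ : _ - _ = 4); [|ring].
rewrite -(@ler_pXn2r _ 2)// ?nnegrE ?mulr_ge0 ?sqrtr_ge0 ?(ltW (catalan_gt0 _))//.
rewrite (le_trans sq)// !exprMn sqr_sqrtr//; lra.
Qed.

End catalan.

(** * Bound on the trace moments *)

Section trace_moment_bound.
Variables (R : realType) (m N : nat) (v : R) (E : seq nat -> R).
Hypothesis m0 : (0 < m)%N.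
Hypothesis v0 : 0 <= v.
Hypothesis E_nil : E [::] = 1.
Hypothesis E_0 : forall s, E (0%N :: s) = m%:R * E s.
Hypothesis E_S : forall p s, E (p.+1 :: s) = v *
    (\sum_(a < p.+1) E ((a : nat) :: (p - a)%N :: s) + p%:R * E (p :: s) +
     \sum_(i < size s) (2 * nth 0%N s i)%:R * E (p + nth 0%N s i :: del i s)%N).

(** Relative cost of the merging terms in one step of the recursion: a merged trace carries m^-2,
    the Catalan factors cost at most a multiple of N^(3/2), and the weights add up to at most 2
    N. *)
Let eta : R := N%:R * (N.+1%:R * Num.sqrt N%:R) / m%:R ^+ 2.
(** Chosen so that q (n+1) - q n = (2 n + 3) / (8 m) + eta, the relative excess of one step over the
    Catalan recursion. *)
Let q (n : nat) : R := (n%:R ^+ 2 + 2 * n%:R) / (8 * m%:R) + n%:R * eta.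
Let B (s : seq nat) : R := \prod_(j <- s) (catalan R j * m%:R ^+ j.+1).

Let mR : 0 < m%:R :> R. Proof. by rewrite ltr0n. Qed.

Let B_ge0 s : 0 <= B s.
Proof.
apply: prodr_ge0 => j _.
by rewrite mulr_ge0 ?exprn_ge0// ltW// catalan_gt0.
Qed.

Let B_del s (i : 'I_(size s)) :
  B s = catalan R (nth 0%N s i) * m%:R ^+ (nth 0%N s i).+1 * B (del i s).
Proof.
elim: s i => [[]//|k s ih] [[|i] hi] /=; first by rewrite /B big_cons.
rewrite /B !big_cons -!/(B _).
have /= -> := ih (Ordinal (hi : (i < size s)%N)); ring.
Qed.

Let sumn_del s (i : 'I_(size s)) : (nth 0 s i + sumn (del i s) = sumn s)%N.
Proof.
elim: s i => [[]//|k s ih] [[|i] hi] //=.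
by have /= := ih (Ordinal (hi : (i < size s)%N)); lia.
Qed.

Let sum_nth s : (\sum_(i < size s) nth 0 s i = sumn s)%N.
Proof. by rewrite sumnE (big_nth 0%N) big_mkord. Qed.

(** The splitting terms reproduce the Catalan convolution without loss, so a step multiplies the
    bound by at most 1 + (2 n + 3) / (8 m) + eta, with n the remaining total exponent; 1 + x <= exp
    x collects these factors in [q]. *)
Lemma trace_moment_bound s : (sumn s <= N)%N ->
  E s <= v ^+ sumn s * expR (q (sumn s)) * B s.
Proof.
(* Outer induction on the total exponent, which [E_S] lowers by one; inner induction on the list,
   from which [E_0] removes the zeros. *)
move: {2}(sumn s) (erefl (sumn s)) => n; elim: n s => [|n ihn].
  elim=> [|k s ihs] /=.
    by rewrite E_nil /q expr0 /B big_nil !mulr1 mul1r !(mul0r, expr0n, mulr0, addr0) expR0.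
  move=> h _; have [k0 s0] : k = 0%N /\ sumn s = 0%N by lia.
  subst k; rewrite E_0 /B big_cons /= mul1r expr1 mulrCA ler_pM2l//.
  by rewrite add0n; apply: ihs; rewrite s0.
elim=> [//|[|p] s ihs] /=.
  move=> h hN; rewrite E_0 /B big_cons /= mul1r expr1 mulrCA ler_pM2l//.
  exact: ihs.
move=> hn hN; have {}hn : (p + sumn s = n)%N by lia.
have -> : (p.+1 + sumn s = n.+1)%N by lia.
have nN : (n < N)%N by lia.
have pN : (p < N)%N by lia.
rewrite E_S exprS -!mulrA; apply: ler_wpM2l => //.
set Q := v ^+ n * expR (q n).
have Q0 : 0 <= Q by rewrite mulr_ge0 ?expR_ge0 ?exprn_ge0.
have BS : B (p.+1 :: s) = catalan R p.+1 * m%:R ^+ p.+2 * B s by rewrite /B big_cons.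
have t1 : \sum_(a < p.+1) E ((a : nat) :: (p - a)%N :: s) <= Q * B (p.+1 :: s).
  rewrite BS -catalan_conv mulr_suml mulr_suml mulr_sumr; apply: ler_sum => a _.
  have ap : (a <= p)%N by rewrite -ltnS.
  have sn : sumn ((a : nat) :: (p - a)%N :: s) = n by rewrite /=; lia.
  have := ihn _ sn; rewrite sn => /(_ (ltnW nN)) /le_trans; apply.
  rewrite /B !big_cons -/(B s) le_eqVlt; apply/orP; left; apply/eqP.
  have -> : p.+2 = (a.+1 + (p - a).+1)%N by lia.
  by rewrite exprD -/Q; ring.
(* The terms from [G^T] miss one factor m, and [catalan_pred_le] compares their C_p with C_(p+1). *)
have t2 : p%:R * E (p :: s) <= (2 * n%:R + 3) / (8 * m%:R) * (Q * B (p.+1 :: s)).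
  have sn : sumn (p :: s) = n by rewrite /=; lia.
  have := ihn _ sn; rewrite sn => /(_ (ltnW nN)) hE.
  apply: (le_trans (ler_wpM2l (ler0n _ _) hE)); rewrite -/Q BS /B big_cons -/(B s).
  rewrite (_ : p%:R * _ = (Q * B s * m%:R ^+ p.+1) * (p%:R * catalan R p)); last by ring.
  rewrite (_ : _ * (Q * _) = (Q * B s * m%:R ^+ p.+1) * ((2 * n%:R + 3) / 8 * catalan R p.+1));
    last by rewrite [m%:R ^+ p.+2]exprS; field; rewrite gt_eqF.
  apply: ler_wpM2l; first by rewrite !mulr_ge0 ?exprn_ge0.
  apply: (le_trans (catalan_pred_le R p)); rewrite ler_pM2r ?catalan_gt0//.
  by rewrite ler_pM2r// lerD2r ler_pM2l// ler_nat; lia.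
have t3 : \sum_(i < size s) (2 * nth 0%N s i)%:R * E (p + nth 0%N s i :: del i s)%N <=
    eta * (Q * B (p.+1 :: s)).
  apply: (@le_trans _ _ (\sum_(i < size s) (nth 0%N s i)%:R *
      (N.+1%:R * Num.sqrt N%:R / m%:R ^+ 2 * (Q * B (p.+1 :: s))))).
    apply: ler_sum => i _; have si := sumn_del i.
    have sn : sumn (p + nth 0%N s i :: del i s)%N = n by rewrite /=; lia.
    have := ihn _ sn; rewrite sn => /(_ (ltnW nN)) hE.
    set k := nth 0%N s i in si hE *.
    apply: (le_trans (ler_wpM2l (ler0n _ _) hE)); rewrite -/Q BS (B_del i) -/k.
    rewrite /B big_cons -/(B (del i s)).
    have D0 := B_ge0 (del i s); set D := B (del i s) in D0 *.
    rewrite natrM (_ : _ * (Q * _) = k%:R * (Q * D * m%:R ^+ (p + k).+1) *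
       (2 * catalan R (p + k))); last by ring.
    rewrite (_ : _ * (_ * (Q * _)) = k%:R * (Q * D * m%:R ^+ (p + k).+1) *
      (N.+1%:R * Num.sqrt N%:R * catalan R k * catalan R p.+1)); last first.
      have -> : m%:R ^+ p.+2 = m%:R ^+ p * m%:R ^+ 2 :> R by rewrite -exprD addn2.
      by rewrite !exprS exprD; field; rewrite gt_eqF.
    apply: ler_wpM2l; first by rewrite !mulr_ge0 ?exprn_ge0.
    have c1 := catalan_gt0 R p.+1; have ck := catalan_gt0 R k.
    have h1 := catalanD_le R p k.
    have h2 : 4 ^+ p.+1 <= 2 * Num.sqrt N%:R * N.+1%:R * catalan R p.+1.
      apply: (le_trans (catalan_lb R p)); rewrite ler_pM2r//.
      apply: ler_pM; rewrite ?mulr_ge0 ?sqrtr_ge0//.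
        by rewrite ler_pM2l; [apply: ler_wsqrtr; rewrite ler_nat; exact: pN|rewrite ltr0n].
      by rewrite ler_nat; exact: pN.
    apply: (@le_trans _ _ (2 * (4 ^+ p * catalan R k))); first by rewrite ler_pM2l.
    rewrite exprS in h2.
    have := ler_wpM2r (ltW ck) h2; lra.
  rewrite -mulr_suml -natr_sum sum_nth mulrA.
  have -> : eta = N%:R * (N.+1%:R * Num.sqrt N%:R / m%:R ^+ 2) by rewrite /eta !mulrA.
  apply: ler_wpM2r; first by rewrite mulr_ge0.
  apply: ler_wpM2r; first by rewrite divr_ge0 ?mulr_ge0 ?sqrtr_ge0 ?exprn_ge0.
  by rewrite ler_nat; lia.
rewrite mulrA -/(B (p.+1 :: s)).
apply: (le_trans (lerD (lerD t1 t2) t3)).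
rewrite -[X in X + _ + _]mul1r -!mulrDl mulrA ler_wpM2r//.
rewrite /Q mulrCA ler_wpM2l ?exprn_ge0//.
apply: (@le_trans _ _ (expR ((2 * n%:R + 3) / (8 * m%:R) + eta) * expR (q n))).
  by rewrite ler_wpM2r ?expR_ge0// -addrA expR_ge1Dx.
rewrite -expRD ler_expR /q -natr1 le_eqVlt; apply/orP; left; apply/eqP.
by field; rewrite gt_eqF.
Qed.

End trace_moment_bound.

(** * Choice of the order of the moment *)

Section exponent.
Variable R : realType.

(** The exponent [q] of the moment bound at [n = N = p], the case of a single trace of order [p]. *)
Definition moment_exponent (m p : nat) : R :=
  (p%:R ^+ 2 + 2 * p%:R) / (8 * m%:R) +
  p%:R * (p%:R * (p.+1%:R * Num.sqrt p%:R) / m%:R ^+ 2).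

(** Relative fluctuation of the norm: for m > 0, 2 sqrt m * (1 + dev m) = 2 sqrt m + sqrt (2 ln m),
    and the denominator in [sigma0] is 2 * (1 + dev m). *)
Definition dev (m : nat) : R := Num.sqrt (ln m%:R) / Num.sqrt (2 * m%:R).

Lemma dev_ge0 m : 0 <= dev m.
Proof. by rewrite divr_ge0 ?sqrtr_ge0. Qed.

(** Combines x - x^2 <= x / (1 + x) with exp (- x / (1 + x)) >= 1 - x / (1 + x) = 1 / (1 + x). *)
Lemma expR_le_1Dx (x : R) : 0 <= x -> expR (x - x ^+ 2) <= 1 + x.
Proof.
move=> x0; have x1 : 0 < 1 + x by rewrite ltr_pwDl.
apply: (@le_trans _ _ (expR (x / (1 + x)))).
  rewrite ler_expR ler_pdivlMr//.
  by rewrite -subr_ge0 (_ : _ - _ = x ^+ 3); [rewrite exprn_ge0|ring].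
rewrite -[leRHS]invrK -[expR _]invrK -expRN lef_pV2 ?posrE ?invr_gt0 ?expR_gt0//.
apply: le_trans (expR_ge1Dx _); rewrite le_eqVlt; apply/orP; left; apply/eqP.
by field; rewrite gt_eqF.
Qed.

Lemma exists_pow2 (r : R) : 1 < r -> exists k, r <= (2 ^ k.+1)%:R <= 2 * r.
Proof.
move=> r1.
have ex : exists k, r <= (2 ^ k)%:R.
  exists (Num.bound r); apply: (le_trans (ltW (archi_boundP (ltW (lt_trans ltr01 r1))))).
  by rewrite ler_nat ltnW// ltn_expl.
case: (ex_minnP ex) => [[|k]] hk mink.
  by move: hk; rewrite expn0 leNgt r1.
exists k; rewrite hk/= expnS natrM ler_pM2l// leNgt; apply/negP => h.
by have := mink k (ltW h); rewrite ltnn.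
Qed.

(** With la = ln m, y = sqrt (m la), p = a y and x = dev m one has sqrt 2 * x * y = la. In units of
    la the left side costs 2 for m^2, a^2/8 for the leading exponent and some lower-order terms,
    while the right side yields sqrt 2 * a up to second order in x. All the lower-order terms
    together are granted a budget of 1. *)
Lemma moment_exponent_le : exists m0 : nat, forall m, (m0 <= m)%N ->
  exists k, m%:R ^+ 2 * expR (moment_exponent m (2 ^ k.+1)) <=
    (1 + dev m) ^+ (2 * 2 ^ k.+1).
Proof.
(* All scales become integer powers of u = m^(1/32) >= 100. Then ln m <= 32 u, the estimates compare
   monomials in u, and a spare factor u absorbs the numerical constants. *)
pose U : R := 100.
exists (Num.bound (U ^+ 32)) => m hm.
have mU : U ^+ 32 < m%:R.
  by rewrite (lt_le_trans (archi_boundP _)) ?exprn_ge0// ler_nat.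
have m0 : 0 < m%:R :> R by apply: lt_trans mU; rewrite exprn_gt0.
pose la : R := ln m%:R; pose u := expR (la / 32).
have um : u ^+ 32 = m%:R.
  by rewrite /u -expRM_natl -mulr_natl mulrC divfK// lnK// posrE.
have uU : U <= u.
  rewrite leNgt; apply/negP => uU; move: mU; rewrite -um ltNge => /negP; apply.
  have U0 : 0 <= U by rewrite /U.
  by apply: lerXn2r; rewrite ?nnegrE ?expR_ge0// ltW.
have u0 : 0 < u by rewrite expR_gt0.
have ug0 : 0 <= u by exact: ltW.
have u1 : 1 <= u by apply: le_trans uU; rewrite /U; lra.
have lau : la <= 32 * u.
  have := expR_ge1Dx (la / 32); rewrite -/u => h; lra.
have la1 : 1 <= la.
  rewrite -[leLHS]expRK /la ler_ln ?posrE ?expR_gt0//.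
  apply: (@le_trans _ _ (U ^+ 1)); last first.
    by apply: ltW; apply: le_lt_trans mU; rewrite ler_weXn2l// /U; lra.
  have e14 : expR (1/4) <= 3/2 :> R.
    have h0 : 0 <= 1/2 :> R by lra.
    have := expR_le_1Dx h0.
    by rewrite (_ : 1/2 - (1/2)^+2 = 1/4 :> R) => [h|]; [lra|field].
  have -> : expR 1 = expR (1/4) * expR (1/4) * (expR (1/4) * expR (1/4)) :> R.
    by rewrite -!expRD; congr expR; field.
  have e0 : 0 <= expR (1/4 : R) by rewrite expR_ge0.
  have h2 : expR (1/4) * expR (1/4) <= 3/2 * (3/2) :> R by rewrite ler_pM.
  rewrite expr1; apply: (le_trans (ler_pM _ _ h2 h2)); rewrite ?mulr_ge0// /U; lra.
set y := Num.sqrt (m%:R * la).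
have ysq : y ^+ 2 = m%:R * la by rewrite sqr_sqrtr// mulr_ge0//; lra.
have y0 : 0 < y by rewrite sqrtr_gt0 mulr_gt0//; lra.
have upow k l : (k <= l)%N -> u ^+ k <= u ^+ l by move=> kl; rewrite ler_weXn2l.
have yu : y <= 6 * u ^+ 17.
  rewrite -(@ler_pXn2r _ 2)// ?nnegrE ?mulr_ge0 ?exprn_ge0 ?(ltW y0)//.
  rewrite ysq -um exprMn -exprM.
  apply: (@le_trans _ _ (u ^+ 32 * (32 * u))).
    by rewrite ler_wpM2l ?exprn_ge0// ltW.
  rewrite (_ : u ^+ 32 * (32 * u) = 32 * u ^+ 33); last by rewrite [u ^+ 33]exprSr; ring.
  have := upow 33%N (17 * 2)%N isT; have : 0 <= u ^+ 33 by rewrite exprn_ge0// ltW.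
  by move=> h1 h2; rewrite expr2; lra.
(* The order p of the moment is a power of two with 3 <= p / y <= 6. *)
have [k /andP[pl pu]] : exists k, 3 * y <= (2 ^ k.+1)%:R <= 2 * (3 * y).
  apply: exists_pow2.
  have : 1 <= y ^+ 2.
    rewrite ysq -um -[leLHS]mul1r ler_pM// exprn_ege1//.
  move=> h; have : 1 <= y by rewrite -(@ler_pXn2r _ 2)// ?nnegrE ?(ltW y0)// expr1n.
  lra.
exists k; move: (2 ^ k.+1)%N pl pu => p pl pu.
set P : R := p%:R in pl pu *.
have P0 : 0 < P by apply: lt_le_trans pl; rewrite mulr_gt0.
set x := dev m.
have xE : x * (Num.sqrt 2 * y) = la.
  rewrite /x /dev -/la /y sqrtrM// sqrtrM ?(ltW m0)//.
  rewrite -[in RHS](@sqr_sqrtr _ la); last by lra.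
  by field; rewrite !gt_eqF// sqrtr_gt0.
have s2 : 7 / 5 <= Num.sqrt 2 :> R.
  rewrite -(@ler_pXn2r _ 2)// ?nnegrE ?sqrtr_ge0//.
  by rewrite sqr_sqrtr// expr2; lra.
have s2sq : Num.sqrt 2 ^+ 2 = 2 :> R by rewrite sqr_sqrtr.
have x0 : 0 <= x by exact: dev_ge0.
have lay : la / y <= 1 / 100.
  rewrite ler_pdivrMr// -(@ler_pXn2r _ 2)// ?nnegrE ?mulr_ge0 ?(ltW y0)//; try lra.
  rewrite exprMn ysq expr2 mulrA ler_pM2r; last by lra.
  rewrite -um; have := upow 2%N 32%N isT; have : U * U <= u ^+ 2.
    by rewrite expr2 ler_pM// /U.
  rewrite /U => h1 h2; have h3 : u * 10000 <= u ^+ 3.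
    by rewrite exprS mulrC [leRHS]mulrC; rewrite ler_pM2r//; lra.
  have h4 := upow 3%N 32%N isT.
  have h5 : 100 * u ^+ 3 <= u ^+ 4 by rewrite [leRHS]exprS ler_pM2r ?exprn_gt0.
  have h6 := upow 4%N 32%N isT. lra.
have e1 : P / (4 * m%:R) <= la / 10.
  rewrite ler_pdivrMr ?mulr_gt0//.
  have h : P <= 36 * u ^+ 17 by lra.
  have h1 := upow 17%N 31%N isT.
  have h2 : 100 * u ^+ 31 <= u ^+ 32 by rewrite [leRHS]exprS ler_pM2r ?exprn_gt0.
  have h3 : m%:R <= la * m%:R by rewrite ler_peMl// ltW.
  rewrite -um in h3 *; lra.
have sP : Num.sqrt P <= 6 * u ^+ 9.
  rewrite -(@ler_pXn2r _ 2)// ?nnegrE ?mulr_ge0 ?exprn_ge0 ?sqrtr_ge0//.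
  rewrite sqr_sqrtr ?(ltW P0)// exprMn -exprM.
  have h : P <= 36 * u ^+ 17 by lra.
  have h1 := upow 17%N (9 * 2)%N isT.
  by rewrite expr2; lra.
(* The merging cost has numerator p * p * (p+1) * sqrt p, at most u^(18+18+18+10) / 10 = m^2 /
   10. *)
have e2 : P * (P * (p.+1%:R * Num.sqrt P) / m%:R ^+ 2) <= la / 10.
  have h : P <= 36 * u ^+ 17 by lra.
  have h' : p.+1%:R <= 37 * u ^+ 17.
    rewrite -natr1 -/P; have := exprn_ege1 17 u1; lra.
  have u36 : 100 <= u by [].
  have c j : 0 <= u ^+ j by rewrite exprn_ge0.
  have h1 : P <= u ^+ 18 by apply: (le_trans h); rewrite exprS ler_wpM2r//; lra.
  have h2 : p.+1%:R <= u ^+ 18 by apply: (le_trans h'); rewrite exprS ler_wpM2r//; lra.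
  have h3 : 10 * Num.sqrt P <= u ^+ 10.
    apply: (@le_trans _ _ (60 * u ^+ 9)); first by lra.
    by rewrite [u ^+ 10]exprS ler_wpM2r//; lra.
  rewrite !mulrA ler_pdivrMr ?exprn_gt0// -(@ler_pM2l _ 10)//.
  have -> : 10 * (la / 10 * m%:R ^+ 2) = la * m%:R ^+ 2 by field.
  apply: (@le_trans _ _ (m%:R ^+ 2)); last by rewrite ler_peMl// exprn_ge0// ltW.
  rewrite -um -exprM (_ : (32 * 2 = 18 + 18 + 18 + 10)%N)// !exprD.
  have -> : 10 * (P * P * p.+1%:R * Num.sqrt P) = P * P * p.+1%:R * (10 * Num.sqrt P) by ring.
  have P0' : 0 <= P by exact: ltW.
  have a1 : P * P <= u ^+ 18 * u ^+ 18 by rewrite ler_pM.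
  have a2 : P * P * p.+1%:R <= u ^+ 18 * u ^+ 18 * u ^+ 18 by rewrite ler_pM ?mulr_ge0.
  by apply: ler_pM => //; rewrite !mulr_ge0 ?sqrtr_ge0.
have Px : 7 / 5 * P * la <= P * x * y * 2.
  have <- : P * (la * Num.sqrt 2) = P * x * y * 2.
    by transitivity (P * x * y * Num.sqrt 2 ^+ 2); [rewrite -xE; ring|rewrite s2sq].
  have la0 : 0 <= la by lra.
  rewrite [7 / 5 * P]mulrC -mulrA ler_pM2l// mulrC; exact: ler_wpM2l.
have xle : x <= la / y.
  rewrite ler_pdivlMr// -xE ler_wpM2l// ler_peMl ?(ltW y0)//; lra.
have main : 2 * la + moment_exponent m p <= (2 * p)%:R * (x - x ^+ 2).
  rewrite /moment_exponent -/P.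
  have -> : (P ^+ 2 + 2 * P) / (8 * m%:R) = P ^+ 2 / (8 * m%:R) + P / (4 * m%:R).
    by field; rewrite gt_eqF.
  pose a := P / y.
  have Pa : P = a * y by rewrite /a divfK// gt_eqF.
  have a3 : 3 <= a by rewrite ler_pdivlMr.
  have a6 : a <= 6 by rewrite ler_pdivrMr//; lra.
  have q1 : P ^+ 2 / (8 * m%:R) = a ^+ 2 / 8 * la.
    by rewrite Pa exprMn ysq; field; rewrite gt_eqF.
  have q2 : 7 / 5 * a * la <= 2 * P * x.
    rewrite -(@ler_pM2r _ y)//; move: Px; rewrite {1}Pa => h.
    by apply: le_trans (_ : _ <= P * x * y * 2) _;
      [apply: le_trans h|]; rewrite le_eqVlt; apply/orP; left; apply/eqP; ring.
  have q3 : 2 * P * x ^+ 2 <= la * (12 / 100).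
    have : P * x <= 6 * la.
      apply: (@le_trans _ _ (6 * y * (la / y))); last by rewrite mulrA mulrAC mulfK ?gt_eqF// mulrC.
      by apply: ler_pM => //; lra.
    have x1 : x <= 1 / 100 by exact: le_trans lay.
    move=> h; have h2 : P * x * x <= 6 * la * (1 / 100) by apply: ler_pM => //; rewrite mulr_ge0// ltW.
    have -> : 2 * P * x ^+ 2 = 2 * (P * x * x) by ring.
    by move: h2; set z := P * x * x; lra.
  rewrite q1 natrM -/P mulrBr.
  (* The quadratic inequality on 3 <= a <= 6 follows from (a - 3) (6 - a) >= 0; 7/5 stands for sqrt
     2. *)
  have fa : (a ^+ 2 / 8 + 2 + 1) * la <= 7 / 5 * a * la.
    rewrite ler_pM2r; last by lra.
    have : 0 <= (a - 3) * (6 - a) by rewrite mulr_ge0// subr_ge0.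
    rewrite expr2; nra.
  lra.
apply: (@le_trans _ _ (expR ((2 * p)%:R * (x - x ^+ 2)))).
  rewrite -[m%:R](@lnK _ m%:R) ?posrE// -/la -expRM_natl -expRD ler_expR.
  by rewrite -mulr_natl in main *.
rewrite expRM_natl lerXn2r ?nnegrE ?expR_ge0 ?addr_ge0//.
exact: expR_le_1Dx.
Qed.

End exponent.

(** * Spectral norm of a Gaussian matrix *)

Section enorm_theory.
Variable R : realType.

Definition cdot p (x y : 'cV[R]_p) : R := \sum_(i < p) x i 0 * y i 0.

Lemma cdotE p (x y : 'cV[R]_p) : cdot x y = (x^T *m y) 0 0.
Proof. by rewrite mxE; apply: eq_bigr => i _; rewrite mxE. Qed.

Lemma cdotC p (x y : 'cV[R]_p) : cdot x y = cdot y x.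
Proof. by apply: eq_bigr => i _; rewrite mulrC. Qed.

Lemma cdotDl p (x y z : 'cV[R]_p) : cdot (x + y) z = cdot x z + cdot y z.
Proof. by rewrite -big_split; apply: eq_bigr => i _; rewrite mxE mulrDl. Qed.

Lemma cdotZl p a (x y : 'cV[R]_p) : cdot (a *: x) y = a * cdot x y.
Proof. by rewrite /cdot mulr_sumr; apply: eq_bigr => i _; rewrite mxE mulrA. Qed.

Lemma cdot_mulmx p q (A : 'M[R]_(p, q)) x y : cdot x (A *m y) = cdot (A^T *m x) y.
Proof. by rewrite !cdotE mulmxA trmx_mul trmxK. Qed.

Lemma cdot_ge0 p (x : 'cV[R]_p) : 0 <= cdot x x.
Proof. by apply: sumr_ge0 => i _; rewrite -expr2 sqr_ge0. Qed.

Lemma enorm_sqr p (x : 'cV[R]_p) : enorm x ^+ 2 = cdot x x.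
Proof.
have -> : enorm x = Num.sqrt (cdot x x).
  by congr Num.sqrt; apply: eq_bigr => i _; rewrite expr2.
by rewrite sqr_sqrtr// cdot_ge0.
Qed.

Lemma enorm_ge0 p (x : 'cV[R]_p) : 0 <= enorm x.
Proof. exact: sqrtr_ge0. Qed.

(** By Lagrange's identity the difference of the two sides is half a sum of squares. *)
Lemma sum_sqr_CauchySchwarz (J : finType) (f g : J -> R) :
  (\sum_j f j * g j) ^+ 2 <= (\sum_j f j ^+ 2) * (\sum_j g j ^+ 2).
Proof.
rewrite -subr_ge0.
suff E : \sum_i \sum_j (f i * g j - f j * g i) ^+ 2 =
    2 * ((\sum_j f j ^+ 2) * (\sum_j g j ^+ 2) - (\sum_j f j * g j) ^+ 2).
  rewrite -(@pmulr_rge0 _ 2)// -E.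
  by apply: sumr_ge0 => i _; apply: sumr_ge0 => j _; rewrite sqr_ge0.
have e1 : \sum_i \sum_j f i ^+ 2 * g j ^+ 2 = (\sum_j f j ^+ 2) * (\sum_j g j ^+ 2).
  by rewrite mulr_suml; apply: eq_bigr => i _; rewrite mulr_sumr.
have e2 : \sum_i \sum_j f j ^+ 2 * g i ^+ 2 = (\sum_j f j ^+ 2) * (\sum_j g j ^+ 2).
  by rewrite exchange_big e1.
have e3 : \sum_i \sum_j (f i * g i) * (f j * g j) = (\sum_j f j * g j) ^+ 2.
  by rewrite expr2 mulr_suml; apply: eq_bigr => i _; rewrite mulr_sumr.
transitivity (\sum_i \sum_j (f i ^+ 2 * g j ^+ 2 + f j ^+ 2 * g i ^+ 2 +
    (- 2) * ((f i * g i) * (f j * g j)))).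
  by apply: eq_bigr => i _; apply: eq_bigr => j _; ring.
under eq_bigr do rewrite big_split -mulr_sumr big_split /=.
by rewrite !big_split /= -mulr_sumr e1 e2 e3; ring.
Qed.

Lemma cdot_sqr_le p (x y : 'cV[R]_p) : cdot x y ^+ 2 <= cdot x x * cdot y y.
Proof.
have := sum_sqr_CauchySchwarz (fun i => x i 0) (fun i => y i 0).
by congr (_ <= _ * _); apply: eq_bigr => i _; rewrite expr2.
Qed.

Lemma cdot_le p (x y : 'cV[R]_p) : `|cdot x y| <= enorm x * enorm y.
Proof.
rewrite -(@ler_pXn2r _ 2)// ?nnegrE ?mulr_ge0 ?enorm_ge0//.
by rewrite real_normK ?num_real// exprMn !enorm_sqr cdot_sqr_le.
Qed.

Lemma enormD p (x y : 'cV[R]_p) : enorm (x + y) <= enorm x + enorm y.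
Proof.
rewrite -(@ler_pXn2r _ 2)// ?nnegrE ?addr_ge0 ?enorm_ge0//.
rewrite enorm_sqr cdotDl ![cdot _ (x + y)]cdotC !cdotDl.
have := le_trans (ler_norm _) (cdot_le x y).
rewrite sqrrD -!enorm_sqr (cdotC y x) !enorm_sqr; lra.
Qed.

Lemma enormZ p a (x : 'cV[R]_p) : enorm (a *: x) = `|a| * enorm x.
Proof.
apply/eqP; rewrite -(@eqrXn2 _ 2)// ?mulr_ge0 ?enorm_ge0//.
by rewrite exprMn !enorm_sqr cdotZl cdotC cdotZl mulrA -expr2 real_normK ?num_real.
Qed.

Lemma enorm0 p : enorm (0 : 'cV[R]_p) = 0.
Proof. by rewrite -(scale0r (0 : 'cV[R]_p)) enormZ normr0 mul0r. Qed.

Lemma enorm_eq0 p (x : 'cV[R]_p) : enorm x = 0 -> x = 0.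
Proof.
move=> /(congr1 (fun t => t ^+ 2)); rewrite enorm_sqr expr0n /= => /psumr_eq0P h.
apply/matrixP => i j; rewrite ord1 mxE; apply/eqP.
have := h (fun i _ => _) i isT => /(_ _)/eqP; rewrite mulf_eq0 orbb; apply.
by move=> k; rewrite -expr2 sqr_ge0.
Qed.

Lemma enorm_gt0 p (x : 'cV[R]_p) : x != 0 -> 0 < enorm x.
Proof.
move=> x0; rewrite lt_neqAle enorm_ge0 andbT eq_sym.
by apply: contra x0 => /eqP /enorm_eq0 ->.
Qed.

Definition frob2 p q (A : 'M[R]_(p, q)) : R := \sum_i \sum_j A i j ^+ 2.

Lemma frob2_ge0 p q (A : 'M[R]_(p, q)) : 0 <= frob2 A.
Proof. by apply: sumr_ge0 => i _; apply: sumr_ge0 => j _; rewrite sqr_ge0. Qed.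

Lemma frob2E p q (A : 'M[R]_(p, q)) : frob2 A = \tr (A *m A^T).
Proof.
rewrite /frob2 /mxtrace; apply: eq_bigr => i _; rewrite mxE.
by apply: eq_bigr => j _; rewrite mxE expr2.
Qed.

Lemma enorm_mul_frob2 p q (A : 'M[R]_(p, q)) x :
  enorm (A *m x) ^+ 2 <= frob2 A * enorm x ^+ 2.
Proof.
rewrite !enorm_sqr /frob2 mulr_suml; apply: ler_sum => i _.
rewrite -expr2 mxE; have := sum_sqr_CauchySchwarz (fun j => A i j) (fun j => x j 0).
by congr (_ <= _ * _); apply: eq_bigr => j _; rewrite expr2.
Qed.

Lemma enorm_mul_sqrt_frob2 p q (A : 'M[R]_(p, q)) x :
  enorm (A *m x) <= Num.sqrt (frob2 A) * enorm x.
Proof.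
rewrite -(@ler_pXn2r _ 2)// ?nnegrE ?mulr_ge0 ?enorm_ge0 ?sqrtr_ge0//.
by rewrite exprMn (sqr_sqrtr (frob2_ge0 A)) enorm_mul_frob2.
Qed.

Lemma enorm_mul_opnorm p q (A : 'M[R]_(p, q)) x :
  enorm (A *m x) <= opnorm A * enorm x.
Proof.
have [->|x0] := eqVneq x 0; first by rewrite mulmx0 !enorm0 mulr0.
have n0 := enorm_gt0 x0.
rewrite -ler_pdivrMr// mulrC -[(enorm x)^-1]ger0_norm ?invr_ge0 ?enorm_ge0//.
(* [sup] dominates its set only if the set is bounded above; the Frobenius norm provides the
   bound. *)
rewrite -enormZ scalemxAr; apply: ub_le_sup.
  exists (Num.sqrt (frob2 A)) => _ [z /= z1 <-].
  apply: (le_trans (enorm_mul_sqrt_frob2 _ _)).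
  by rewrite ler_piMr// sqrtr_ge0.
exists ((enorm x)^-1 *: x) => //=.
by rewrite enormZ ger0_norm ?invr_ge0 ?enorm_ge0// mulVf// gt_eqF.
Qed.

Lemma gram_tr_exp m (G : 'M[R]_m) k : gram G^T ^+ k.+1 = G^T *m gram G ^+ k *m G.
Proof.
elim: k => [|k ih]; first by rewrite expr1 gram_exp0 mulmx1 /gram trmxK.
by rewrite -gram_expS ih {1}/gram trmxK -gram_expS !mulmxA.
Qed.

(* Cauchy-Schwarz, iterated along the powers of two *)
Lemma enorm_exp_le_trace m (G : 'M[R]_m) k x : enorm x <= 1 ->
  enorm (G *m x) ^+ (2 * 2 ^ k.+1) <= \tr (gram G ^+ (2 ^ k.+1)).
Proof.
move=> x1; set A := gram G^T.
have xx1 : cdot x x <= 1 by rewrite -enorm_sqr exprn_ile1// enorm_ge0.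
have sq n y : cdot (A ^+ n *m y) (A ^+ n *m y) = cdot y (A ^+ (2 * n) *m y).
  by rewrite mul2n -addnn -gram_expD -mulmxA [RHS]cdot_mulmx gram_exp_sym.
have E0 : enorm (G *m x) ^+ 2 = cdot x (A ^+ 1 *m x).
  by rewrite expr1 /A /gram trmxK enorm_sqr -mulmxA [RHS]cdot_mulmx trmxK.
have step j : (cdot x (A ^+ 1 *m x)) ^+ (2 ^ j) <= cdot x (A ^+ (2 ^ j) *m x).
  elim: j => [|j ih]; first by rewrite expr1.
  have c0 : 0 <= cdot x (A ^+ 1 *m x) by rewrite -E0 sqr_ge0.
  rewrite expnSr exprM.
  apply: (@le_trans _ _ (cdot x (A ^+ (2 ^ j) *m x) ^+ 2)).
    apply: lerXn2r => //; rewrite nnegrE; first exact: exprn_ge0.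
    by apply: le_trans ih; exact: exprn_ge0.
  apply: (le_trans (cdot_sqr_le _ _)); rewrite mulnC -sq.
  by rewrite ler_piMl// cdot_ge0.
rewrite exprM E0; apply: (le_trans (step _)).
rewrite expnS -sq -enorm_sqr; apply: (le_trans (enorm_mul_frob2 _ _)).
apply: (@le_trans _ _ (frob2 (A ^+ (2 ^ k)))).
  by rewrite ler_piMr ?frob2_ge0// exprn_ile1// enorm_ge0.
rewrite frob2E gram_exp_sym gram_expD addnn -mul2n.
have : (0 < 2 * 2 ^ k)%N by rewrite muln_gt0 expn_gt0.
case: (2 * 2 ^ k)%N => // l _.
by rewrite gram_tr_exp -mulmxA mxtrace_mulC -mulmxA -/(gram G) gram_expSr.
Qed.

End enorm_theory.

(** * From trace moments to the norm *)

Section random_matrix_norm.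
Context dT (T : measurableType dT) (R : realType) (P : probability T R).

Lemma markov_compl (f : T -> R) (a b : R) : 0 < a -> 0 < b ->
  P.-integrable setT (EFin \o f) -> (forall w, 0 <= f w) ->
  \int[P]_w f w <= a ->
  measurable [set w | f w <= a * b] /\
  (P (~` [set w | (f w <= a * b)%R]) <= (b^-1)%:E)%E.
Proof.
move=> a0 b0 fi f0 fa.
have mf : measurable_fun setT f by apply/measurable_EFinP; exact: measurable_int fi.
have mS : measurable [set w | f w <= a * b].
  rewrite (_ : mkset _ = setT `&` f @^-1` `]-oo, a * b]%classic); last first.
    by rewrite setTI; apply/seteqP; split => w /=; rewrite in_itv.
  by apply: mf => //; exact: measurable_itv.
split=> //.
pose f' : {RV P >-> R} := HB.pack f (isMeasurableFun.Build _ _ _ _ _ mf).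
have ab0 : 0 < a * b by rewrite mulr_gt0.
have mk : ((a * b)%:E * P [set x | ((a * b)%:E <= `|(f' x)%:E|)%E] <=
    'E_P[(fun x => `|x|%R) \o f'])%E.
  exact: (@markov _ _ _ P f' id (a * b) ab0).
have Ef : ('E_P[(fun x => `|x|%R) \o f'] <= a%:E)%E.
  rewrite unlock (_ : (\int[P]_w _)%E = (\int[P]_w f w)%:E) ?lee_fin//.
  rewrite /Rintegral fineK; last exact: integrable_fin_num.
  by apply: eq_integral => w _ /=; rewrite ger0_norm.
have sub : (P (~` [set w | (f w <= a * b)%R]) <= P [set x | ((a * b)%:E <= `|(f' x)%:E|)%E])%E.
  apply: le_measure; rewrite ?inE.
  - exact: measurableC.
  - rewrite (_ : mkset _ = setT `&` f @^-1` `[a * b, +oo[%classic).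
      by apply: (measurable_funP f') => //; exact: measurable_itv.
    rewrite setTI; apply/seteqP; split => w /=; rewrite in_itv /= andbT ger0_norm//.
  - by move=> w /= /negP; rewrite -ltNge lee_fin ger0_norm// => /ltW.
apply: (le_trans sub).
have := le_trans mk Ef; rewrite -lee_pdivlMl// => /le_trans; apply.
by rewrite -EFinM lee_fin invfM mulrAC mulVf ?mul1r// gt_eqF.
Qed.

Variables (I : finType) (X : I -> T -> R) (m : nat) (emb : 'I_m -> 'I_m -> I).
Hypothesis emb_inj : forall i j i' j', emb i j = emb i' j' -> i = i' /\ j = j'.
Hypothesis mX : forall c, measurable_fun setT (X c).
Hypothesis indX : mutually_independent P X.
Variable sg : I -> R.
Hypothesis sg0 : forall i, 0 < sg i.
Hypothesis lawX : forall c B, measurable B -> P (X c @^-1` B) = normal_prob 0 (sg c) B.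
Variable sigma : R.
Hypothesis sg_emb : forall i j, sg (emb i j) = sigma.
Hypothesis m0 : (0 < m)%N.

Lemma trprod_moment_le p :
  \int[P]_w trprod X emb [:: p] w <=
  sigma ^+ 2 ^+ p * expR (moment_exponent R m p) * (4 ^+ p * m%:R ^+ p.+1).
Proof.
have h := @trace_moment_bound R m p (sigma ^+ 2) (fun s => \int[P]_w trprod X emb s w)
  m0 (sqr_ge0 _) _ _ _ [:: p].
have sn : sumn [:: p] = p by rewrite /= addn0.
rewrite sn in h; apply: le_trans (h _ _ _ (leqnn _)) _.
- rewrite /= (@Rintegral_cst _ _ _ P _ measurableT 1) mul1r.
  exact: (congr1 fine (probability_setT P)).
- move=> s; rewrite -RintegralZl//; last exact: (integrable_trprod emb mX indX sg0 lawX).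
  by apply: eq_Rintegral => w _ /=; rewrite gram_exp0 mxtrace1.
- by move=> k s; exact: (trprod_recursion emb_inj mX indX sg0 lawX sg_emb).
- rewrite big_seq1 /moment_exponent; apply: ler_wpM2l.
    by rewrite mulr_ge0 ?expR_ge0// exprn_ge0// sqr_ge0.
  rewrite ler_wpM2r ?exprn_ge0//.
  by have := catalanD_le R p 0; rewrite addn0 mulr1.
Qed.

(** One factor of [m%:R ^+ 2] comes from the trace, the other from Markov's inequality at failure
    probability 1/m. In the 2p-th root, the 4^p of the Catalan bound cancels the 2 in the
    denominator of [sigma0], and (1 + dev m)^(2p) cancels the rest of it. *)
Lemma random_matrix_norm_event (s gamma : R) k : 0 < s -> 0 <= gamma ->
  sigma = sigma0 m s ->
  m%:R ^+ 2 * expR (moment_exponent R m (2 ^ k.+1)) <= (gamma * (1 + dev R m)) ^+ (2 * 2 ^ k.+1) ->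
  exists S : set T, [/\ measurable S, (P (~` S) <= (m%:R^-1)%:E)%E &
    forall w, S w -> forall x,
      enorm (rmx X emb w *m x) <= gamma * s * Num.sqrt m%:R * enorm x].
Proof.
move=> s0 g0 sE; set p := (2 ^ k.+1)%N => hg.
pose f w := \tr (gram (rmx X emb w) ^+ p).
pose a := sigma ^+ 2 ^+ p * expR (moment_exponent R m p) * (4 ^+ p * m%:R ^+ p.+1).
have mR : 0 < m%:R :> R by rewrite ltr0n.
have d1 : 0 < 1 + dev R m by rewrite ltr_pwDl// dev_ge0.
have sg1 : 0 < sigma by rewrite sE /sigma0 -/(dev R m) divr_gt0// mulr_gt0.
have a0 : 0 < a by rewrite !mulr_gt0 ?expR_gt0 ?exprn_gt0.
have fE : f =1 trprod X emb [:: p] by move=> w; rewrite /= mulr1.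
have f0 w : 0 <= f w.
  have x1 : enorm (0 : 'cV[R]_m) <= 1 by rewrite enorm0.
  by have := enorm_exp_le_trace (rmx X emb w) k x1; rewrite mulmx0 enorm0 expr0n muln_eq0 expn_eq0.
have fi : P.-integrable setT (EFin \o f).
  have -> : f = trprod X emb [:: p] by exact/funext.
  exact: (integrable_trprod emb mX indX sg0 lawX).
have fa : \int[P]_w f w <= a.
  by under eq_Rintegral do rewrite fE; exact: trprod_moment_le.
have [mS PS] := markov_compl a0 mR fi f0 fa.
exists [set w | f w <= a * m%:R]; split => // w /= fw x.
have am : a * m%:R = m%:R ^+ 2 * expR (moment_exponent R m p) * (s ^+ 2 / (1 + dev R m) ^+ 2 * m%:R) ^+ p.
  have -> : s ^+ 2 / (1 + dev R m) ^+ 2 = sigma ^+ 2 * 4.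
    by rewrite sE /sigma0 -/(dev R m); field; rewrite gt_eqF.
  by rewrite /a; move: (sigma ^+ 2) => z; rewrite !exprMn [m%:R ^+ p.+1]exprS; ring.
have key z : enorm z <= 1 -> enorm (rmx X emb w *m z) <= gamma * s * Num.sqrt m%:R.
  move=> z1; have p0 : (0 < 2 * p)%N by rewrite muln_gt0 expn_gt0.
  rewrite -(@ler_pXn2r _ (2 * p))// ?nnegrE ?enorm_ge0 ?mulr_ge0 ?sqrtr_ge0 ?(ltW s0)//.
  apply: (le_trans (enorm_exp_le_trace (rmx X emb w) k z1)).
  apply: (le_trans fw); rewrite am.
  apply: (@le_trans _ _ ((gamma * (1 + dev R m)) ^+ (2 * p) *
      (s ^+ 2 / (1 + dev R m) ^+ 2 * m%:R) ^+ p)).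
    by rewrite ler_wpM2r// exprn_ge0// mulr_ge0 ?divr_ge0 ?sqr_ge0.
  rewrite !exprM -exprMn le_eqVlt; apply/orP; left; apply/eqP; congr (_ ^+ p).
  rewrite [(gamma * _) ^+ 2]exprMn [(_ * Num.sqrt _) ^+ 2]exprMn (sqr_sqrtr (ltW mR)).
  by field; rewrite gt_eqF.
have [->|x0] := eqVneq x 0; first by rewrite mulmx0 !enorm0 mulr0.
have n0 := enorm_gt0 x0.
rewrite -ler_pdivrMr// mulrC -[(enorm x)^-1]ger0_norm ?invr_ge0 ?enorm_ge0//.
rewrite -enormZ scalemxAr; apply: key.
by rewrite enormZ ger0_norm ?invr_ge0 ?enorm_ge0// mulVf// gt_eqF.
Qed.

End random_matrix_norm.

(** Only finitely many widths lie below the threshold, so the moment p = 2 serves there with [kappa]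
    equal to 1 plus the sum of the corresponding left sides; kappa^4 >= kappa then suffices. *)
Lemma exists_gain (R : realType) : exists (m0 : nat) (kappa : R), 1 <= kappa /\
  forall m, (0 < m)%N -> exists k,
    m%:R ^+ 2 * expR (moment_exponent R m (2 ^ k.+1)) <=
    ((if (m0 <= m)%N then 1 else kappa) * (1 + dev R m)) ^+ (2 * 2 ^ k.+1).
Proof.
have [m0 hm0] := moment_exponent_le R.
pose t (i : nat) : R := i%:R ^+ 2 * expR (moment_exponent R i 2).
have t0 i : 0 <= t i by rewrite mulr_ge0 ?expR_ge0// sqr_ge0.
exists m0, (1 + \sum_(i < m0) t i).
have k1 : 1 <= 1 + \sum_(i < m0) t i by rewrite lerDl; exact: sumr_ge0.
split => // m mgt0; case: leqP => hm.
  by have [k hk] := hm0 _ hm; exists k; rewrite mul1r.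
exists 0%N; rewrite expn1 -/(t m) exprMn.
apply: (@le_trans _ _ (1 + \sum_(i < m0) t i)).
  rewrite (bigD1 (Ordinal hm))//= addrCA lerDl addr_ge0//; exact: sumr_ge0.
rewrite -[leLHS]mulr1 ler_pM//; first by rewrite (le_trans _ k1).
  by rewrite ler_eXnr.
by rewrite exprn_ege1// lerDl dev_ge0.
Qed.

(** * Sums of squares of Gaussian variables *)

Section chi_square.
Context dT (T : measurableType dT) (R : realType) (P : probability T R).
Variables (I : finType) (X : I -> T -> R) (J : finType) (e : J -> I).
Hypothesis e_inj : injective e.
Hypothesis mX : forall c, measurable_fun setT (X c).
Hypothesis indX : mutually_independent P X.
Variable sg : I -> R.
Hypothesis sg0 : forall i, 0 < sg i.
Hypothesis lawX : forall c B, measurable B -> P (X c @^-1` B) = normal_prob 0 (sg c) B.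
Variable sigma : R.
Hypothesis sg_e : forall j, sg (e j) = sigma.

Let S w := \sum_j X (e j) w ^+ 2.
Let N : R := #|J|%:R.

Let dS c w := \sum_j ((c == e j)%:R * X (e j) w + X (e j) w * (c == e j)%:R).

Let poly_derivS : poly_deriv X S dS.
Proof.
apply: (poly_deriv_eq (poly_deriv_sum (index_enum J) (fun j =>
  poly_derivM (poly_deriv_var X (e j)) (poly_deriv_var X (e j))))) => //.
Qed.

Let dSE j w : dS (e j) w = 2 * X (e j) w.
Proof.
rewrite /dS (bigD1 j)//= eqxx mul1r mulr1 big1 ?addr0 ?mulr2n ?mulrDl ?mul1r// => i ij.
by rewrite (inj_eq e_inj) eq_sym (negbTE ij) mul0r mulr0 addr0.
Qed.

Let S_stein f df : poly_deriv X f df ->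
  \int[P]_w (S w * f w) = sigma ^+ 2 * \int[P]_w (\sum_j (f w + X (e j) w * df (e j) w)).
Proof.
move=> fdf.
have Xf j := poly_derivM (poly_deriv_var X (e j)) fdf.
have -> : \int[P]_w (S w * f w) = \int[P]_w (\sum_j X (e j) w * (X (e j) w * f w)).
  apply: eq_Rintegral => w _; rewrite mulr_suml; apply: eq_bigr => j _.
  by rewrite expr2 mulrA.
rewrite [LHS]Rintegral_sum; last first.
  by move=> j; exact: (poly_deriv_integrable mX indX sg0 lawX (poly_derivM (poly_deriv_var X (e j)) (Xf j))).
have st j := gaussian_stein mX indX sg0 lawX (e j) (Xf j).
under eq_bigr do rewrite st sg_e.
rewrite -mulr_sumr -Rintegral_sum.
  congr (_ * _); apply: eq_Rintegral => w _; apply: eq_bigr => j _.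
  by rewrite eqxx mul1r.
by move=> j; exact: (poly_deriv_integrableD mX indX sg0 lawX (e j) (Xf j)).
Qed.

Let ES : \int[P]_w S w = sigma ^+ 2 * N.
Proof.
have := S_stein (poly_deriv_cst X 1).
under eq_Rintegral do rewrite mulr1.
move=> ->; congr (_ * _).
under eq_Rintegral => w _ do
  (under eq_bigr do rewrite mulr0 addr0; rewrite sumr_const -/N).
rewrite (@Rintegral_cst _ _ _ P _ measurableT N).
by rewrite (congr1 fine (probability_setT P)) mulr1.
Qed.

(** Integration by parts gives [S] the mean sigma^2 N and the variance 2 sigma^4 N, and Chebyshev's
    inequality applies. The variance enters through a positive upper bound [a], because N may be
    0. *)
Lemma chi_square_event (m : nat) (a : R) : (0 < m)%N -> 0 < a ->
  2 * sigma ^+ 2 * (sigma ^+ 2 * N) <= a ->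
  exists E : set T, [/\ measurable E, (P (~` E) <= (m%:R^-1)%:E)%E &
    forall w, E w -> S w <= sigma ^+ 2 * N + Num.sqrt (a * m%:R)].
Proof.
move=> m0 a0 ha; have mR : 0 < m%:R :> R by rewrite ltr0n.
pose c := sigma ^+ 2 * N; pose g w := S w - c.
have gd : poly_deriv X g dS.
  by apply: (poly_deriv_eq (poly_derivD poly_derivS (poly_deriv_cst X (- c)))) => // j w; rewrite addr0.
have ig := poly_deriv_integrable mX indX sg0 lawX gd.
have iS := poly_deriv_integrable mX indX sg0 lawX poly_derivS.
have ggd := poly_derivM gd gd.
have iSg := poly_deriv_integrable mX indX sg0 lawX (poly_derivM poly_derivS gd).
have Eg : \int[P]_w g w = 0.
  rewrite /g RintegralB//; last exact: finite_measure_integrable_cst.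
  rewrite ES (@Rintegral_cst _ _ _ P _ measurableT c).
  by rewrite (congr1 fine (probability_setT P)) mulr1 subrr.
have Egg : \int[P]_w (g w * g w) = 2 * sigma ^+ 2 * (sigma ^+ 2 * N).
  have -> : \int[P]_w (g w * g w) = \int[P]_w (S w * g w - c * g w).
    by apply: eq_Rintegral => w _; rewrite -mulrBl.
  rewrite RintegralB//; last first.
    by rewrite /comp; under eq_fun do rewrite EFinM; exact: integrableZl.
  rewrite RintegralZl// Eg mulr0 subr0 (S_stein gd).
  have -> : \int[P]_w (\sum_j (g w + X (e j) w * dS (e j) w)) = \int[P]_w (N * g w + 2 * S w).
    apply: eq_Rintegral => w _; rewrite big_split sumr_const -[_ *+ _]mulr_natl; congr (_ + _).
    by rewrite mulr_sumr; apply: eq_bigr => j _; rewrite dSE; ring.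
  rewrite RintegralD//; last 2 first.
  - by rewrite /comp; under eq_fun do rewrite EFinM; exact: integrableZl.
  - by rewrite /comp; under eq_fun do rewrite EFinM; exact: integrableZl.
  by rewrite !RintegralZl// Eg ES mulr0 add0r; ring.
have [mE PE] := @markov_compl _ _ _ P (fun w => g w * g w) a m%:R a0 mR
  (poly_deriv_integrable mX indX sg0 lawX ggd)
  (fun w => sqr_ge0 (g w)) (eq_ind_r (fun z => z <= a) ha Egg).
exists [set w | g w * g w <= a * m%:R]; split => // w /= gw.
rewrite -lerBlDl -/c -/(g w) (le_trans (ler_norm _))//.
rewrite -(@ler_pXn2r _ 2)// ?nnegrE ?sqrtr_ge0//.
by rewrite sqr_sqrtr ?mulr_ge0 ?(ltW a0)// real_normK ?num_real.
Qed.

End chi_square.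

(** * Derivatives of the network along a segment *)

Section jets.
Import numFieldNormedType.Exports.
Variable R : realType.

Definition vderiv p (u du : R -> 'cV[R]_p) :=
  forall (t : R) (i : 'I_p), is_derive t 1 (fun s : R => u s i 0) (du t i 0).

Lemma is_derive_sum_fun (J : Type) (s : seq J) (F : J -> R -> R) (dF : J -> R) (t : R) :
  (forall j, is_derive t 1 (F j) (dF j)) ->
  is_derive t 1 (fun x => \sum_(j <- s) F j x) (\sum_(j <- s) dF j).
Proof.
move=> h; elim: s => [|j s ih].
  under eq_fun do rewrite big_nil.
  by rewrite big_nil; exact: is_derive_cst.
under eq_fun do rewrite big_cons.
by rewrite big_cons; exact: is_deriveD.
Qed.

Lemma is_deriveM_fun (f g : R -> R) (df dg t : R) :
  is_derive t 1 f df -> is_derive t 1 g dg ->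
  is_derive t 1 (fun x => f x * g x) (f t * dg + df * g t).
Proof.
move=> hf hg; have := is_deriveM hf hg.
by rewrite /GRing.scale /= (mulrC (g t)).
Qed.

Lemma is_derive_affine (a b t : R) : is_derive t 1 (fun x => a + x * b) b.
Proof.
have h : is_derive t 1 (fun x : R => x * b) b.
  have := is_deriveM_fun (is_derive_id t 1) (is_derive_cst b t 1).
  by rewrite mulr0 add0r mul1r.
have := is_deriveD (is_derive_cst a t 1) h.
by rewrite add0r.
Qed.

Lemma vderivD p (u du w dw : R -> 'cV[R]_p) : vderiv u du -> vderiv w dw ->
  vderiv (fun t => u t + w t) (fun t => du t + dw t).
Proof.
move=> hu hw t i; rewrite mxE; under eq_fun do rewrite mxE.
exact: is_deriveD.
Qed.

Lemma vderiv_mulmx p q (A B : 'M[R]_(p, q)) (u du : R -> 'cV[R]_q) : vderiv u du ->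
  vderiv (fun t => (A + t *: B) *m u t) (fun t => (A + t *: B) *m du t + B *m u t).
Proof.
move=> hu t i.
have E : ((A + t *: B) *m du t + B *m u t) i 0 =
    \sum_j ((A i j + t * B i j) * du t j 0 + B i j * u t j 0).
  rewrite !mxE -big_split; apply: eq_bigr => j _.
  by rewrite !mxE.
rewrite E; under eq_fun => s.
  rewrite mxE; under eq_bigr do rewrite !mxE.
  over.
apply: is_derive_sum_fun => j.
exact: is_deriveM_fun (is_derive_affine _ _ _) (hu t j).
Qed.

Variables (phi : R -> R).
Hypothesis dphi : forall x, derivable phi x 1.
Hypothesis ddphi : forall x, derivable (derive1 phi) x 1.

Local Notation phi1 := (derive1 phi).
Local Notation phi2 := (derive1 (derive1 phi)).

Definition vmul p (x y : 'cV[R]_p) : 'cV[R]_p := \col_i (x i 0 * y i 0).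

Lemma is_derive_compR (f g : R -> R) (df dg t : R) :
  is_derive (g t) 1 f df -> is_derive t 1 g dg ->
  is_derive t 1 (fun x => f (g x)) (df * dg).
Proof.
move=> hf hg; have := @is_derive1_comp _ f g t df dg hf hg.
by rewrite /GRing.scale /= mulrC.
Qed.

Let is_derive_phi (x : R) : is_derive x 1 phi (phi1 x).
Proof. by rewrite derive1E; exact: derivableP. Qed.

Let is_derive_phi1 (x : R) : is_derive x 1 phi1 (phi2 x).
Proof. by rewrite derive1E; exact: derivableP. Qed.

Lemma vderiv_phi p (z dz : R -> 'cV[R]_p) : vderiv z dz ->
  vderiv (fun t => map_mx phi (z t)) (fun t => vmul (map_mx phi1 (z t)) (dz t)).
Proof.
move=> hz t i; rewrite !mxE; under eq_fun do rewrite mxE.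
exact: is_derive_compR.
Qed.

Lemma vderiv_phi1 p (z dz ddz : R -> 'cV[R]_p) : vderiv z dz -> vderiv dz ddz ->
  vderiv (fun t => vmul (map_mx phi1 (z t)) (dz t))
    (fun t => vmul (map_mx phi1 (z t)) (ddz t) +
              vmul (map_mx phi2 (z t)) (vmul (dz t) (dz t))).
Proof.
move=> hz hdz t i; rewrite !mxE; under eq_fun do rewrite !mxE.
rewrite mulrA; apply: is_deriveM_fun; last exact: hdz.
exact: is_derive_compR.
Qed.

(** Value, first and second derivative of a vector along a line in parameter space. *)
Definition jet p := ('cV[R]_p * 'cV[R]_p * 'cV[R]_p)%type.

Definition jet_act p (z dz ddz : 'cV[R]_p) : jet p :=
  (map_mx phi z, vmul (map_mx phi1 z) dz,
   vmul (map_mx phi1 z) ddz + vmul (map_mx phi2 z) (vmul dz dz)).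

(** [B *m j.1.2] occurs twice because the second derivative of (A + t B) u is (A + t B) u'' + 2 B
    u'. *)
Definition jet_layer p q (A B : 'M[R]_(p, q)) (j : jet q) : jet p :=
  jet_act (A *m j.1.1) (A *m j.1.2 + B *m j.1.1) (A *m j.2 + B *m j.1.2 + B *m j.1.2).

Definition jderiv p (j : R -> jet p) :=
  vderiv (fun t => (j t).1.1) (fun t => (j t).1.2) /\
  vderiv (fun t => (j t).1.2) (fun t => (j t).2).

Lemma jderiv_layer p q (A B : 'M[R]_(p, q)) (j : R -> jet q) : jderiv j ->
  jderiv (fun t => jet_layer (A + t *: B) B (j t)).
Proof.
move=> [h1 h2].
have z1 := vderiv_mulmx A B h1.
have z2 : vderiv (fun t => (A + t *: B) *m (j t).1.2 + B *m (j t).1.1)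
    (fun t => (A + t *: B) *m (j t).2 + B *m (j t).1.2 + B *m (j t).1.2).
  apply: vderivD; first exact: vderiv_mulmx.
  have := vderiv_mulmx B 0 h1.
  move=> h t i; have := h t i; rewrite mul0mx addr0 scaler0 addr0.
  by under eq_fun do rewrite scaler0 addr0.
by split; [exact: vderiv_phi z1|exact: vderiv_phi1 z1 z2].
Qed.

End jets.

(** * Smoothness from second derivatives along segments *)

Section taylor.
Import numFieldNormedType.Exports.
Variable R : realType.

Lemma le_MVT (f df : R -> R) (a b : R) : a <= b ->
  (forall t : R, is_derive t 1 f (df t)) -> (forall t, a <= t <= b -> df t <= 0) ->
  f b <= f a.
Proof.
rewrite le_eqVlt => /predU1P[->//|ab] hf hdf.
have cf : {within `[a, b], continuous f}.
  apply: continuous_subspaceT => t.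
  by apply: differentiable_continuous; apply/derivable1_diffP; case: (hf t).
have [c /[!in_itv]/= /andP[ac cb] E] := MVT ab (fun t _ => hf t) cf.
rewrite -subr_le0 E mulr_le0_ge0 ?subr_ge0 ?(ltW ab)//.
by apply: hdf; rewrite !ltW.
Qed.

(** The bound on the second derivative is integrated twice, each time as monotonicity of the
    difference with a polynomial. *)
Lemma taylor2_le (g g1 g2 : R -> R) (B : R) :
  (forall t : R, is_derive t 1 g (g1 t)) -> (forall t : R, is_derive t 1 g1 (g2 t)) ->
  (forall t, 0 <= t <= 1 -> g2 t <= B) -> g 1 <= g 0 + g1 0 + B / 2.
Proof.
move=> hg hg1 hB.
have h1 t : 0 <= t <= 1 -> g1 t <= g1 0 + t * B.
  move=> /andP[t0 t1].
  have hd (x : R) : is_derive x 1 (fun s => g1 s - (g1 0 + s * B)) (g2 x - B).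
    exact: is_deriveB (hg1 x) (is_derive_affine _ _ _).
  have := le_MVT t0 hd; rewrite mul0r addr0 subrr subr_le0; apply.
  move=> s /andP[s0 st]; rewrite subr_le0; apply: hB.
  by rewrite s0 (le_trans st).
have hd (x : R) : is_derive x 1 (fun s => g s - (g 0 + s * g1 0 + s * (B / 2 * s)))
    (g1 x - (g1 0 + x * B)).
  have h2 := is_deriveM_fun (is_derive_id x 1) (is_deriveM_fun (is_derive_cst (B / 2) x 1) (is_derive_id x 1)).
  have := is_deriveB (hg x) (is_deriveD (is_derive_affine (g 0) (g1 0) x) h2).
  by congr (is_derive _ _ _ _); rewrite /= ?/cst; field.
have := le_MVT (@ler01 R) hd; rewrite !mul0r !addr0 subrr => h.
have : g 1 - (g 0 + 1 * g1 0 + 1 * (B / 2 * 1)) <= 0.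
  by apply: h => t /h1; rewrite subr_le0.
by rewrite subr_le0 !mul1r mulr1.
Qed.

Variables (m d L : nat).

(** [grad_inner] is built from partial derivatives. It equals the derivative along [delta] once
    directional derivatives are linear in the direction, which derivability along lines does not
    imply and the second hypothesis provides. *)
Lemma grad_innerE (f : param R m d L -> R) (f1 : param R m d L -> R) th :
  (forall delta, is_derive (0 : R) 1 (fun t => f (th + t *: delta)) (f1 delta)) ->
  (forall a x y, f1 (a *: x + y) = a * f1 x + f1 y) ->
  forall delta, grad_inner f th delta = f1 delta.
Proof.
move=> hf lin delta.
have pE c : ppartial f th c = f1 (pbasis R c).
  by rewrite /ppartial derive1E; exact: derive_val.
have f10 : f1 0 = 0.
  by have := lin 1 0 0; rewrite scaler0 addr0 mul1r => /eqP; rewrite addrC -subr_eq subrr eq_sym => /eqP.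
have sumE (s : seq (pidx m d L)) :
    f1 (\sum_(c <- s) delta c *: pbasis R c) = \sum_(c <- s) delta c * f1 (pbasis R c).
  elim: s => [|c s ih]; first by rewrite !big_nil.
  by rewrite !big_cons lin ih.
rewrite /grad_inner; under eq_bigr do rewrite pE.
rewrite -sumE; congr f1; apply/ffunP => c.
rewrite sum_ffunE (bigD1 c)//= big1 ?addr0 => [|c' /negbTE cc'].
  by rewrite !ffunE eqxx /GRing.scale /= mulr1.
by rewrite !ffunE eq_sym cc' /GRing.scale /= mulr0.
Qed.

Lemma smooth_of_second_derivative (f : param R m d L -> R)
    (f1 f2 : param R m d L -> param R m d L -> R) (beta rw rr r1 : R) th0 :
  (forall th delta (t : R),
     is_derive t 1 (fun s => f (th + s *: delta)) (f1 (th + t *: delta) delta)) ->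
  (forall th delta (t : R),
     is_derive t 1 (fun s => f1 (th + s *: delta) delta) (f2 (th + t *: delta) delta)) ->
  (forall th a x y, f1 th (a *: x + y) = a * f1 th x + f1 th y) ->
  (forall th th' t, in_ball rw rr r1 th0 th -> in_ball rw rr r1 th0 th' -> 0 <= t <= 1 ->
     f2 (th + t *: (th' - th)) (th' - th) <= beta * pnorm2 (th' - th)) ->
  smooth_on_ball f beta rw rr r1 th0.
Proof.
move=> h1 h2 lin hb th th' bth bth'.
set delta := th' - th.
have -> : grad_inner f th delta = f1 th delta.
  apply: grad_innerE => [D|]; last exact: lin.
  by have := h1 th D 0; rewrite scale0r addr0.
have := taylor2_le (h1 th delta) (h2 th delta) (fun t ht => hb _ _ t bth bth' ht).
by rewrite scale1r scale0r !addr0 addrC subrK mulrAC.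
Qed.

End taylor.

(** * The network over an abstract parameter space *)

Section network.
Import numFieldNormedType.Exports.
Variables (R : realType) (V : lmodType R) (m d : nat) (J : Type).
Variables (M : J -> V -> 'M[R]_m) (M0 : V -> 'M[R]_(m, d)) (v : V -> 'cV[R]_m).
Hypothesis M_lin : forall l a x y, M l (a *: x + y) = a *: M l x + M l y.
Hypothesis M0_lin : forall a x y, M0 (a *: x + y) = a *: M0 x + M0 y.
Hypothesis v_lin : forall a x y, v (a *: x + y) = a *: v x + v y.
Variable phi : R -> R.
Hypothesis dphi : forall x, derivable phi x 1.
Hypothesis ddphi : forall x, derivable (derive1 phi) x 1.

(** Each layer is abstracted to a matrix depending linearly on the parameters; the input does not
    move, whence the initial jet [(alpha, 0, 0)]. *)
Definition net_jet (th delta : V) (alpha : 'cV[R]_d) (ls : seq J) : jet R m :=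
  foldl (fun j l => jet_layer phi (M l th) (M l delta) j)
    (jet_layer phi (M0 th) (M0 delta) (alpha, 0, 0)) ls.

Lemma net_jet_deriv th delta alpha ls :
  jderiv (fun t => net_jet (th + t *: delta) delta alpha ls).
Proof.
rewrite /net_jet.
have h0 : jderiv (fun t => jet_layer phi (M0 (th + t *: delta)) (M0 delta) (alpha, 0, 0)).
  under eq_fun do rewrite addrC M0_lin addrC.
  have c0 (x : 'cV[R]_d) : vderiv (fun=> x) (fun=> 0).
    by move=> t i; rewrite mxE; exact: is_derive_cst.
  by apply: jderiv_layer => //; split; exact: c0.
suff H : forall j : R -> jet R m, jderiv j -> jderiv (fun t =>
    foldl (fun j l => jet_layer phi (M l (th + t *: delta)) (M l delta) j) (j t) ls).
  exact: (H _ h0).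
elim: ls => //= l ls ih j hj; apply: ih.
under eq_fun do rewrite addrC M_lin addrC.
exact: jderiv_layer.
Qed.

(** Linearity of the first derivative in the direction is proved together with the independence of
    the values from it, since the values enter the derivative of the next layer. *)
Lemma net_jet_lin th alpha ls a x y :
  [/\ (net_jet th (a *: x + y) alpha ls).1.1 = (net_jet th x alpha ls).1.1,
      (net_jet th y alpha ls).1.1 = (net_jet th x alpha ls).1.1 &
      (net_jet th (a *: x + y) alpha ls).1.2 =
      a *: (net_jet th x alpha ls).1.2 + (net_jet th y alpha ls).1.2].
Proof.
rewrite /net_jet.
have vmul_lin (u w z : 'cV[R]_m) : vmul u (a *: w + z) = a *: vmul u w + vmul u z.
  by apply/matrixP => i j; rewrite !mxE; ring.
have base : forall p (A B1 B2 : 'M[R]_(m, p)) (j j1 j2 : jet R p),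
    [/\ j.1.1 = j1.1.1, j2.1.1 = j1.1.1 & j.1.2 = a *: j1.1.2 + j2.1.2] ->
    [/\ (jet_layer phi A (a *: B1 + B2) j).1.1 = (jet_layer phi A B1 j1).1.1,
        (jet_layer phi A B2 j2).1.1 = (jet_layer phi A B1 j1).1.1 &
        (jet_layer phi A (a *: B1 + B2) j).1.2 =
        a *: (jet_layer phi A B1 j1).1.2 + (jet_layer phi A B2 j2).1.2].
  move=> p A B1 B2 j j1 j2 [e1 e2 e3]; rewrite /jet_layer /jet_act /= e1 e2 e3; split => //.
  rewrite -vmul_lin; congr vmul.
  rewrite mulmxDr -scalemxAr mulmxDl -scalemxAl scalerDr.
  by rewrite addrACA.
pose j0 : jet R d := (alpha, 0, 0).
have b0 : [/\ j0.1.1 = j0.1.1, j0.1.1 = j0.1.1 & j0.1.2 = a *: j0.1.2 + j0.1.2].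
  by rewrite scaler0 addr0.
have := base d (M0 th) (M0 x) (M0 y) j0 j0 j0 b0; rewrite /j0.
rewrite -M0_lin.
move: (jet_layer phi (M0 th) (M0 (a *: x + y)) (alpha, 0, 0))
  (jet_layer phi (M0 th) (M0 x) (alpha, 0, 0)) (jet_layer phi (M0 th) (M0 y) (alpha, 0, 0)).
elim: ls => //= l ls ih j j1 j2 h; apply: ih.
by rewrite M_lin; exact: base.
Qed.

(** The direction 0 is a placeholder: the value component of the jet does not depend on it. *)
Definition out0 c th alpha ls := c * cdot (v th) (net_jet th 0 alpha ls).1.1.
Definition out1 c th delta alpha ls :=
  c * (cdot (v th) (net_jet th delta alpha ls).1.2 + cdot (v delta) (net_jet th delta alpha ls).1.1).
Definition out2 c th delta alpha ls :=
  c * (cdot (v th) (net_jet th delta alpha ls).2 +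
       2 * cdot (v delta) (net_jet th delta alpha ls).1.2).

Lemma net_jet_val th delta alpha ls :
  (net_jet th delta alpha ls).1.1 = (net_jet th 0 alpha ls).1.1.
Proof. by have [] := net_jet_lin th alpha ls 1 0 delta. Qed.

Lemma is_derive_cdot p (u w du dw : R -> 'cV[R]_p) (t : R) : vderiv u du -> vderiv w dw ->
  is_derive t 1 (fun s => cdot (u s) (w s)) (cdot (u t) (dw t) + cdot (du t) (w t)).
Proof.
move=> hu hw; rewrite /cdot -big_split.
by apply: is_derive_sum_fun => i; exact: is_deriveM_fun (hu t i) (hw t i).
Qed.

Let vderiv_v th delta : vderiv (fun t => v (th + t *: delta)) (fun=> v delta).
Proof.
move=> t i; under eq_fun do rewrite addrC v_lin addrC !mxE.
exact: is_derive_affine.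
Qed.

Let is_deriveZ_fun (c : R) (f : R -> R) df (t : R) : is_derive t 1 f df ->
  is_derive t 1 (fun s => c * f s) (c * df).
Proof.
move=> h; have := is_deriveM_fun (is_derive_cst c t 1) h.
by rewrite mul0r addr0.
Qed.

Lemma out0_deriv c th delta alpha ls (t : R) :
  is_derive t 1 (fun s => out0 c (th + s *: delta) alpha ls) (out1 c (th + t *: delta) delta alpha ls).
Proof.
apply: is_deriveZ_fun.
have [h _] := net_jet_deriv th delta alpha ls.
have := is_derive_cdot t (vderiv_v th delta) h.
by congr (is_derive _ _ _ _); apply/funext => s; rewrite -(net_jet_val _ delta).
Qed.

Lemma out1_deriv c th delta alpha ls (t : R) :
  is_derive t 1 (fun s => out1 c (th + s *: delta) delta alpha ls)
    (out2 c (th + t *: delta) delta alpha ls).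
Proof.
apply: is_deriveZ_fun.
have [h h'] := net_jet_deriv th delta alpha ls.
have c0 : vderiv (fun=> v delta) (fun=> 0).
  by move=> s i; rewrite mxE; exact: is_derive_cst.
have := is_deriveD (is_derive_cdot t (vderiv_v th delta) h') (is_derive_cdot t c0 h).
congr (is_derive _ _ _ _).
have -> : cdot 0 ((net_jet (th + t *: delta) delta alpha ls).1.1) = 0.
  by rewrite /cdot big1// => i _; rewrite mxE mul0r.
by rewrite addr0; ring.
Qed.

Lemma out1_lin c th alpha ls a x y :
  out1 c th (a *: x + y) alpha ls = a * out1 c th x alpha ls + out1 c th y alpha ls.
Proof.
have [e1 e2 e3] := net_jet_lin th alpha ls a x y.
rewrite /out1 e1 e2 e3 v_lin cdotDl cdotZl [cdot (v th) (_ + _)]cdotC cdotDl cdotZl.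
by rewrite !(cdotC _ (v th)); ring.
Qed.

End network.

(** * Growth of the derivatives with the depth *)

Section jet_bounds.
Import numFieldNormedType.Exports.
Variable R : realType.

Lemma enorm_vmul p (u w : 'cV[R]_p) (B : R) : 0 <= B -> (forall i, `|u i 0| <= B) ->
  enorm (vmul u w) <= B * enorm w.
Proof.
move=> B0 hu; rewrite -(@ler_pXn2r _ 2)// ?nnegrE ?mulr_ge0 ?enorm_ge0//.
rewrite exprMn !enorm_sqr /cdot mulr_sumr; apply: ler_sum => i _.
rewrite mxE -!expr2 exprMn ler_wpM2r ?sqr_ge0//.
by rewrite -(real_normK (num_real (u i 0))) lerXn2r ?nnegrE.
Qed.

Lemma enorm_coord p (w : 'cV[R]_p) i : `|w i 0| <= enorm w.
Proof.
rewrite -(@ler_pXn2r _ 2)// ?nnegrE ?enorm_ge0// real_normK ?num_real//.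
rewrite enorm_sqr /cdot (bigD1 i)//= -expr2 lerDl sumr_ge0// => j _.
by rewrite -expr2 sqr_ge0.
Qed.

(** Every coordinate is at most the norm. The term with the second derivative of [phi] is thus
    quadratic in the norm, without a factor depending on the width. *)
Lemma enorm_vmul_self p (w : 'cV[R]_p) : enorm (vmul w w) <= enorm w ^+ 2.
Proof. by rewrite expr2; apply: enorm_vmul; [exact: enorm_ge0|exact: enorm_coord]. Qed.

Lemma enorm_const p (c : R) : enorm (const_mx c : 'cV[R]_p) = Num.sqrt p%:R * `|c|.
Proof.
rewrite /enorm; under eq_bigr do rewrite mxE.
by rewrite sumr_const card_ord -[_ *+ p]mulr_natl sqrtrM// sqrtr_sqr.
Qed.

Variables (phi : R -> R) (beta : R).
Hypothesis phi_lip : forall a b, `|phi a - phi b| <= `|a - b|.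
Hypothesis dphi : forall x, derivable phi x 1.
Hypothesis ddphi_le : forall x, `|derive1 (derive1 phi) x| <= beta.

Lemma derive1_lip_le1 x : `|derive1 phi x| <= 1.
Proof.
have E : (fun t : R => t^-1 *: ((phi \o shift x) (t *: 1) - phi x)) =
    (fun t : R => t^-1 *: (phi (t + x) - phi x)).
  by apply/funext => t; rewrite /= /GRing.scale /= mulr1.
have := @dphi x; rewrite /derivable E => cv0.
have cv : (fun t : R => t^-1 *: (phi (t + x) - phi x)) @ 0^' --> derive1 phi x := cv0.
have cn : `|t^-1 *: (phi (t + x) - phi x)| @[t --> 0^'] --> `|derive1 phi x| by exact: cvg_norm.
rewrite -(cvg_lim (@Rhausdorff R) cn); apply: limr_le; first exact: cvgP cn.
near=> t; rewrite /GRing.scale /= normrM normfV.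
have t0 : t != 0 by near: t; exact: nbhs_dnbhs_neq.
rewrite ler_pdivrMl ?normr_gt0// mulr1; apply: (le_trans (phi_lip _ _)).
by rewrite addrK.
Unshelve. all: by end_near.
Qed.

Let beta0 : 0 <= beta. Proof. exact: le_trans (normr_ge0 _) (ddphi_le 0). Qed.

(** As [phi 0] may be nonzero, every layer adds a shift of norm |phi 0| sqrt p; this is the source
    of the growth of the activations with the depth when the gain is 1. *)
Lemma enorm_map_phi p (z : 'cV[R]_p) :
  enorm (map_mx phi z) <= enorm z + `|phi 0| * Num.sqrt p%:R.
Proof.
have -> : map_mx phi z = (map_mx phi z - const_mx (phi 0)) + const_mx (phi 0) by rewrite subrK.
apply: (le_trans (enormD _ _)); rewrite enorm_const [Num.sqrt _ * _]mulrC lerD2r.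
rewrite -(@ler_pXn2r _ 2)// ?nnegrE ?enorm_ge0// !enorm_sqr.
apply: ler_sum => i _; rewrite !mxE -!expr2.
rewrite -(real_normK (num_real (phi _ - _))) -(real_normK (num_real (z i 0))).
by rewrite lerXn2r ?nnegrE// (le_trans (phi_lip _ _))// subr0.
Qed.

Lemma jet_act_bound p (z dz ddz : 'cV[R]_p) :
  let j := jet_act phi z dz ddz in
  [/\ enorm j.1.1 <= enorm z + `|phi 0| * Num.sqrt p%:R, enorm j.1.2 <= enorm dz &
      enorm j.2 <= enorm ddz + beta * enorm dz ^+ 2].
Proof.
split => /=; first exact: enorm_map_phi.
  rewrite -[leRHS]mul1r; apply: enorm_vmul => // i.
  by rewrite mxE derive1_lip_le1.
apply: (le_trans (enormD _ _)); apply: lerD.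
  rewrite -[leRHS]mul1r; apply: enorm_vmul => // i.
  by rewrite mxE derive1_lip_le1.
apply: (@le_trans _ _ (beta * enorm (vmul dz dz))).
  by apply: enorm_vmul => // i; rewrite mxE.
by rewrite ler_wpM2l// enorm_vmul_self.
Qed.

End jet_bounds.

(** Activations have size sqrt m, but a direction of norm [D] changes a layer by at most 2 D / sqrt
    m, with one share each for W and R, so no power of m enters the derivatives. Besides the factor
    [Gam], a layer adds an amount that the bounds [U] and [W], valid at all depths considered, make
    independent of the layer: apart from powers of [Gam] the growth is linear in [k]. *)
Lemma net_jet_bound (R : realType) (phi : R -> R) (beta : R)
    (V : lmodType R) (m d : nat) (J : Type) (M : J -> V -> 'M[R]_m) (M0 : V -> 'M[R]_(m, d))
    (th delta : V) (alpha : 'cV[R]_d) (Gam D s A V0 U W : R) :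
  (forall a b, `|phi a - phi b| <= `|a - b|) ->
  (forall x, derivable phi x 1) ->
  (forall x, `|derive1 (derive1 phi) x| <= beta) ->
  1 <= Gam -> 0 <= D -> 1 <= s -> s = Num.sqrt m%:R -> 0 <= U -> 0 <= V0 -> 0 <= W ->
  (forall l x, enorm (M l th *m x) <= Gam * enorm x) ->
  (forall l x, enorm (M l delta *m x) <= 2 * D / s * enorm x) ->
  enorm (M0 th *m alpha) + `|phi 0| * s <= A * s ->
  enorm (M0 delta *m alpha) <= D * V0 ->
  forall ls : seq J, let k := size ls in
  A + k%:R * `|phi 0| <= U -> V0 + 2 * k%:R * U <= W ->
  let j := net_jet M M0 phi th delta alpha ls in
  [/\ enorm j.1.1 <= Gam ^+ k * (A + k%:R * `|phi 0|) * s,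
      enorm j.1.2 <= Gam ^+ k * D * (V0 + 2 * k%:R * U) &
      enorm j.2 <= Gam ^+ (2 * k) * D ^+ 2 * (beta * V0 ^+ 2 + k%:R * (beta * W ^+ 2 + 4 * W))].
Proof.
move=> phi_lip dphi ddphi_le Gam1 D0 s1 sE U0 V00 W0 M_th M_delta M0_th M0_delta ls.
have beta0 : 0 <= beta by exact: le_trans (normr_ge0 _) (ddphi_le 0).
have jet_act_bound := @jet_act_bound R phi beta phi_lip dphi ddphi_le m.
have Gam0 : 0 <= Gam by exact: le_trans ler01 Gam1.
have s0 : 0 < s by exact: lt_le_trans ltr01 s1.
elim/last_ind: ls => [|ls l ih] /=.
  rewrite muln0 !mul0r mulr0 !mul0r !addr0 !expr0 !mul1r => _ _; rewrite /net_jet /=.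
  have [h1 h2 h3] := jet_act_bound (M0 th *m alpha) (M0 th *m 0 + M0 delta *m alpha)
    (M0 th *m 0 + M0 delta *m 0 + M0 delta *m 0).
  rewrite /jet_layer; move: h1 h2 h3; rewrite !mulmx0 !addr0 !add0r enorm0 -sE => h1 h2 h3.
  split; [exact: le_trans h1 _|exact: le_trans h2 _|].
  apply: (le_trans h3); rewrite ?add0r [leRHS]mulrCA ler_wpM2l// -exprMn.
  by rewrite lerXn2r ?nnegrE ?enorm_ge0 ?mulr_ge0.
rewrite size_rcons -natr1 => hU hW.
set k := size ls in ih hU hW *.
have p0 : 0 <= `|phi 0| by [].
have k0 : 0 <= k%:R :> R by [].
have hU' : A + k%:R * `|phi 0| <= U by lra.
have hW' : V0 + 2 * k%:R * U <= W by lra.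
have [i1 i2 i3] := ih hU' hW'.
rewrite /net_jet foldl_rcons -/(net_jet M M0 phi th delta alpha ls).
move: (net_jet _ _ _ _ _ _ _) i1 i2 i3 => j i1 i2 i3.
rewrite /jet_layer.
set z := M l th *m j.1.1; set dz := _ + _; set ddz := _ + _ + _.
have [h1 h2 h3] := jet_act_bound z dz ddz.
set G := Gam ^+ k in i1 i2.
have G1 : 1 <= G by rewrite exprn_ege1.
have G0 : 0 <= G by lra.
have GS : Gam ^+ k.+1 = Gam * G by rewrite exprS.
have G2 : Gam ^+ (2 * k) = G ^+ 2 by rewrite mulnC exprM.
have G2S : Gam ^+ (2 * k.+1) = Gam ^+ 2 * G ^+ 2 by rewrite mulnC exprM GS exprMn.
rewrite GS G2S; rewrite G2 in i3.
have dzb : enorm dz <= Gam * G * D * (V0 + 2 * (k%:R + 1) * U).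
  apply: (le_trans (enormD _ _)).
  have a1 : enorm (M l th *m j.1.2) <= Gam * (G * D * (V0 + 2 * k%:R * U)).
    by apply: (le_trans (M_th _ _)); rewrite ler_wpM2l.
  (* The 1 / s of the perturbed layer cancels the s in the size of the activations. *)
  have a2 : enorm (M l delta *m j.1.1) <= 2 * D * G * U.
    apply: (le_trans (M_delta _ _)).
    apply: (@le_trans _ _ (2 * D / s * (G * U * s))).
      rewrite ler_wpM2l ?mulr_ge0 ?invr_ge0 ?(ltW s0)//.
      by apply: (le_trans i1); rewrite ler_pM2r// ler_wpM2l.
    by rewrite le_eqVlt; apply/orP; left; apply/eqP; field; rewrite gt_eqF.
  have a3 : 2 * D * G * U <= Gam * (2 * D * G * U) by rewrite ler_peMl// !mulr_ge0.
  apply: (le_trans (lerD a1 (le_trans a2 a3))).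
  by rewrite le_eqVlt; apply/orP; left; apply/eqP; ring.
have dzW : enorm dz <= Gam * G * D * W.
  apply: (le_trans dzb); rewrite ler_wpM2l ?mulr_ge0//; lra.
split.
- apply: (le_trans h1); rewrite -sE.
  have a1 : enorm z <= Gam * (G * (A + k%:R * `|phi 0|) * s).
    by apply: (le_trans (M_th _ _)); rewrite ler_wpM2l.
  have a2 : `|phi 0| * s <= Gam * G * (`|phi 0| * s).
    by rewrite ler_peMl ?mulr_ge0 ?(ltW s0)// mulr_ege1.
  apply: (le_trans (lerD a1 a2)).
  by rewrite le_eqVlt; apply/orP; left; apply/eqP; ring.
- exact: le_trans h2 dzb.
- apply: (le_trans h3).
  have b1 : beta * enorm dz ^+ 2 <= beta * (Gam * G * D * W) ^+ 2.
    by rewrite ler_wpM2l// lerXn2r ?nnegrE ?enorm_ge0// !mulr_ge0.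
  have b2 : enorm (M l th *m j.2) <= Gam * (G ^+ 2 * D ^+ 2 * (beta * V0 ^+ 2 + k%:R * (beta * W ^+ 2 + 4 * W))).
    by apply: (le_trans (M_th _ _)); rewrite ler_wpM2l.
  have b3 : enorm (M l delta *m j.1.2) <= 2 * D * (G * D * W).
    apply: (le_trans (M_delta _ _)).
    apply: (@le_trans _ _ (2 * D * (G * D * W) / s)).
      rewrite [leRHS](_ : _ = 2 * D / s * (G * D * W)); last by field; rewrite gt_eqF.
      rewrite ler_wpM2l ?mulr_ge0 ?invr_ge0 ?(ltW s0)//.
      by apply: (le_trans i2); rewrite ler_wpM2l ?mulr_ge0.
    rewrite ler_pdivrMr// ler_peMr// !mulr_ge0//.
  have b4 : enorm ddz <= enorm (M l th *m j.2) + enorm (M l delta *m j.1.2) + enorm (M l delta *m j.1.2).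
    by apply: (le_trans (enormD _ _)); rewrite lerD2r; exact: enormD.
  set Q := beta * V0 ^+ 2 + k%:R * (beta * W ^+ 2 + 4 * W) in b2.
  have Q0 : 0 <= Q.
    by rewrite addr_ge0 ?mulr_ge0 ?sqr_ge0// addr_ge0 ?mulr_ge0 ?sqr_ge0.
  have c1 : Gam * (G ^+ 2 * D ^+ 2 * Q) <= Gam ^+ 2 * G ^+ 2 * D ^+ 2 * Q.
    rewrite expr2 -!mulrA ler_wpM2l// ler_peMl// !mulr_ge0 ?sqr_ge0//.
  have c2 : 4 * (D ^+ 2 * G * W) <= Gam ^+ 2 * G ^+ 2 * (4 * (D ^+ 2 * W)).
    rewrite (_ : 4 * (D ^+ 2 * G * W) = G * (4 * (D ^+ 2 * W))); last by ring.
    rewrite ler_wpM2r ?mulr_ge0 ?sqr_ge0// expr2 [G ^+ 2]expr2.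
    by rewrite mulrA ler_peMl// mulr_ege1// mulr_ege1.
  have -> : Gam ^+ 2 * G ^+ 2 * D ^+ 2 *
      (beta * V0 ^+ 2 + (k%:R + 1) * (beta * W ^+ 2 + 4 * W)) =
    Gam ^+ 2 * G ^+ 2 * D ^+ 2 * Q + beta * (Gam * G * D * W) ^+ 2 +
    Gam ^+ 2 * G ^+ 2 * (4 * (D ^+ 2 * W)) by rewrite /Q; ring.
  rewrite (_ : 4 * (D ^+ 2 * G * W) = 2 * D * (G * D * W) + 2 * D * (G * D * W)) in c2; last by ring.
  lra.
Qed.


(** * Unitarity of the discrete Fourier transform *)

Section dft_unitary.
Variable R : realType.

Definition cis (x : R) : R[i] := (cos x +i* sin x)%C.

Lemma cisD x y : cis (x + y) = cis x * cis y.
Proof. by rewrite /cis cosD sinD; apply/eqP; rewrite eq_complex /= eqxx addrC eqxx. Qed.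

Lemma cis0 : cis 0 = 1.
Proof. by rewrite /cis cos0 sin0. Qed.

Lemma cisX x n : cis (x *+ n) = cis x ^+ n.
Proof.
elim: n => [|n ih]; first by rewrite mulr0n cis0.
by rewrite mulrS cisD ih exprS.
Qed.

Lemma conj_cis x : conjc (cis x) = cis (- x).
Proof. by rewrite /cis cosN sinN. Qed.

Lemma cos_neq1 (x : R) : 0 < x < pi *+ 2 -> cos x != 1.
Proof.
move=> /andP[x0 x2]; have xE : x = x / 2 *+ 2 by rewrite -mulr_natr; field.
have s0 : 0 < sin (x / 2).
  by apply: sin_gt0_pi; rewrite divr_gt0//= ltr_pdivrMr// mulr_natr.
rewrite {1}xE cos_mulr2n; apply/eqP => h.
have := cos2Dsin2 (x / 2); have : 0 < sin (x / 2) ^+ 2 by rewrite exprn_gt0.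
move: h; rewrite mulr2n; lra.
Qed.

Variable m : nat.
Hypothesis m0 : (0 < m)%N.

Let w := cis (- (2 * pi / m%:R)).

Let mR : m%:R != 0 :> R. Proof. by rewrite pnatr_eq0 -lt0n. Qed.

Let w_expm : w ^+ m = 1.
Proof.
rewrite -cisX (_ : _ *+ m = - (pi *+ 2)); last by rewrite -mulr_natr -[pi *+ 2]mulr_natr; field.
by rewrite /cis cosN sinN cos2pi -{1}[pi *+ 2]add0r sinD2pi sin0 oppr0.
Qed.

Let w_exp_neq1 n : (0 < n < m)%N -> w ^+ n != 1.
Proof.
move=> /andP[n0 nm]; rewrite -cisX mulNrn; apply/eqP => /(congr1 (@complex.Re R)) /=.
rewrite cosN; apply/eqP/cos_neq1.
have mp : 0 < m%:R :> R by rewrite ltr0n.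
have p0 := @pi_gt0 R.
rewrite -[_ *+ n]mulr_natr; apply/andP; split.
  by rewrite !mulr_gt0 ?invr_gt0 ?ltr0n.
rewrite mulrAC ltr_pdivrMr// -[pi *+ 2]mulr_natl ltr_pM2l ?mulr_gt0//.
by rewrite ltr_nat.
Qed.

Let w_conj n : conjc (w ^+ n) * w ^+ n = 1.
Proof. by rewrite -cisX conj_cis -cisD addNr cis0. Qed.

Let dftE (k j : 'I_m) : dft R m k j = ((Num.sqrt m%:R)^-1)%:C%C * w ^+ (k * j).
Proof.
rewrite mxE; congr (_ * _); rewrite -cisX mulNrn -conj_cis /cis /=.
by rewrite (_ : 2 * pi * (k * j)%:R / m%:R = 2 * pi / m%:R *+ (k * j))// -[RHS]mulr_natr; field.
Qed.

(** For i different from j the ratio [z] is an m-th root of unity other than 1, so the geometric sum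
    vanishes. *)
Let sum_roots (i j : 'I_m) :
  \sum_(k < m) conjc (w ^+ (k * i)) * w ^+ (k * j) = (i == j)%:R *+ m.
Proof.
have [->|ij] := eqVneq i j.
  by under eq_bigr do rewrite w_conj; rewrite sumr_const card_ord.
pose z := conjc (w ^+ i) * w ^+ j.
have zE k : conjc (w ^+ (k * i)) * w ^+ (k * j) = z ^+ k.
  by rewrite /z exprMn -rmorphXn /= -!exprM ![(_ * k)%N]mulnC.
under eq_bigr do rewrite zE.
rewrite mul0rn; have z1 : z - 1 != 0.
  rewrite subr_eq0; apply/negP => /eqP h.
  have wij : w ^+ j = w ^+ i.
    have := congr1 (fun t => w ^+ i * t) h; rewrite /z mulrA [w ^+ i * _]mulrC w_conj mul1r mulr1.
    by [].
  wlog lij : i j ij {h z zE} wij / (i < j)%N => [hw|].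
    case: (ltngtP i j) => [||/val_inj /eqP]; last by rewrite (negbTE ij).
      exact: hw.
    by apply: hw => //; rewrite eq_sym.
  have := @w_exp_neq1 (j - i)%N; rewrite subn_gt0 lij (leq_ltn_trans (leq_subr _ _) (ltn_ord j)).
  move=> /(_ isT)/negP; apply; apply/eqP.
  by rewrite -[LHS]mul1r -(w_conj i) -mulrA -exprD subnKC ?(ltnW lij)// wij w_conj.
apply: (mulfI z1); rewrite -subrX1 mulr0 /z exprMn -rmorphXn /= -!exprM.
by rewrite ![(_ * m)%N]mulnC !exprM w_expm !expr1n rmorph1 mulr1 subrr.
Qed.

Lemma dft_unitary : adjmx (dft R m) *m dft R m = 1%:M.
Proof.
apply/matrixP => i j; rewrite mxE [RHS]mxE.
pose c : R[i] := ((Num.sqrt m%:R)^-1)%:C%C.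
have cM (x y : R[i]) : conjc (x * y) = conjc x * conjc y by exact: rmorphM.
under eq_bigr => k _ do rewrite mxE [_^T _ _]mxE !dftE -/c cM mulrACA.
rewrite -mulr_sumr sum_roots /c conjc_real -rmorphM /=.
have -> : (Num.sqrt m%:R)^-1 * (Num.sqrt m%:R)^-1 = m%:R^-1 :> R.
  by rewrite -invfM -expr2 sqr_sqrtr.
case: eqP => _; last by rewrite mul0rn mulr0.
rewrite -(rmorph_nat (real_complex R) m) -rmorphM mulVf//.
Qed.

Lemma dft_unitaryV : dft R m *m adjmx (dft R m) = 1%:M.
Proof. exact: mulmx1C dft_unitary. Qed.

End dft_unitary.

(** * The Fourier term as a real matrix *)

Section fourier_isometry.
Variables (R : realType) (m : nat).
Hypothesis m0 : (0 < m)%N.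

Definition cnorm2 (z : 'cV[R[i]]_m) : R :=
  \sum_i ((complex.Re (z i 0)) ^+ 2 + (complex.Im (z i 0)) ^+ 2).

Lemma cnorm2E (z : 'cV[R[i]]_m) : (map_mx (@conjc R) z^T *m z) 0 0 = (cnorm2 z)%:C%C.
Proof.
rewrite mxE rmorph_sum; apply: eq_bigr => i _; rewrite !mxE.
by case: (z i 0) => a b; apply/eqP; rewrite eq_complex /=; apply/andP; split; apply/eqP; ring.
Qed.

Lemma cnorm2_isometry (A : 'M[R[i]]_m) z : adjmx A *m A = 1%:M -> cnorm2 (A *m z) = cnorm2 z.
Proof.
move=> hA; have : (cnorm2 (A *m z))%:C%C = (cnorm2 z)%:C%C.
  rewrite -!cnorm2E trmx_mul map_mxM -mulmxA [_ *m (A *m z)]mulmxA.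
  by rewrite -/(adjmx A) hA mul1mx.
by move=> /(congr1 (@complex.Re R)).
Qed.

Definition toC p q (A : 'M[R]_(p, q)) : 'M[R[i]]_(p, q) := map_mx (fun x => (x%:C)%C) A.

(** The DFT and its adjoint are isometries, and taking real parts does not increase the norm. The
    real matrix [Rm] acts separately on real and imaginary parts, so its bound on real vectors
    persists on complex ones. *)
Lemma fourier_term_le (rho : R) (Rm : 'M[R]_m) (a : 'cV[R]_m) : 0 <= rho ->
  (forall y, enorm (Rm *m y) <= rho * enorm y) ->
  enorm (fourier_term Rm a) <= rho * enorm a.
Proof.
move=> rho0 hR; rewrite -(@ler_pXn2r _ 2)// ?nnegrE ?mulr_ge0 ?enorm_ge0//.
rewrite exprMn !enorm_sqr /fourier_term -/(toC Rm) -/(toC a).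
set z := _ *m toC a.
apply: (@le_trans _ _ (cnorm2 z)).
  by apply: ler_sum => i _; rewrite !mxE -expr2 lerDl sqr_ge0.
have adjK : adjmx (adjmx (dft R m)) = dft R m.
  by apply/matrixP => i j; rewrite !mxE conjcK.
rewrite /z -!mulmxA cnorm2_isometry; last by rewrite adjK dft_unitaryV.
set y := dft R m *m toC a.
have -> : cdot a a = cnorm2 y.
  rewrite cnorm2_isometry ?dft_unitary//; apply: eq_bigr => i _.
  by rewrite !mxE /= expr0n /= addr0 expr2.
pose yr : 'cV[R]_m := map_mx (@complex.Re R) y.
pose yi : 'cV[R]_m := map_mx (@complex.Im R) y.
have nE (u : 'cV[R[i]]_m) : cnorm2 u =
    cdot (map_mx (@complex.Re R) u) (map_mx (@complex.Re R) u) +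
    cdot (map_mx (@complex.Im R) u) (map_mx (@complex.Im R) u).
  by rewrite /cnorm2 big_split; congr (_ + _); apply: eq_bigr => i _; rewrite mxE expr2.
have rE : map_mx (@complex.Re R) (toC Rm *m y) = Rm *m yr.
  apply/matrixP => i j; rewrite mxE mxE raddf_sum [RHS]mxE; apply: eq_bigr => k _.
  by rewrite [toC Rm i k]mxE [yr k j]mxE; case: (y k j) => u v /=; ring.
have iE : map_mx (@complex.Im R) (toC Rm *m y) = Rm *m yi.
  apply/matrixP => i j; rewrite mxE mxE raddf_sum [RHS]mxE; apply: eq_bigr => k _.
  by rewrite [toC Rm i k]mxE [yi k j]mxE; case: (y k j) => u v /=; ring.
rewrite nE [X in _ <= _ * X]nE rE iE -/yr -/yi mulrDr -!enorm_sqr -!exprMn.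
by apply: lerD; rewrite lerXn2r ?nnegrE ?mulr_ge0 ?enorm_ge0.
Qed.

(** With this real matrix of the Fourier term, a Fourier layer becomes an ordinary layer of
    [net_jet]. *)
Definition fourier_mx (Rm : 'M[R]_m) : 'M[R]_m :=
  \matrix_(i, j) fourier_term Rm (delta_mx j 0) i 0.

Let Re_linear (s : R) (x y : R[i]) :
  complex.Re (s%:C%C * x + y) = s * complex.Re x + complex.Re y.
Proof. by case: x => a b; case: y => u v /=; rewrite mul0r subr0. Qed.

Let map_Re_linear p q s (U W : 'M[R[i]]_(p, q)) :
  map_mx (@complex.Re R) ((s%:C)%C *: U + W) =
  s *: map_mx (@complex.Re R) U + map_mx (@complex.Re R) W.
Proof. by apply/matrixP => i j; rewrite !mxE Re_linear. Qed.

Let toC_lin p q s (A B : 'M[R]_(p, q)) : toC (s *: A + B) = (s%:C)%C *: toC A + toC B.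
Proof. by apply/matrixP => i j; rewrite !mxE rmorphD rmorphM. Qed.

Lemma fourier_term_linr (Rm : 'M[R]_m) s a b :
  fourier_term Rm (s *: a + b) = s *: fourier_term Rm a + fourier_term Rm b.
Proof.
rewrite /fourier_term -/(toC Rm) -/(toC (s *: a + b)) -/(toC a) -/(toC b).
by rewrite toC_lin mulmxDr -scalemxAr map_Re_linear.
Qed.

Lemma fourier_term_linl (a : 'cV[R]_m) s (A B : 'M[R]_m) :
  fourier_term (s *: A + B) a = s *: fourier_term A a + fourier_term B a.
Proof.
rewrite /fourier_term -/(toC A) -/(toC (s *: A + B)) -/(toC a) -/(toC B).
by rewrite toC_lin mulmxDr -scalemxAr !mulmxDl -!scalemxAl map_Re_linear.
Qed.

Lemma fourier_mxE Rm a : fourier_mx Rm *m a = fourier_term Rm a.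
Proof.
have aE : a = \sum_(j < m) a j 0 *: delta_mx j 0.
  apply/matrixP => i k; rewrite ord1 summxE (bigD1 i)//= big1 ?addr0.
    by rewrite !mxE !eqxx mulr1.
  by move=> j /negbTE ji; rewrite !mxE eq_sym ji mulr0.
have f0 : fourier_term Rm 0 = 0.
  have := fourier_term_linr Rm 1 0 0; rewrite scale1r addr0 scale1r => /eqP.
  by rewrite addrC -subr_eq subrr eq_sym => /eqP.
have sumE (s : seq 'I_m) : fourier_term Rm (\sum_(j <- s) a j 0 *: delta_mx j 0) =
    \sum_(j <- s) a j 0 *: fourier_term Rm (delta_mx j 0).
  elim: s => [|j s ih]; first by rewrite !big_nil.
  by rewrite !big_cons fourier_term_linr ih.
rewrite [in RHS]aE sumE; apply/matrixP => i k; rewrite ord1 mxE summxE.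
by apply: eq_bigr => j _; rewrite mxE [RHS]mxE mulrC.
Qed.

Lemma fourier_mx_lin s (A B : 'M[R]_m) :
  fourier_mx (s *: A + B) = s *: fourier_mx A + fourier_mx B.
Proof.
have E (C : 'M[R]_m) i j : fourier_mx C i j = fourier_term C (delta_mx j 0) i 0 by rewrite [LHS]mxE.
apply/matrixP => i j; rewrite (E (s *: A + B)) fourier_term_linl.
rewrite [LHS]mxE [X in X + _ = _]mxE [RHS]mxE [X in _ = X + _]mxE.
by congr (_ * _ + _); apply: esym; exact: E.
Qed.

End fourier_isometry.

(** * The loss and its second derivative *)

Section fno_network.
Import numFieldNormedType.Exports.
Variables (R : realType) (m d L : nat) (phi : R -> R).
Local Notation PT := (param R m d L).

Definition layer_mx (l : 'I_L) (th : PT) : 'M[R]_m :=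
  (Num.sqrt m%:R)^-1 *: (W_of th l + fourier_mx (R_of th l)).

Definition input_mx (th : PT) : 'M[R]_(m, d) := (Num.sqrt m%:R)^-1 *: W1_of th.

Lemma W_of_lin l a (x y : PT) : W_of (a *: x + y) l = a *: W_of x l + W_of y l.
Proof. by apply/matrixP => i j; rewrite !mxE !ffunE. Qed.

Lemma R_of_lin l a (x y : PT) : R_of (a *: x + y) l = a *: R_of x l + R_of y l.
Proof. by apply/matrixP => i j; rewrite !mxE !ffunE. Qed.

Lemma W1_of_lin a (x y : PT) : W1_of (a *: x + y) = a *: W1_of x + W1_of y.
Proof. by apply/matrixP => i j; rewrite !mxE !ffunE. Qed.

Lemma v_of_lin a (x y : PT) : v_of (a *: x + y) = a *: v_of x + v_of y.
Proof. by apply/matrixP => i j; rewrite !mxE !ffunE. Qed.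

Lemma layer_mx_lin l a (x y : PT) : layer_mx l (a *: x + y) = a *: layer_mx l x + layer_mx l y.
Proof.
rewrite /layer_mx W_of_lin R_of_lin fourier_mx_lin addrACA -[a *: _ + a *: _]scalerDr [LHS]scalerDr.
by rewrite scalerA mulrC -scalerA.
Qed.

Lemma input_mx_lin a (x y : PT) : input_mx (a *: x + y) = a *: input_mx x + input_mx y.
Proof. by rewrite /input_mx W1_of_lin scalerDr scalerA mulrC -scalerA. Qed.

Lemma fno_out0 (th : PT) alpha :
  fno phi th alpha = out0 layer_mx input_mx (@v_of R m d L) phi (Num.sqrt m%:R)^-1 th alpha (enum 'I_L).
Proof.
rewrite /fno /out0 cdotE; congr (_ * (_ *m _) 0 0); rewrite /net_jet.
have : map_mx phi ((Num.sqrt m%:R)^-1 *: (W1_of th *m alpha)) =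
    (jet_layer phi (input_mx th) (input_mx 0) (alpha, 0, 0)).1.1.
  by rewrite /jet_layer /= /input_mx -scalemxAl.
move: (map_mx phi _) (jet_layer _ _ _ _) => a j aj.
elim: (enum 'I_L) a j aj => //= l ls ih a j aj; apply: ih.
by rewrite /fno_layer /jet_layer /= aj /layer_mx -scalemxAl mulmxDl fourier_mxE scalerDr.
Qed.

Variables (n K : nat).

Definition avg (f : 'I_n -> 'I_K -> R) : R :=
  (n%:R)^-1 * \sum_(i < n) ((K%:R)^-1 * \sum_(r < K) f i r).

Lemma avg_le (f : 'I_n -> 'I_K -> R) B : 0 <= B -> (forall i r, f i r <= B) -> avg f <= B.
Proof.
have le1 (k : nat) (g : 'I_k -> R) b : 0 <= b -> (forall i, g i <= b) ->
    (k%:R)^-1 * \sum_(i < k) g i <= b.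
  (* An empty average equals 0, because the inverse of 0 is 0. *)
  case: k g => [|k] g b0 hg; first by rewrite big_ord0 mulr0.
  rewrite ler_pdivrMl ?ltr0n//; apply: (@le_trans _ _ (\sum_(i < k.+1) b)).
    exact: ler_sum.
  by rewrite sumr_const card_ord mulr_natl.
by move=> B0 hf; apply/le1 => // i; exact: le1.
Qed.

Lemma avg_lin a (f g : 'I_n -> 'I_K -> R) :
  avg (fun i r => a * f i r + g i r) = a * avg f + avg g.
Proof.
rewrite /avg; under eq_bigr do rewrite big_split mulrDr -mulr_sumr mulrCA.
by rewrite big_split mulrDr -mulr_sumr mulrCA.
Qed.

Lemma is_derive_avg (f : 'I_n -> 'I_K -> R -> R) (df : 'I_n -> 'I_K -> R) (t : R) :
  (forall i r, is_derive t 1 (f i r) (df i r)) ->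
  is_derive t 1 (fun s => avg (fun i r => f i r s)) (avg df).
Proof.
have cm c (g : R -> R) dg : is_derive t 1 g dg -> is_derive t 1 (fun s => c * g s) (c * dg).
  move=> h; have := is_deriveM_fun (is_derive_cst c t 1) h.
  by rewrite mul0r addr0.
move=> h; apply/cm; apply: is_derive_sum_fun => i; apply/cm.
by apply: is_derive_sum_fun => r; exact: h.
Qed.

Variables (alpha0 : 'I_n -> 'I_K -> 'cV[R]_d) (y : 'I_n -> 'I_K -> R).
Hypothesis dphi : forall x, derivable phi x 1.
Hypothesis ddphi : forall x, derivable (derive1 phi) x 1.

Let c : R := (Num.sqrt m%:R)^-1.
Let g0 (th : PT) i r := out0 layer_mx input_mx (@v_of R m d L) phi c th (alpha0 i r) (enum 'I_L).
Let g1 (th delta : PT) i r :=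
  out1 layer_mx input_mx (@v_of R m d L) phi c th delta (alpha0 i r) (enum 'I_L).
Let g2 (th delta : PT) i r :=
  out2 layer_mx input_mx (@v_of R m d L) phi c th delta (alpha0 i r) (enum 'I_L).

(** Along a line the squared error has second derivative 2 (g1^2 + (g0 - y) g2), and averaging over
    the data preserves a nonnegative bound. *)
Lemma smooth_of_output_bounds (a b e rw rr r1 : R) (th0 : PT) :
  0 <= a -> 0 <= b -> 0 <= e ->
  (forall (th th' : PT) t, in_ball rw rr r1 th0 th -> in_ball rw rr r1 th0 th' -> 0 <= t <= 1 ->
    forall i r, let u := th + t *: (th' - th) in let D := Num.sqrt (pnorm2 (th' - th)) in
    [/\ `|g0 u i r - y i r| <= a, `|g1 u (th' - th) i r| <= b * D &
        `|g2 u (th' - th) i r| <= e * D ^+ 2]) ->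
  smooth_on_ball (fno_loss phi alpha0 y) (2 * (b ^+ 2 + a * e)) rw rr r1 th0.
Proof.
move=> a0 b0 e0 hb.
pose f1 (th delta : PT) := avg (fun i r => 2 * (g0 th i r - y i r) * g1 th delta i r).
pose f2 (th delta : PT) := avg (fun i r =>
  2 * (g1 th delta i r * g1 th delta i r + (g0 th i r - y i r) * g2 th delta i r)).
have g0d th delta i r (t : R) :
    is_derive t 1 (fun s => g0 (th + s *: delta) i r) (g1 (th + t *: delta) delta i r).
  exact: (out0_deriv layer_mx_lin input_mx_lin v_of_lin dphi ddphi).
have g0yd th delta i r (t : R) :
    is_derive t 1 (fun s => g0 (th + s *: delta) i r - y i r) (g1 (th + t *: delta) delta i r).
  have := is_deriveB (g0d th delta i r t) (is_derive_cst (y i r) t 1).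
  by rewrite subr0.
have g1d th delta i r (t : R) :
    is_derive t 1 (fun s => g1 (th + s *: delta) delta i r) (g2 (th + t *: delta) delta i r).
  exact: (out1_deriv layer_mx_lin input_mx_lin v_of_lin dphi ddphi).
apply: (smooth_of_second_derivative (f1 := f1) (f2 := f2)).
- move=> th delta t.
  have -> : (fun s => fno_loss phi alpha0 y (th + s *: delta)) =
      (fun s => avg (fun i r => (g0 (th + s *: delta) i r - y i r) * (g0 (th + s *: delta) i r - y i r))).
    apply/funext => s; rewrite /fno_loss /avg; congr (_ * _); apply: eq_bigr => i _.
    by congr (_ * _); apply: eq_bigr => r _; rewrite fno_out0 expr2.
  rewrite /f1; apply: is_derive_avg => i r.
  have := is_deriveM_fun (g0yd th delta i r t) (g0yd th delta i r t).
  by congr (is_derive _ _ _ _); ring.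
- move=> th delta t; rewrite /f1 /f2; apply: is_derive_avg => i r.
  have := is_deriveM_fun (is_deriveM_fun (is_derive_cst (2 : R) t 1) (g0yd th delta i r t)) (g1d th delta i r t).
  by congr (is_derive _ _ _ _); rewrite /cst; ring.
- move=> th s x z; rewrite /f1 -avg_lin; congr avg; apply/funext => i; apply/funext => r.
  have -> : g1 th (s *: x + z) i r = s * g1 th x i r + g1 th z i r.
    exact: (out1_lin layer_mx_lin input_mx_lin v_of_lin).
  by move: (g1 th x i r) (g1 th z i r) (g0 th i r - y i r) => p q k; ring.
- move=> th th' t bth bth' ht; rewrite /f2.
  have p0 : 0 <= pnorm2 (th' - th) by apply: sumr_ge0 => i _; exact: sqr_ge0.
  have B0 : 0 <= 2 * (b ^+ 2 + a * e) * pnorm2 (th' - th).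
    by rewrite mulr_ge0// mulr_ge0// addr_ge0 ?sqr_ge0// mulr_ge0.
  apply: avg_le => // i r; have [h1 h2 h3] := hb th th' t bth bth' ht i r.
  set u1 := g1 _ _ _ _ in h2 *; set u2 := g2 _ _ _ _ in h3 *; set u0 := g0 _ _ _ - _ in h1 *.
  rewrite sqr_sqrtr// in h3.
  have e1 : u1 * u1 <= b ^+ 2 * pnorm2 (th' - th).
    rewrite -expr2 -(real_normK (num_real u1)) -[X in _ * X](sqr_sqrtr p0) -exprMn.
    by rewrite lerXn2r ?nnegrE// mulr_ge0// sqrtr_ge0.
  have e2 : u0 * u2 <= a * e * pnorm2 (th' - th).
    apply: (le_trans (ler_norm _)); rewrite normrM -mulrA.
    by rewrite ler_pM.
  by rewrite -[leRHS]mulrA ler_pM2l// [leRHS]mulrDl lerD.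
Qed.

End fno_network.

(** Bookkeeping with two scales: [K] for what the data fix, [X] for the depth and the radii. In turn
    U <= 2 K X, W <= 5 K X^2, Z <= 46 K^3 X^5, a <= 3 K^2 X^2, b <= 7 K^2 X^3 and e <= 56 K^4 X^6,
    whence 434 = 2 (7 * 7 + 3 * 56). *)
Lemma fno_constant_le (R : realType) (K X G L c0 A V0 be r1 Y : R) :
  1 <= K -> 1 <= X -> 1 <= G -> G ^+ 2 <= K -> 0 <= L -> L <= X ->
  0 <= c0 -> c0 <= K -> 0 <= A -> A <= K * X -> 0 <= V0 -> V0 <= K ->
  0 <= be -> be <= K -> be * V0 ^+ 2 <= K -> 0 <= r1 -> 1 + r1 <= X -> 0 <= Y -> Y <= K ->
  let U := A + L * c0 in let W := V0 + 2 * L * U in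
  let Z := be * V0 ^+ 2 + L * (be * W ^+ 2 + 4 * W) in
  let a := (1 + r1) * G * U + Y in let b := G * ((1 + r1) * W + U) in
  let e := (1 + r1) * G ^+ 2 * Z + 2 * (G * W) in
  is_true (2 * (b ^+ 2 + a * e) <= 434 * K ^+ 6 * X ^+ 8).
Proof.
move=> K1 X1 G1 GK L0 LX c00 c0K A0 AK V00 V0K be0 beK beV r10 r1X Y0 YK U W Z a b e.
have K0 : 0 <= K by lra.
have X0 : 0 <= X by lra.
have G0 : 0 <= G by lra.
have GK' : G <= K by apply: le_trans GK; rewrite expr2 ler_peMl.
have mono i j k l : (i <= k)%N -> (j <= l)%N -> K ^+ i * X ^+ j <= K ^+ k * X ^+ l.
  by move=> ik jl; rewrite ler_pM ?exprn_ge0// ler_weXn2l.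
have pos i j : 0 <= K ^+ i * X ^+ j by rewrite mulr_ge0 ?exprn_ge0.
have Lc : L * c0 <= X * K by rewrite ler_pM.
have U0 : 0 <= U by rewrite addr_ge0// mulr_ge0.
have UB : U <= 2 * (K ^+ 1 * X ^+ 1) by rewrite /U !expr1; lra.
have LU : L * U <= X * (2 * (K ^+ 1 * X ^+ 1)) by rewrite ler_pM.
have LUe : X * (2 * (K ^+ 1 * X ^+ 1)) = 2 * (K ^+ 1 * X ^+ 2) by ring.
have W0 : 0 <= W by rewrite addr_ge0// !mulr_ge0.
have WB : W <= 5 * (K ^+ 1 * X ^+ 2).
  have := mono 1%N 0%N 1%N 2%N isT isT; rewrite /W expr0 mulr1 {1}expr1.
  rewrite -mulrA; lra.
have WW : W * W <= 5 * (K ^+ 1 * X ^+ 2) * (5 * (K ^+ 1 * X ^+ 2)) by rewrite ler_pM.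
have beW : be * (W * W) <= K * (5 * (K ^+ 1 * X ^+ 2) * (5 * (K ^+ 1 * X ^+ 2))).
  by rewrite ler_pM// mulr_ge0.
have bWe : K * (5 * (K ^+ 1 * X ^+ 2) * (5 * (K ^+ 1 * X ^+ 2))) = 25 * (K ^+ 3 * X ^+ 4) by ring.
have in0 : 0 <= be * W ^+ 2 + 4 * W by rewrite addr_ge0 ?mulr_ge0 ?sqr_ge0.
have inB : be * W ^+ 2 + 4 * W <= 45 * (K ^+ 3 * X ^+ 4).
  have := mono 1%N 2%N 3%N 4%N isT isT; rewrite [W ^+ 2]expr2; lra.
have LinB : L * (be * W ^+ 2 + 4 * W) <= X * (45 * (K ^+ 3 * X ^+ 4)) by rewrite ler_pM.
have LinE : X * (45 * (K ^+ 3 * X ^+ 4)) = 45 * (K ^+ 3 * X ^+ 5) by ring.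
have Z0 : 0 <= Z by rewrite addr_ge0 ?mulr_ge0 ?sqr_ge0.
have ZB : Z <= 46 * (K ^+ 3 * X ^+ 5).
  have := mono 1%N 0%N 3%N 5%N isT isT; rewrite /Z expr0 mulr1 expr1; lra.
have r1p : 0 <= 1 + r1 by lra.
have rG : (1 + r1) * G <= X * K by rewrite ler_pM.
have rG0 : 0 <= (1 + r1) * G by rewrite mulr_ge0.
have rGU : (1 + r1) * G * U <= X * K * (2 * (K ^+ 1 * X ^+ 1)) by rewrite ler_pM.
have rGUe : X * K * (2 * (K ^+ 1 * X ^+ 1)) = 2 * (K ^+ 2 * X ^+ 2) by ring.
have a0 : 0 <= a by rewrite addr_ge0// mulr_ge0.
have aB : a <= 3 * (K ^+ 2 * X ^+ 2).
  have := mono 1%N 0%N 2%N 2%N isT isT; rewrite /a expr0 mulr1 expr1; lra.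
have rW : (1 + r1) * W <= X * (5 * (K ^+ 1 * X ^+ 2)) by rewrite ler_pM.
have rWe : X * (5 * (K ^+ 1 * X ^+ 2)) = 5 * (K ^+ 1 * X ^+ 3) by ring.
have rWU : (1 + r1) * W + U <= 7 * (K ^+ 1 * X ^+ 3).
  have := mono 1%N 1%N 1%N 3%N isT isT; lra.
have rWU0 : 0 <= (1 + r1) * W + U by rewrite addr_ge0// mulr_ge0.
have b0 : 0 <= b by rewrite mulr_ge0.
have bB : b <= K * (7 * (K ^+ 1 * X ^+ 3)) by rewrite ler_pM.
have bBe : K * (7 * (K ^+ 1 * X ^+ 3)) = 7 * (K ^+ 2 * X ^+ 3) by ring.
rewrite bBe in bB.
have rGG : (1 + r1) * G ^+ 2 <= X * K by rewrite ler_pM// exprn_ge0.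
have rGGZ : (1 + r1) * G ^+ 2 * Z <= X * K * (46 * (K ^+ 3 * X ^+ 5)).
  by rewrite ler_pM// mulr_ge0// exprn_ge0.
have rGGZe : X * K * (46 * (K ^+ 3 * X ^+ 5)) = 46 * (K ^+ 4 * X ^+ 6) by ring.
have GW : G * W <= K * (5 * (K ^+ 1 * X ^+ 2)) by rewrite ler_pM.
have GWe : K * (5 * (K ^+ 1 * X ^+ 2)) = 5 * (K ^+ 2 * X ^+ 2) by ring.
have e0 : 0 <= e by rewrite addr_ge0// !mulr_ge0 ?exprn_ge0.
have eB : e <= 56 * (K ^+ 4 * X ^+ 6).
  have := mono 2%N 2%N 4%N 6%N isT isT; rewrite /e; lra.
have bb : b * b <= 7 * (K ^+ 2 * X ^+ 3) * (7 * (K ^+ 2 * X ^+ 3)) by rewrite ler_pM.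
have bbe : 7 * (K ^+ 2 * X ^+ 3) * (7 * (K ^+ 2 * X ^+ 3)) = 49 * (K ^+ 4 * X ^+ 6) by ring.
have ae : a * e <= 3 * (K ^+ 2 * X ^+ 2) * (56 * (K ^+ 4 * X ^+ 6)) by rewrite ler_pM.
have aee : 3 * (K ^+ 2 * X ^+ 2) * (56 * (K ^+ 4 * X ^+ 6)) = 168 * (K ^+ 6 * X ^+ 8) by ring.
have := mono 4%N 6%N 6%N 8%N isT isT; rewrite [b ^+ 2]expr2 -mulrA; lra.
Qed.

(** * Parameters on segments of the ball *)

Section ball.
Variable R : realType.

(** A point of the segment is [A0] plus a convex combination of two deviations, both of operator
    norm at most [rho]. *)
Lemma enorm_mul_segment p q (A A' A0 : 'M[R]_(p, q)) (rho t : R) x :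
  opnorm (A - A0) <= rho -> opnorm (A' - A0) <= rho -> 0 <= t <= 1 ->
  enorm ((A + t *: (A' - A)) *m x) <= enorm (A0 *m x) + rho * enorm x.
Proof.
move=> h h' /andP[t0 t1].
have -> : (A + t *: (A' - A)) *m x =
    A0 *m x + ((1 - t) *: ((A - A0) *m x) + t *: ((A' - A0) *m x)).
  rewrite !scalemxAl -!mulmxDl; congr (_ *m _).
  by apply/matrixP => i j; rewrite !mxE; ring.
apply: (le_trans (enormD _ _)); rewrite lerD2l.
apply: (le_trans (enormD _ _)); rewrite !enormZ (ger0_norm t0) ger0_norm ?subr_ge0//.
have e1 : enorm ((A - A0) *m x) <= rho * enorm x.
  by apply: (le_trans (enorm_mul_opnorm _ _)); rewrite ler_wpM2r ?enorm_ge0.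
have e2 : enorm ((A' - A0) *m x) <= rho * enorm x.
  by apply: (le_trans (enorm_mul_opnorm _ _)); rewrite ler_wpM2r ?enorm_ge0.
have -> : rho * enorm x = (1 - t) * (rho * enorm x) + t * (rho * enorm x) by ring.
by apply: lerD; rewrite ler_wpM2l// subr_ge0.
Qed.

Lemma enorm_segment p (v v' v0 : 'cV[R]_p) (rho t : R) :
  enorm (v - v0) <= rho -> enorm (v' - v0) <= rho -> 0 <= t <= 1 ->
  enorm (v + t *: (v' - v)) <= enorm v0 + rho.
Proof.
move=> h h' /andP[t0 t1].
have -> : v + t *: (v' - v) = v0 + ((1 - t) *: (v - v0) + t *: (v' - v0)).
  by apply/matrixP => i j; rewrite !mxE; ring.
apply: (le_trans (enormD _ _)); rewrite lerD2l.
apply: (le_trans (enormD _ _)); rewrite !enormZ (ger0_norm t0) ger0_norm ?subr_ge0//.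
have -> : rho = (1 - t) * rho + t * rho by ring.
by apply: lerD; rewrite ler_wpM2l// subr_ge0.
Qed.

Lemma sum_inj_le (I J : finType) (e : J -> I) (F : I -> R) : injective e ->
  (forall i, 0 <= F i) -> \sum_j F (e j) <= \sum_i F i.
Proof.
move=> ei F0; rewrite [leRHS](bigID (mem (e @: [set: J])%SET)) /=.
rewrite big_imset /=; last by move=> j k _ _; exact: ei.
rewrite [X in _ <= X + _](eq_bigl xpredT) => [|j]; last by rewrite inE.
by rewrite lerDl sumr_ge0.
Qed.

Variables (m d L : nat).
Implicit Type dl : param R m d L.

Lemma pnorm2_ge0 dl : 0 <= pnorm2 dl.
Proof. by apply: sumr_ge0 => i _; exact: sqr_ge0. Qed.

Lemma frob2_W_le dl l : frob2 (W_of dl l) <= pnorm2 dl.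
Proof.
rewrite /frob2 pair_bigA /=; under eq_bigr do rewrite mxE.
apply: (@sum_inj_le _ _ (fun z : 'I_m * 'I_m => inl (inr (l, z.1, z.2)) : pidx m d L)
  (fun c => dl c ^+ 2)); last by move=> i; exact: sqr_ge0.
by move=> [i j] [i' j'] [-> ->].
Qed.

Lemma frob2_R_le dl l : frob2 (R_of dl l) <= pnorm2 dl.
Proof.
rewrite /frob2 pair_bigA /=; under eq_bigr do rewrite mxE.
apply: (@sum_inj_le _ _ (fun z : 'I_m * 'I_m => inr (inl (l, z.1, z.2)) : pidx m d L)
  (fun c => dl c ^+ 2)); last by move=> i; exact: sqr_ge0.
by move=> [i j] [i' j'] [-> ->].
Qed.

Lemma frob2_W1_le dl : frob2 (W1_of dl) <= pnorm2 dl.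
Proof.
rewrite /frob2 pair_bigA /=; under eq_bigr do rewrite mxE.
apply: (@sum_inj_le _ _ (fun z : 'I_m * 'I_d => inl (inl (z.1, z.2)) : pidx m d L)
  (fun c => dl c ^+ 2)); last by move=> i; exact: sqr_ge0.
by move=> [i j] [i' j'] [-> ->].
Qed.

Lemma enorm_v_le dl : enorm (v_of dl) <= Num.sqrt (pnorm2 dl).
Proof.
rewrite /enorm; apply: ler_wsqrtr; under eq_bigr do rewrite mxE.
apply: (@sum_inj_le _ _ (fun z : 'I_m => inr (inr z) : pidx m d L)
  (fun c => dl c ^+ 2)); last by move=> i; exact: sqr_ge0.
by move=> i i' [->].
Qed.

End ball.

(** The condition on scales and radii enters here: it bounds the gain of a layer by 1 when
    [gam = 1], and a larger [gam] is harmless because it multiplies the radii as well. *)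
Lemma layer_gain_le (R : realType) (gam sw sr rw rr s : R) : 1 <= gam -> 0 < s ->
  0 <= rw -> 0 <= rr -> sw + sr <= 1 - (rw + rr) / s ->
  gam * sw * s + rw + (gam * sr * s + rr) <= gam * s.
Proof.
move=> gam1 s0 rw0 rr0 hs.
have h2 : (sw + sr) * s + (rw + rr) <= s.
  have := ler_wpM2r (ltW s0) hs; rewrite mulrBl mul1r divfK ?gt_eqF//; lra.
have h3 : gam * ((sw + sr) * s + (rw + rr)) <= gam * s by rewrite ler_wpM2l// (le_trans ler01).
have h4 : rw + rr <= gam * (rw + rr) by rewrite ler_peMl// addr_ge0.
lra.
Qed.

(** The factor 1 / s cancels the size s of the activations; the derivatives of the hidden layer are
    already free of s, and for them only 1 / s <= 1 is used. *)
Lemma out_le (R : realType) (m : nat) (v dv a da dda : 'cV[R]_m) (s r1 G U D W Z : R) :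
  1 <= s -> 0 <= r1 -> 0 <= G -> 0 <= U -> 0 <= D -> 0 <= W -> 0 <= Z ->
  enorm v <= 1 + r1 -> enorm dv <= D -> enorm a <= G * U * s -> enorm da <= G * D * W ->
  enorm dda <= G ^+ 2 * D ^+ 2 * Z ->
  [/\ `|s^-1 * cdot v a| <= (1 + r1) * G * U,
      `|s^-1 * (cdot v da + cdot dv a)| <= G * ((1 + r1) * W + U) * D &
      `|s^-1 * (cdot v dda + 2 * cdot dv da)| <= ((1 + r1) * G ^+ 2 * Z + 2 * (G * W)) * D ^+ 2].
Proof.
move=> s1 r10 G0 U0 D0 W0 Z0 vu vdl j1 j2 j3.
have s0 : 0 < s by exact: lt_le_trans ltr01 s1.
have si0 : 0 < s^-1 by rewrite invr_gt0.
have si1 : s^-1 <= 1 by rewrite invf_le1.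
have r1p : 0 <= 1 + r1 by rewrite addr_ge0.
have cs z : s^-1 * (z * s) = z by rewrite mulrCA mulVf ?mulr1// gt_eqF.
have cl z : 0 <= z -> s^-1 * z <= z by move=> z0; rewrite ler_piMl.
have cd (x y : 'cV[R]_m) p q : enorm x <= p -> enorm y <= q -> `|cdot x y| <= p * q.
  by move=> hx hy; apply: (le_trans (cdot_le _ _)); apply: ler_pM; rewrite ?enorm_ge0.
rewrite !normrM (ger0_norm (ltW si0)); split.
- apply: (@le_trans _ _ (s^-1 * ((1 + r1) * (G * U * s)))).
    by rewrite ler_pM2l//; exact: cd.
  by rewrite mulrA cs mulrA.
- apply: (@le_trans _ _ (s^-1 * ((1 + r1) * (G * D * W) + D * (G * U * s)))).
    by rewrite ler_pM2l//; apply: (le_trans (ler_normD _ _)); apply: lerD; exact: cd.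
  rewrite mulrDr [D * (G * U * s)]mulrA cs.
  have p0 : 0 <= (1 + r1) * (G * D * W) by rewrite !mulr_ge0.
  apply: (le_trans (lerD (cl _ p0) (lexx _))); rewrite le_eqVlt; apply/orP; left; apply/eqP; ring.
- have p0 : 0 <= (1 + r1) * (G ^+ 2 * D ^+ 2 * Z) + 2 * (D * (G * D * W)).
    by rewrite addr_ge0 ?mulr_ge0 ?sqr_ge0.
  apply: (@le_trans _ _ (s^-1 * ((1 + r1) * (G ^+ 2 * D ^+ 2 * Z) + 2 * (D * (G * D * W))))).
    rewrite ler_pM2l//; apply: (le_trans (ler_normD _ _)); apply: lerD; first exact: cd.
    by rewrite normrM ger0_norm// ler_pM2l//; exact: cd.
  apply: (le_trans (cl _ p0)); rewrite le_eqVlt; apply/orP; left; apply/eqP; ring.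
Qed.

(** Deterministic half of the argument. The resulting constant does not mention the width: the gain
    of the layers enters only through [Kc], with exponent 2 L because second derivatives contain
    squares of first derivatives. *)
Lemma fno_smooth (R : realType) (m d L n K : nat) (phi : R -> R)
    (alpha0 : 'I_n -> 'I_K -> 'cV[R]_d) (y : 'I_n -> 'I_K -> R)
    (beta_phi sw sr rw rr r1 gam C1 Y Kc : R) (th0 : param R m d L) :
  (forall i r, enorm (alpha0 i r) = Num.sqrt d%:R) ->
  (forall a b, `|phi a - phi b| <= `|a - b|) ->
  (forall x, derivable phi x 1) ->
  (forall x, derivable (derive1 phi) x 1) ->
  (forall x, `|derive1 (derive1 phi) x| <= beta_phi) ->
  (0 < m)%N -> 0 < sw -> 0 < sr -> 0 <= rw -> 0 <= rr -> 0 <= r1 ->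
  sw + sr <= 1 - (rw + rr) / Num.sqrt m%:R ->
  1 <= gam -> 0 <= C1 ->
  (forall l x, enorm (W_of th0 l *m x) <= gam * sw * Num.sqrt m%:R * enorm x) ->
  (forall l x, enorm (R_of th0 l *m x) <= gam * sr * Num.sqrt m%:R * enorm x) ->
  (forall x, enorm (W1_of th0 *m x) <= C1 * Num.sqrt m%:R * enorm x) ->
  enorm (v_of th0) <= 1 ->
  0 <= Y -> (forall i r, `|y i r| <= Y) ->
  1 <= Kc -> gam ^+ (2 * L) <= Kc -> (C1 + 1) * Num.sqrt d%:R + `|phi 0| <= Kc ->
  beta_phi <= Kc -> beta_phi * d%:R <= Kc -> Y <= Kc ->
  smooth_on_ball (fno_loss phi alpha0 y)
    (434 * Kc ^+ 6 * (1 + L%:R + rw + rr + r1) ^+ 8) rw rr r1 th0.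
Proof.
move=> ha lip dphi ddphi bphi m0 sw0 sr0 rw0 rr0 r10 hs gam1 C10 hW hR hW1 hv Y0 hY.
move=> Kc1 KcG KcC Kcb Kcbd KcY.
set s := Num.sqrt m%:R in hs hW hR hW1 *.
have s1 : 1 <= s.
  by rewrite -[leLHS]sqrtr1; apply: ler_wsqrtr; rewrite ler1n.
have s0 : 0 < s by exact: lt_le_trans ltr01 s1.
have si0 : 0 < s^-1 by rewrite invr_gt0.
have si1 : s^-1 <= 1 by rewrite invf_le1.
set X := 1 + L%:R + rw + rr + r1.
have L0 : 0 <= L%:R :> R by [].
have X1 : 1 <= X by rewrite /X; lra.
have be0 : 0 <= beta_phi by exact: le_trans (normr_ge0 _) (bphi 0).
have c00 : 0 <= `|phi 0| by [].
have sd0 : 0 <= Num.sqrt d%:R :> R by exact: sqrtr_ge0.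
have Cd0 : 0 <= C1 * Num.sqrt d%:R by rewrite mulr_ge0.
(* Sizes up to powers of [gam]: [A] for the first layer and [U] for all activations, both divided by
   sqrt m; [W] and [Z] for first and second derivatives along a unit direction. *)
pose c0 := `|phi 0|; pose A := c0 + (C1 + rw) * Num.sqrt d%:R; pose V0 : R := Num.sqrt d%:R.
pose U := A + L%:R * c0; pose W := V0 + 2 * L%:R * U.
pose Z := beta_phi * V0 ^+ 2 + L%:R * (beta_phi * W ^+ 2 + 4 * W).
pose G := gam ^+ L.
pose a := (1 + r1) * G * U + Y; pose b := G * ((1 + r1) * W + U).
pose e := (1 + r1) * G ^+ 2 * Z + 2 * (G * W).
have G2 : G ^+ 2 = gam ^+ (2 * L) by rewrite /G mulnC exprM.
have G1 : 1 <= G by rewrite exprn_ege1.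
have G0 : 0 <= G by exact: le_trans ler01 G1.
have A0 : 0 <= A by rewrite addr_ge0// mulr_ge0// addr_ge0.
have U0 : 0 <= U by rewrite addr_ge0// mulr_ge0.
have W0 : 0 <= W by rewrite addr_ge0// !mulr_ge0.
have Z0 : 0 <= Z.
  by rewrite addr_ge0 ?mulr_ge0 ?sqr_ge0// addr_ge0 ?mulr_ge0 ?sqr_ge0.
have r1p : 0 <= 1 + r1 by rewrite addr_ge0.
have sdK : Num.sqrt d%:R <= Kc by rewrite mulrDl mul1r in KcC; lra.
have cK : c0 <= Kc by rewrite /c0; rewrite mulrDl mul1r in KcC; lra.
have AK : A <= Kc * X.
  have h1 : (C1 + 1) * Num.sqrt d%:R + `|phi 0| <= Kc by [].
  have h2 : A <= ((C1 + 1) * Num.sqrt d%:R + `|phi 0|) * X.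
    have -> : ((C1 + 1) * Num.sqrt d%:R + `|phi 0|) * X =
      `|phi 0| * X + (C1 + 1) * Num.sqrt d%:R * X by ring.
    rewrite /A /c0; apply: lerD.
      by rewrite ler_peMr.
    rewrite mulrAC ler_wpM2r//.
    have : 0 <= C1 * (L%:R + rw + rr + r1) by rewrite mulr_ge0// !addr_ge0.
    rewrite /X; nra.
  by apply: (le_trans h2); rewrite ler_wpM2r// (le_trans ler01).
have const_le : 2 * (b ^+ 2 + a * e) <= 434 * Kc ^+ 6 * X ^+ 8.
  apply: fno_constant_le => //; rewrite ?G2//.
  - by rewrite /X; lra.
  - by rewrite sqr_sqrtr.
  - by rewrite /X; lra.
suff main : smooth_on_ball (fno_loss phi alpha0 y) (2 * (b ^+ 2 + a * e)) rw rr r1 th0.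
  move=> th th' bth bth'; apply: (le_trans (main th th' bth bth')).
  by rewrite lerD2l ler_wpM2r ?pnorm2_ge0// ler_pM2r.
have a0 : 0 <= a by rewrite addr_ge0// !mulr_ge0.
have b0 : 0 <= b by rewrite mulr_ge0// addr_ge0// mulr_ge0.
have e0 : 0 <= e by rewrite addr_ge0 ?mulr_ge0 ?sqr_ge0// mulr_ge0.
apply: smooth_of_output_bounds => // th th' t bth bth' ht i r u D.
set delta := th' - th.
have D0 : 0 <= D by exact: sqrtr_ge0.
have [bW1 [bW [bR bv]]] := bth; have [bW1' [bW' [bR' bv']]] := bth'.
have segE (F : param R m d L -> 'M[R]_m) :
    (forall a x z, F (a *: x + z) = a *: F x + F z) -> F u = F th + t *: (F th' - F th).
  move=> Fl; rewrite /u addrC Fl addrC.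
  have -> : th' - th = (-1) *: th + th' by rewrite scaleN1r addrC.
  by rewrite Fl scaleN1r [- F th + _]addrC.
have Wu l x : enorm (W_of u l *m x) <= (gam * sw * s + rw) * enorm x.
  rewrite (segE (fun z => W_of z l)); last by move=> *; exact: W_of_lin.
  by apply: (le_trans (enorm_mul_segment x (bW l) (bW' l) ht)); rewrite mulrDl lerD2r.
have Ru l x : enorm (R_of u l *m x) <= (gam * sr * s + rr) * enorm x.
  rewrite (segE (fun z => R_of z l)); last by move=> *; exact: R_of_lin.
  by apply: (le_trans (enorm_mul_segment x (bR l) (bR' l) ht)); rewrite mulrDl lerD2r.
have W1u x : enorm (W1_of u *m x) <= (C1 * s + rw) * enorm x.
  have -> : W1_of u = W1_of th + t *: (W1_of th' - W1_of th).
    rewrite /u addrC W1_of_lin addrC (_ : th' - th = (-1) *: th + th'); last by rewrite scaleN1r addrC.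
    by rewrite W1_of_lin scaleN1r [- _ + W1_of th']addrC.
  by apply: (le_trans (enorm_mul_segment x bW1 bW1' ht)); rewrite mulrDl lerD2r.
have vu : enorm (v_of u) <= 1 + r1.
  have -> : v_of u = v_of th + t *: (v_of th' - v_of th).
    rewrite /u addrC v_of_lin addrC (_ : th' - th = (-1) *: th + th'); last by rewrite scaleN1r addrC.
    by rewrite v_of_lin scaleN1r [- _ + v_of th']addrC.
  by apply: (le_trans (enorm_segment bv bv' ht)); rewrite lerD2r.
(* Every weight block is part of [delta], so its Frobenius norm, hence its operator norm, is at most
   the length [D] of [delta]. *)
have frobD p q (B : 'M[R]_(p, q)) x : frob2 B <= pnorm2 delta -> enorm (B *m x) <= D * enorm x.
  move=> h; apply: (le_trans (enorm_mul_sqrt_frob2 _ _)).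
  by rewrite ler_wpM2r ?enorm_ge0// ler_wsqrtr.
have Mth l x : enorm (layer_mx l u *m x) <= gam * enorm x.
  rewrite /layer_mx -scalemxAl enormZ -/s ger0_norm ?(ltW si0)// mulmxDl fourier_mxE.
  rewrite mulrC ler_pdivrMr//; apply: (le_trans (enormD _ _)).
  have h1 : 0 <= gam * sr * s + rr by rewrite addr_ge0 ?mulr_ge0// ltW// (lt_le_trans ltr01).
  apply: (le_trans (lerD (Wu l x) (fourier_term_le m0 x h1 (Ru l)))).
  rewrite -mulrDl [leRHS]mulrAC; apply: ler_wpM2r; first exact: enorm_ge0.
  exact: layer_gain_le.
have Mdl l x : enorm (layer_mx l delta *m x) <= 2 * D / s * enorm x.
  rewrite /layer_mx -scalemxAl enormZ -/s ger0_norm ?(ltW si0)// mulmxDl fourier_mxE.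
  rewrite [2 * D / s]mulrC -mulrA ler_pM2l//; apply: (le_trans (enormD _ _)).
  have h1 x' := frobD _ _ _ x' (frob2_R_le delta l).
  have := lerD (frobD _ _ _ x (frob2_W_le delta l)) (fourier_term_le m0 x D0 h1).
  move=> /le_trans; apply; rewrite le_eqVlt; apply/orP; left; apply/eqP; ring.
have M0th : enorm (input_mx u *m alpha0 i r) + c0 * s <= A * s.
  rewrite /input_mx -scalemxAl enormZ -/s ger0_norm ?(ltW si0)//.
  have h1 : s^-1 * enorm (W1_of u *m alpha0 i r) <= (C1 + rw) * Num.sqrt d%:R.
    rewrite mulrC ler_pdivrMr//; apply: (le_trans (W1u _)); rewrite ha [leRHS]mulrAC; apply: ler_wpM2r => //.
    by rewrite mulrDl lerD2l ler_peMr.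
  have h2 : (C1 + rw) * Num.sqrt d%:R <= (C1 + rw) * Num.sqrt d%:R * s.
    by rewrite ler_peMr// mulr_ge0// addr_ge0.
  rewrite /A mulrDl addrC lerD2l; exact: le_trans h1 h2.
have M0dl : enorm (input_mx delta *m alpha0 i r) <= D * V0.
  rewrite /input_mx -scalemxAl enormZ -/s ger0_norm ?(ltW si0)//.
  apply: (@le_trans _ _ (enorm (W1_of delta *m alpha0 i r))).
    by rewrite ler_piMl ?enorm_ge0.
  by rewrite /V0 -(ha i r); apply: frobD; exact: frob2_W1_le.
have vdl : enorm (v_of delta) <= D by exact: enorm_v_le.
have szL : size (enum 'I_L) = L by rewrite size_enum_ord.
have := @net_jet_bound R phi beta_phi _ m d 'I_L (@layer_mx R m d L) (@input_mx R m d L)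
  u delta (alpha0 i r) gam D s A V0 U W lip dphi bphi gam1 D0 s1 erefl U0 sd0 W0
  Mth Mdl M0th M0dl (enum 'I_L).
rewrite szL => /(_ (lexx _) (lexx _)) [j1 j2 j3].
rewrite -/c0 -/U -/G in j1; rewrite -/W -/G in j2; rewrite -/Z -G2 in j3.
have [q0 q1 q2] := out_le s1 r10 G0 U0 D0 W0 Z0 vu vdl j1 j2 j3.
rewrite (net_jet_val (@layer_mx_lin R m d L) (@input_mx_lin R m d L)) in q0.
split; [|exact: q1|exact: q2].
by apply: (le_trans (ler_normB _ _)); apply: lerD; [exact: q0|exact: hY].
Qed.

(** * Norm bounds at initialization *)

Section initialization_events.
Context dT (T : measurableType dT) (R : realType) (P : probability T R).

Lemma setC_setI_le (A B : set T) (a b : R) : measurable A -> measurable B ->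
  (P (~` A) <= a%:E)%E -> (P (~` B) <= b%:E)%E -> (P (~` (A `&` B)) <= (a + b)%:E)%E.
Proof.
move=> mA mB hA hB; rewrite setCI EFinD.
have h := @measureU2 _ _ _ P _ _ (measurableC mA) (measurableC mB).
exact: le_trans h (leeD hA hB).
Qed.

Lemma finite_inter_event (J : eqType) (s : seq J) (S : J -> set T) (e : R) :
  (forall j, measurable (S j)) -> (forall j, P (~` S j) <= e%:E)%E ->
  exists E : set T, [/\ measurable E, (P (~` E) <= ((size s)%:R * e)%:E)%E &
    forall w, E w -> forall j, j \in s -> S j w].
Proof.
move=> mS hS; elim: s => [|j s [E [mE PE hE]]].
  by exists setT; split => //; rewrite setCT measure0 mul0r.
exists (S j `&` E); split.
- exact: measurableI.
- by rewrite /= -natr1 mulrDl mul1r addrC; exact: setC_setI_le.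
- by move=> w [Sj Ew] k; rewrite inE => /predU1P[->//|]; exact: hE.
Qed.

Lemma sigma0_gt0 m (s : R) : 0 < s -> 0 < sigma0 m s.
Proof.
move=> s0; rewrite /sigma0 -/(dev R m).
by rewrite divr_gt0// mulr_gt0// ltr_pwDl// dev_ge0.
Qed.

Lemma sigma0_le m (s : R) : 0 < s -> sigma0 m s <= s.
Proof.
move=> s0; rewrite /sigma0 -/(dev R m) ler_piMr ?(ltW s0)//.
have := dev_ge0 R m => h; rewrite invf_le1; last by rewrite mulr_gt0// ltr_pwDl.
lra.
Qed.

Variables (m d L : nat) (sw sr : R) (X : pidx m d L -> T -> R).
Hypothesis sw0 : 0 < sw.
Hypothesis sr0 : 0 < sr.
Hypothesis m0 : (0 < m)%N.
Hypothesis mX : forall c, measurable_fun setT (X c).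
Hypothesis indX : mutually_independent P X.
Let sg (c : pidx m d L) := init_std sw sr c.
Hypothesis lawX : forall c (B : set R), measurable B -> P (X c @^-1` B) = normal_prob 0 (sg c) B.

Let sg0 c : 0 < sg c.
Proof. by case: c => [c|[c|c]] /=; rewrite ?ltr01// sigma0_gt0. Qed.

Lemma W_norm_event (gam : R) k (l : 'I_L) : 0 <= gam ->
  m%:R ^+ 2 * expR (moment_exponent R m (2 ^ k.+1)) <= (gam * (1 + dev R m)) ^+ (2 * 2 ^ k.+1) ->
  exists S : set T, [/\ measurable S, (P (~` S) <= (m%:R^-1)%:E)%E &
    forall w, S w -> forall x, enorm (W_of (theta0_of X w) l *m x) <=
      gam * sw * Num.sqrt m%:R * enorm x].
Proof.
move=> g0 hg; pose emb (i j : 'I_m) : pidx m d L := inl (inr (l, i, j)).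
have ei i j i' j' : emb i j = emb i' j' -> i = i' /\ j = j' by case=> -> ->.
have se i j : sg (emb i j) = sigma0 m sw by [].
have [S [mS PS hS]] := random_matrix_norm_event ei mX indX sg0 lawX se m0 sw0 g0 erefl hg.
exists S; split => // w Sw x; have := hS w Sw x.
by congr (enorm (_ *m _) <= _); apply/matrixP => i j; rewrite !mxE ffunE.
Qed.

Lemma R_norm_event (gam : R) k (l : 'I_L) : 0 <= gam ->
  m%:R ^+ 2 * expR (moment_exponent R m (2 ^ k.+1)) <= (gam * (1 + dev R m)) ^+ (2 * 2 ^ k.+1) ->
  exists S : set T, [/\ measurable S, (P (~` S) <= (m%:R^-1)%:E)%E &
    forall w, S w -> forall x, enorm (R_of (theta0_of X w) l *m x) <=
      gam * sr * Num.sqrt m%:R * enorm x].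
Proof.
move=> g0 hg; pose emb (i j : 'I_m) : pidx m d L := inr (inl (l, i, j)).
have ei i j i' j' : emb i j = emb i' j' -> i = i' /\ j = j' by case=> -> ->.
have se i j : sg (emb i j) = sigma0 m sr by [].
have [S [mS PS hS]] := random_matrix_norm_event ei mX indX sg0 lawX se m0 sr0 g0 erefl hg.
exists S; split => // w Sw x; have := hS w Sw x.
by congr (enorm (_ *m _) <= _); apply/matrixP => i j; rewrite !mxE ffunE.
Qed.

(** [d] is fixed and this layer is not iterated, so the Frobenius norm is precise enough: its square
    has mean sigma0^2 m d and exceeds it by at most sigma0^2 m (d + 2) outside an event of
    probability 1/m. *)
Lemma W1_norm_event :
  exists S : set T, [/\ measurable S, (P (~` S) <= (m%:R^-1)%:E)%E &
    forall w, S w -> forall x, enorm (W1_of (theta0_of X w) *m x) <=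
      sw * Num.sqrt (2 * d%:R + 2) * Num.sqrt m%:R * enorm x].
Proof.
pose e (z : 'I_m * 'I_d) : pidx m d L := inl (inl (z.1, z.2)).
have ei : injective e by move=> [i j] [i' j'] [-> ->].
set s := sigma0 m sw; have s0 : 0 < s by exact: sigma0_gt0.
have se z : sg (e z) = s by [].
have mR : 0 < m%:R :> R by rewrite ltr0n.
have dR : 0 <= d%:R :> R by [].
(* [d + 1] in place of [d] keeps [a] positive when d = 0. *)
pose a : R := 2 * s ^+ 2 * (s ^+ 2 * (m%:R * (d%:R + 1))).
have a0 : 0 < a.
  by rewrite /a !mulr_gt0 ?exprn_gt0// ltr_wpDl.
have cardE : #|{: 'I_m * 'I_d}|%:R = m%:R * d%:R :> R by rewrite card_prod !card_ord natrM.
have ha : 2 * s ^+ 2 * (s ^+ 2 * #|{: 'I_m * 'I_d}|%:R) <= a.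
  rewrite cardE /a ler_pM2l ?mulr_gt0 ?exprn_gt0// ler_pM2l ?exprn_gt0//.
  by rewrite ler_pM2l// lerDl.
have [S [mS PS hS]] := chi_square_event ei mX indX sg0 lawX se m0 a0 ha.
exists S; split => // w Sw x.
have fE : frob2 (W1_of (theta0_of X w)) = \sum_z X (e z) w ^+ 2.
  by rewrite /frob2 pair_bigA; apply: eq_bigr => -[i j] _; rewrite mxE ffunE.
apply: (le_trans (enorm_mul_sqrt_frob2 _ _)); rewrite ler_wpM2r ?enorm_ge0//.
have sw0' : 0 <= sw by exact: ltW.
rewrite -[sw in leRHS]ger0_norm// -sqrtr_sqr -!sqrtrM ?mulr_ge0 ?sqr_ge0 ?addr_ge0 ?mulr_ge0//.
apply: ler_wsqrtr; rewrite fE; apply: (le_trans (hS w Sw)); rewrite cardE.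
have sq : Num.sqrt (a * m%:R) <= s ^+ 2 * (m%:R * (d%:R + 2)).
  have r0 : 0 <= s ^+ 2 * (m%:R * (d%:R + 2)).
    by rewrite mulr_ge0 ?sqr_ge0// mulr_ge0// addr_ge0.
  rewrite -[leRHS]ger0_norm// -sqrtr_sqr; apply: ler_wsqrtr.
  rewrite (_ : a * m%:R = (s ^+ 2 * m%:R) ^+ 2 * (2 * d%:R + 2)); last by rewrite /a; ring.
  rewrite [leRHS](_ : _ = (s ^+ 2 * m%:R) ^+ 2 * (d%:R + 2) ^+ 2); last by ring.
  apply: ler_wpM2l; first exact: sqr_ge0.
  rewrite -subr_ge0 (_ : _ - _ = d%:R ^+ 2 + 2 * d%:R + 2); last by ring.
  by rewrite !addr_ge0 ?sqr_ge0// mulr_ge0.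
apply: (le_trans (lerD (lexx _) sq)).
rewrite (_ : _ + _ = s ^+ 2 * (m%:R * (2 * d%:R + 2))); last by ring.
rewrite -mulrA [(2 * d%:R + 2) * _]mulrC ler_wpM2r ?mulr_ge0 ?addr_ge0 ?mulr_ge0//.
by apply: lerXn2r; rewrite ?nnegrE ?(ltW s0) ?(ltW sw0) ?sigma0_le.
Qed.

(** Stated as an inequality to cover every [w]: for g = 0 the division by [enorm g] returns 0. *)
Lemma enorm_v_theta0 w : enorm (v_of (theta0_of X w)) <= 1.
Proof.
set g : 'cV[R]_m := \col_i X (inr (inr i)) w.
have -> : v_of (theta0_of X w) = (enorm g)^-1 *: g.
  by apply/matrixP => i j; rewrite !mxE ffunE mulrC.
rewrite enormZ ger0_norm ?invr_ge0 ?enorm_ge0//.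
have [->|g0] := eqVneq g 0; first by rewrite enorm0 mulr0.
by rewrite mulVf// gt_eqF// enorm_gt0.
Qed.

Lemma initialization_event (gam : R) k : 0 <= gam ->
  m%:R ^+ 2 * expR (moment_exponent R m (2 ^ k.+1)) <= (gam * (1 + dev R m)) ^+ (2 * 2 ^ k.+1) ->
  exists E : set T, [/\ measurable E,
    ((1 - (2 * (L + 2))%:R / m%:R)%:E <= P E)%E &
    forall w, E w -> let th0 := theta0_of X w in
      [/\ forall l x, enorm (W_of th0 l *m x) <= gam * sw * Num.sqrt m%:R * enorm x,
          forall l x, enorm (R_of th0 l *m x) <= gam * sr * Num.sqrt m%:R * enorm x &
          forall x, enorm (W1_of th0 *m x) <=
            sw * Num.sqrt (2 * d%:R + 2) * Num.sqrt m%:R * enorm x]].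
Proof.
move=> g0 hg.
pose SW l := sval (cid (W_norm_event l g0 hg)).
pose SR l := sval (cid (R_norm_event l g0 hg)).
have hSW l : [/\ measurable (SW l), (P (~` SW l) <= (m%:R^-1)%:E)%E &
    forall w, SW l w -> forall x, enorm (W_of (theta0_of X w) l *m x) <=
      gam * sw * Num.sqrt m%:R * enorm x] := svalP (cid (W_norm_event l g0 hg)).
have hSR l : [/\ measurable (SR l), (P (~` SR l) <= (m%:R^-1)%:E)%E &
    forall w, SR l w -> forall x, enorm (R_of (theta0_of X w) l *m x) <=
      gam * sr * Num.sqrt m%:R * enorm x] := svalP (cid (R_norm_event l g0 hg)).
have [EW [mEW PEW hEW]] := @finite_inter_event _ (enum 'I_L) SW m%:R^-1
  (fun l => let: And3 h _ _ := hSW l in h) (fun l => let: And3 _ h _ := hSW l in h).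
have [ER [mER PER hER]] := @finite_inter_event _ (enum 'I_L) SR m%:R^-1
  (fun l => let: And3 h _ _ := hSR l in h) (fun l => let: And3 _ h _ := hSR l in h).
have [E1 [mE1 PE1 hE1]] := W1_norm_event.
have mE : measurable (EW `&` ER `&` E1) by apply: measurableI => //; exact: measurableI.
exists (EW `&` ER `&` E1); split => //.
  have := setC_setI_le (measurableI _ _ mEW mER) mE1 (setC_setI_le mEW mER PEW PER) PE1.
  rewrite probability_setC// => h.
  have PF : P (EW `&` ER `&` E1) \is a fin_num by rewrite fin_num_measure.
  rewrite -(fineK PF) -EFinB lee_fin in h; rewrite -(fineK PF) lee_fin.
  move: h; rewrite size_enum_ord => h.
  (* The 2 L + 1 events leave a slack of 3 / m in the claimed probability. *)
  have e : (2 * (L + 2))%:R / m%:R = L%:R * m%:R^-1 + L%:R * m%:R^-1 + 4 * m%:R^-1 :> R.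
    by rewrite natrM natrD; ring.
  have i0 : 0 <= (m%:R : R)^-1 by rewrite invr_ge0.
  rewrite e; lra.
move=> w [[EWw ERw] E1w]; split => [l x|l x|x].
- by have [_ _ h] := hSW l; apply: h; apply: hEW; rewrite ?mem_enum.
- by have [_ _ h] := hSR l; apply: h; apply: hER; rewrite ?mem_enum.
- exact: hE1.
Qed.

End initialization_events.

Unset Implicit Arguments.

Theorem theorem5 (R : realType) (d n K : nat)
    (alpha0 : 'I_n -> 'I_K -> 'cV[R]_d) (y : 'I_n -> 'I_K -> R)
    (phi : R -> R) (beta_phi sigma1w sigma1r : R) :
  (forall i r, enorm (alpha0 i r) = Num.sqrt d%:R) ->
  (forall a b, `|phi a - phi b| <= `|a - b|) ->
  (forall x, derivable phi x 1) ->
  (forall x, derivable (derive1 phi) x 1) ->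
  (forall x, `|derive1 (derive1 phi) x| <= beta_phi) ->
  0 < sigma1w -> 0 < sigma1r ->
  exists (C : R) (k : nat), 0 < C /\
  forall (m L : nat) (rho_w rho_r rho_1 : R),
    (0 < m)%N -> 0 <= rho_w -> 0 <= rho_r -> 0 <= rho_1 ->
    sigma1w + sigma1r <= 1 - (rho_w + rho_r) / Num.sqrt m%:R ->
    let beta := C * (1 + L%:R + rho_w + rho_r + rho_1) ^+ k in
    forall (dT : measure_display) (T : measurableType dT) (P : probability T R)
           (X : pidx m d L -> T -> R),
      (forall c, measurable_fun setT (X c)) ->
      mutually_independent P X ->
      (forall c (B : set R), measurable B ->
         P (X c @^-1` B) = normal_prob 0 (init_std (m:=m) (d:=d) (L:=L) sigma1w sigma1r c) B) ->
      exists E : set T, measurable E /\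
        E `<=` [set w | smooth_on_ball (fno_loss phi alpha0 y) beta rho_w rho_r rho_1
                          (theta0_of X w)] /\
        ((1 - (2 * (L + 2))%:R / m%:R)%:E <= P E)%E.
Proof.
move=> ha lip dphi ddphi bphi sw0 sr0.
have [m0 [kap [kap1 hk]]] := exists_gain R.
pose C1 : R := sigma1w * Num.sqrt (2 * d%:R + 2).
pose Y : R := \sum_i \sum_r `|y i r|.
have be0 : 0 <= beta_phi by exact: le_trans (normr_ge0 _) (bphi 0).
have Y0 : 0 <= Y by apply: sumr_ge0 => i _; apply: sumr_ge0.
have C10 : 0 <= C1 by rewrite mulr_ge0 ?sqrtr_ge0// ltW.
have hY i r : `|y i r| <= Y.
  rewrite /Y (bigD1 i)//= (bigD1 r)//= -addrA lerDl addr_ge0 ?sumr_ge0// => j _.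
  exact: sumr_ge0.
have k0 : 0 <= kap ^+ m0 by rewrite exprn_ge0// (le_trans ler01).
have t0 : 0 <= (C1 + 1) * Num.sqrt d%:R + `|phi 0|.
  by rewrite addr_ge0// mulr_ge0 ?sqrtr_ge0// addr_ge0.
have bd0 : 0 <= beta_phi * d%:R by rewrite mulr_ge0.
(* One constant for all bounds, fixed before the width, the depth and the radii; [kap ^+ m0] covers
   the powers of the gain at small widths. *)
have [Kc [Kc1 KcG KcC Kcb [Kcbd KcY]]] : exists Kc, [/\ 1 <= Kc, kap ^+ m0 <= Kc,
    (C1 + 1) * Num.sqrt d%:R + `|phi 0| <= Kc, beta_phi <= Kc &
    beta_phi * d%:R <= Kc /\ Y <= Kc].
  exists (1 + kap ^+ m0 + ((C1 + 1) * Num.sqrt d%:R + `|phi 0|) + beta_phi + beta_phi * d%:R + Y).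
  by split; [| | | |split]; lra.
have C0 : 0 < 434 * Kc ^+ 6.
  apply: mulr_gt0; first by rewrite ltr0n.
  by apply: exprn_gt0; exact: lt_le_trans ltr01 Kc1.
exists (434 * Kc ^+ 6), 8%N; split; first exact: C0.
move=> m L rho_w rho_r rho_1 mgt0 rw0 rr0 r10 hs beta dT T P X mX indX lawX.
have mR : 0 < m%:R :> R by rewrite ltr0n.
have [hm|hm] := leqP m (2 * (L + 2)).
  (* The claimed probability is at most 0 here, so the empty event suffices. *)
  exists set0; split; [exact: measurable0|split; first by []].
  rewrite measure0 lee_fin subr_le0 ler_pdivlMr// mul1r ler_nat //.
have [k hg] := hk m mgt0.
set gam := (if _ then _ else _) in hg.
have gam1 : 1 <= gam by rewrite /gam; case: ifP.
have gam0 : 0 <= gam by exact: le_trans ler01 gam1.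
have gamL : gam ^+ (2 * L) <= kap ^+ m0.
  (* The gain [kap] occurs only for m < m0, and then 2 L < m keeps the exponent below m0. *)
  rewrite /gam; case: leqP => m0m; first by rewrite expr1n exprn_ege1.
  apply: ler_weXn2l; first exact: kap1.
  apply: leq_trans (ltnW m0m); apply: leq_trans (ltnW hm).
  by rewrite leq_mul2l leq_addr orbT.
have [E [mE PE hE]] := initialization_event sw0 sr0 mgt0 mX indX lawX gam0 hg.
exists E; split; [exact: mE|split; last exact: PE] => w Ew.
have [h1 h2 h3] := hE w Ew.
exact: (fno_smooth ha lip dphi ddphi bphi mgt0 sw0 sr0 rw0 rr0 r10 hs gam1 C10 h1 h2 h3
  (enorm_v_theta0 X w) Y0 hY Kc1 (le_trans gamL KcG) KcC Kcb Kcbd KcY).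
Qed.
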